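(* Let $n\ge 2$ and let $O_n$ denote the $n\times n$ zero matrix. Then, for $T\ge 1$, $$\tau_n(T,O_n)=c_{O_n}T^{n^2}+O(T^{n^2-1}),$$ where the implied constant depends only on $n$ and $c_{O_n}$ is the positive constant $$c_{O_n}=2^{n^2+1}+\sum_{r=1}^{n-1}\ \sum_{\Lambda\in\mathcal{P}_{n,r}}\frac{\nu_\Lambda^n\,\nu_{\Lambda^\perp}^n}{\det(\Lambda)^{2n}}.$$
   Context: For a matrix $A=(a_{ij})$, $|A|=\max_{i,j}|a_{ij}|$, and $$\tau_n(T,M)=\#\{(A,B)\in\mathcal{M}_n(\mathbb{Z})^2:\ |A|,|B|\le T,\ AB=M\},$$ where $\mathcal{M}_n(\mathbb{Z})$ is the set of $n\times n$ integer matrices. $\mathcal{P}_{n,r}$ is the set of primitive lattices of rank $r$ in $\mathbb{Z}^n$, i.e. rank $r$ subgroups $\Lambda\subset\mathbb{Z}^n$ with $\Lambda=\langle\Lambda\rangle_{\mathbb{Q}}\cap\mathbb{Z}^n$, where $\langle\Lambda\rangle_R$ is the $R$-span of $\Lambda$. $\det(\Lambda)$ is the $r$-dimensional Euclidean covolume of $\Lambda$ in $\langle\Lambda\rangle_{\mathbb{R}}$. The orthogonal lattice of $\Lambda$ is $\Lambda^\perp=\mathbb{Z}^n\cap V^\perp$, where $V^\perp\subset\mathbb{Q}^n$ is the orthogonal complement of $V=\langle\Lambda\rangle_{\mathbb{Q}}$. For a subspace $W\subset\mathbb{R}^n$, $\mu_W$ is the Lebesgue (Haar) measure on $W$ induced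 by the Euclidean structure of $\mathbb{R}^n$ (the Euclidean unit ball of $W$ has its usual volume), and $\nu_\Lambda=\mu_{\langle\Lambda\rangle_{\mathbb{R}}}\left(\langle\Lambda\rangle_{\mathbb{R}}\cap[-1,1]^n\right)$. *)

(* Defs.v *)
From mathcomp Require Import all_boot all_order all_algebra finmap.
From mathcomp Require Import all_classical all_reals all_analysis.

Set Implicit Arguments.
Unset Strict Implicit.
Unset Printing Implicit Defensive.

Import Order.TTheory GRing.Theory Num.Theory.
Import numFieldNormedType.Exports.
Local Open Scope classical_set_scope.
Local Open Scope ring_scope.

Definition maxnorm (n : nat) (A : 'M[int]_n) : nat :=
  \max_(i < n) \max_(j < n) `|A i j|%N.

(* [fset_set] of an infinite set is empty, but only finitely many integer
   matrices satisfy the bound below. *)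
Definition tau (R : realType) (n : nat) (T : R) (M : 'M[int]_n) : nat :=
  #|` fset_set [set AB : 'M[int]_n * 'M[int]_n |
        [/\ (maxnorm AB.1)%:R <= T, (maxnorm AB.2)%:R <= T
          & AB.1 *m AB.2 = M]] |.

(* The elements of Z^n are row vectors. *)
Definition lspan (F : fieldType) (n : nat) (L : set 'rV[int]_n)
    : set 'rV[F]_n :=
  [set v | exists (m : nat) (B : 'M[int]_(m, n)) (c : 'rV[F]_m),
     (forall i, L (row i B)) /\ v = c *m map_mx intr B].
Arguments lspan F {n} L.

Definition subgroup (n : nat) (L : set 'rV[int]_n) : Prop :=
  L 0 /\ (forall x y, L x -> L y -> L (x - y)).

(* The rows of B form a basis of L over Z. *)
Definition Zbasis (r n : nat) (L : set 'rV[int]_n) (B : 'M[int]_(r, n))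
    : Prop :=
  injective (fun x : 'rV[int]_r => x *m B) /\
  L = range (fun x : 'rV[int]_r => x *m B).

Definition primitive (n r : nat) : set (set 'rV[int]_n) :=
  [set L | [/\ subgroup L, exists B : 'M[int]_(r, n), Zbasis L B
             & L = [set x | lspan rat L (map_mx intr x)]]].

Definition orthlattice (n : nat) (L : set 'rV[int]_n) : set 'rV[int]_n :=
  [set x | forall v, lspan rat L v -> map_mx intr x *m v^T = 0].

(* Lebesgue measure on R^d, as the d-fold product of Lebesgue measure on the
   line: the successor case is the integral of the measures of the sections,
   as in [product_measure1]. This is meaningful for Borel sets A, the only
   ones to which it is applied below. *)
Fixpoint lebesgue_rV (R : realType) (d : nat) : set 'rV[R]_d -> \bar R :=
  match d with
  | 0 => fun A => (\1_A (0 : 'rV[R]_0))%:E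
  | d'.+1 => fun A =>
      (\int[lebesgue_measure]_(x in [set: R])
         lebesgue_rV [set y : 'rV[R]_d' | A (row_mx (x%:M : 'M[R]_1) y)])%E
  end.

Definition orthonormal_basis (R : realType) (n : nat) (W : set 'rV[R]_n)
    (d : nat) (Q : 'M[R]_(d, n)) : Prop :=
  Q *m Q^T = 1%:M /\ W = range (fun x : 'rV[R]_d => x *m Q).

(* For a linear subspace W, transport of Lebesgue measure along the isometry
   R^d -> W given by an orthonormal basis of W; the result does not depend on
   the basis chosen. *)
Definition subspace_measure (R : realType) (n : nat) (W A : set 'rV[R]_n)
    : \bar R :=
  let dQ := xget (Tagged (fun d : nat => 'M[R]_(d, n)) (0 : 'M[R]_(0, n)))
              [set dQ | orthonormal_basis W (tagged dQ)] in
  lebesgue_rV [set x : 'rV[R]_(tag dQ) | A (x *m tagged dQ)].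

Definition parallelepiped (R : realType) (r n : nat) (B : 'M[int]_(r, n))
    : set 'rV[R]_n :=
  [set t *m map_mx intr B | t in
    [set t : 'rV[R]_r | forall i, 0 <= t 0 i < 1]].
Arguments parallelepiped R {r n} B.

(* The covolume is the volume of the fundamental parallelepiped of a Z-basis,
   and does not depend on that basis. *)
Definition latdet (R : realType) (n : nat) (L : set 'rV[int]_n) : R :=
  let rB := xget (Tagged (fun r : nat => 'M[int]_(r, n)) (0 : 'M[int]_(0, n)))
              [set rB | Zbasis L (tagged rB)] in
  fine (subspace_measure (lspan R L) (parallelepiped R (tagged rB))).

Definition nu (R : realType) (n : nat) (L : set 'rV[int]_n) : R :=
  fine (subspace_measure (lspan R L)
    (lspan R L `&` [set x : 'rV[R]_n | forall i, -1 <= x 0 i <= 1])).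

Definition c_zero (R : realType) (n : nat) : \bar R :=
  ((2 ^+ (n ^ 2 + 1))%:E +
   \sum_(1 <= r < n) \esum_(L in @primitive n r)
     (nu R L ^+ n * nu R (orthlattice L) ^+ n / latdet R L ^+ (2 * n))%:E)%E.

(* Main.v *)
From HB Require Import structures.
Require Import Defs.
From mathcomp Require Import all_boot all_order all_algebra finmap.
From mathcomp Require Import all_classical all_reals all_analysis.
From mathcomp Require Import measurable_realfun perm zify ring lra.

Set Implicit Arguments.
Unset Strict Implicit.
Unset Printing Implicit Defensive.

Import Order.TTheory GRing.Theory Num.Theory.
Import numFieldNormedType.Exports.
Local Open Scope classical_set_scope.
Local Open Scope ring_scope.

(** Group the nonzero solutions of [A *m B = 0] by the primitive lattice
    [L = sat A] of all integer vectors in the rational row space of [A].  If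
    [L] has rank [r], the rows of [A] are [n] points of [L] in a cube, the
    columns of [B] are [n] points of [orthlattice L] in a cube, and each of
    these points has about [nu L / latdet L * T ^+ r], respectively
    [nu (orthlattice L) / latdet (orthlattice L) * T ^+ (n - r)], possible
    values.  Since [L] and [orthlattice L] have the same determinant
    ([orth_gram_det]), [L] contributes [main_term R L * T ^+ (n ^ 2)].  The
    solutions with [A = 0] or [B = 0] contribute twice [(2 * T) ^+ (n ^ 2)], and
    those with both ranks positive but [rank A + rank B < n] are negligible.

    The point is to make this uniform in [L].  Choose a basis b_1, ..., b_r of
    [L] such that the product p of the sup norms |b_i| is at most a constant
    times [latdet L] ([reduced_basis]).  By Cramer's rule, the coordinates of a
    vector of [L] of norm at most T then satisfy |x_i| << T / |b_i|
    ([reduced_box]).  This has four consequences, collected in [satset_asymp].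
    The body of the coordinate vectors of norm at most 1, whose volume is
    V = nu L / latdet L ([nu_latdet]), has V << 1 / p.  No matrix of norm at
    most T spans [L] unless every |b_i| << T.  The number of points of [L] of
    norm at most T is V * T ^+ r up to a relative error p / T, because the unit
    cells at these points are caught between two dilates of the body
    ([count_upper], [count_lower]).  Finally, among the matrices with rows in
    [L], those which do not span [L] are rarer by the same factor p / T
    ([cnt_singular]).  Reduced bases of [L] and of its orthogonal lattice have
    comparable p, so the total error at [L] is
    << T ^+ (n ^ 2 - 1) * p ^- (2 * n - 1) ([pairset_asymp]).

    A lattice is determined by its basis, so a sum over lattices is at most a
    sum over all r-tuples of nonzero integer vectors, which is a power of one
    sum over vectors ([lattice_sum_le]).  The sum of |b| ^- s over nonzero b
    converges for s > n.  As 2 * n - 1 > n, both the error terms and the main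
    terms can be summed ([rank_pairs_asymp]).  For s = n and |b| << T the
    sum is << log T, and every power of log T is << T; hence there are
    << T ^+ (r * n + 1) matrices of rank r ([rank_count]).  Ranks r, s >= 1 with
    r + s < n force n >= 3, and then n * (r + s) + 2 <= n ^ 2 - 1, which
    disposes of the remaining pairs ([low_rank_pairs]).

    Behind [nu_latdet] is the fact that the iterated integral [lebesgue_rV] is
    multiplied by |det G| under an invertible linear map G
    ([leb_scales_unit]). *)

(** * Reduction of positive definite integral quadratic forms *)

Definition posdef (r : nat) (M : 'M[int]_r) : Prop :=
  M^T = M /\ forall x : 'rV[int]_r, x != 0 -> 0 < (x *m M *m x^T) 0 0.

Lemma unit_int_sqr (r : nat) (U : 'M[int]_r) : U \in unitmx -> \det U ^+ 2 = 1.
Proof.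
by rewrite unitmxE => /orP[] /eqP ->.
Qed.

Lemma posdef_cong (r : nat) (M U : 'M[int]_r) :
  posdef M -> U \in unitmx -> posdef (U *m M *m U^T).
Proof.
move=> [sM pM] uU; split.
  by rewrite !trmx_mul trmxK sM mulmxA.
move=> x xn0; have := pM (x *m U); rewrite trmx_mul !mulmxA; apply.
apply: contra_neq xn0 => h; by rewrite -[x](mulmxK uU) h mul0mx.
Qed.

Lemma posdef_diag (r : nat) (M : 'M[int]_r) i : posdef M -> 0 < M i i.
Proof.
move=> [_ /(_ (delta_mx 0 i))].
rewrite -rowE trmx_delta -colE !mxE; apply.
by apply/eqP => /matrixP/(_ ord0 i); rewrite !mxE !eqxx.
Qed.

(** Division with nearest remainder, free of fractions: [N * z + a] is the
    remainder of [a] of absolute value at most [N / 2]. *)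
Lemma round_exists (a N : int) : 0 < N -> exists z : int,
  4 * (N * z + a) ^+ 2 <= N ^+ 2.
Proof.
move=> N0; exists (- ((2 * a + N) %/ (2 * N))%Z).
have e := divz_eq (2 * a + N) (2 * N).
have h1 : 0 <= ((2 * a + N) %% (2 * N))%Z by apply: modz_ge0; lia.
have h2 : ((2 * a + N) %% (2 * N))%Z < 2 * N by apply: ltz_pmod; lia.
set q := (_ %/ _)%Z in e *; set m := (_ %% _)%Z in e h1 h2.
have -> : 4 * (N * - q + a) ^+ 2 = (m - N) ^+ 2.
  have -> : m = 2 * a + N - q * (2 * N) by lia.
  ring.
rewrite -subr_ge0 (_ : _ - _ = m * (2 * N - m)); last by ring.
by apply: mulr_ge0; lia.
Qed.

(** The corner entries over the orbit are positive integers, so one of them is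
    least: this is the shortest vector that starts some basis. *)
Lemma min_orbit (r : nat) (M : 'M[int]_r.+1) : posdef M ->
  exists2 U, U \in unitmx & forall V, V \in unitmx ->
    (U *m M *m U^T) 0 0 <= (V *m M *m V^T) 0 0.
Proof.
move=> pM.
pose P k := `[< exists2 U : 'M[int]_r.+1, U \in unitmx &
   (U *m M *m U^T) 0 0 = k%:Z >].
have pos U : U \in unitmx -> 0 <= (U *m M *m U^T) 0 0.
  by move=> uU; apply/ltW/posdef_diag/posdef_cong.
have exP : exists k, P k.
  exists `|(1%:M *m M *m 1%:M^T)%R ord0 ord0|%N; apply/asboolP; exists 1%:M.
    exact: unitmx1.
  by rewrite gez0_abs// pos// unitmx1.
case: (ex_minnP exP) => k /asboolP[U uU Uk] mink; exists U => // V uV.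
rewrite Uk -(gez0_abs (pos V uV)) lez_nat; apply: mink; apply/asboolP.
by exists V => //; rewrite gez0_abs// pos.
Qed.

(** One step of fraction-free elimination: multiply on the left by the block
    matrix with rows [1, 0] and [- w^T, N]. *)
Lemma schur_det (r : nat) (N : int) (w : 'rV[int]_r) (M' : 'M[int]_r) :
  \det (block_mx (N%:M : 'M[int]_1) w w^T M') * N ^+ r =
  N * \det (N *: M' - w^T *m w).
Proof.
have := congr1 (@determinant _ _) (mulmx_block (1%:M : 'M[int]_1) 0 (- w^T) (N%:M : 'M[int]_r)
   (N%:M : 'M[int]_1) w w^T M').
rewrite det_mulmx det_lblock !det_scalar expr1n mul1r mulrC => ->.
rewrite !mul1mx !mul0mx !addr0 !mul_scalar_mx mulNmx mul_mx_scalar addrC subrr.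
by rewrite det_ublock det_scalar1 mulNmx addrC.
Qed.

(** The form [N *: M' - w^T *m w] at [x] is, up to the factor [N], the original
    form at the vector obtained by projecting [x] away from the first basis
    vector and clearing denominators. *)
Lemma schur_posdef (r : nat) (N : int) (w : 'rV[int]_r) (M' : 'M[int]_r) :
  0 < N -> posdef (block_mx (N%:M : 'M[int]_1) w w^T M') ->
  posdef (N *: M' - w^T *m w).
Proof.
move=> N0 [sM pM].
move: sM; rewrite tr_block_mx trmxK => /eq_block_mx[_ _ _ sM'].
split; first by rewrite linearB/= linearZ/= trmx_mul trmxK sM'.
move=> x xn0.
have := pM (row_mx (- (x *m w^T)) (N *: x)).
have -> : row_mx (- (x *m w^T)) (N *: x) != 0.
  apply: contra_neq xn0 => h; have : N *: x = 0.
    by have := congr1 rsubmx h; rewrite row_mxKr linear0.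
  move/matrixP => e; apply/matrixP => i j; have := e i j; rewrite !mxE => /eqP.
  by rewrite mulf_eq0 gt_eqF//= => /eqP.
move/(_ isT); rewrite mul_row_block tr_row_mx mul_row_col.
rewrite mul_mx_scalar scalerN -scalemxAl addNr mul0mx add0r.
rewrite linearZ/= -scalemxAr mxE pmulr_rgt0//.
rewrite mulNmx -scalemxAl.
rewrite (_ : - (x *m w^T *m w) + N *: (x *m M') = x *m (N *: M' - w^T *m w))//.
by rewrite mulmxBr -scalemxAr mulmxA addrC.
Qed.

Lemma unit_block_lower (r : nat) (z : 'cV[int]_r) (U : 'M[int]_r) :
  U \in unitmx -> block_mx (1%:M : 'M[int]_1) 0 z U \in unitmx.
Proof. by rewrite !unitmxE det_lblock det1 mul1r. Qed.

(** Stated for Gram matrices, so that projecting along a basis vector stays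
    inside integral forms.  Take the first vector shortest among all bases, and
    reduce the form of the projections by induction; then shift the remaining
    vectors by multiples of the first one so that their components along it are
    at most half of it.  As each of them is still at least as long as the first
    vector, its squared length is at most 4/3 of that of its projection, and so
    the product of the squared lengths is at most a constant times the
    determinant. *)
Lemma gram_reduction (r : nat) : exists2 C : nat, (0 < C)%N &
  forall M : 'M[int]_r, posdef M -> exists2 U, U \in unitmx &
    \prod_i (U *m M *m U^T) i i <= C%:Z * \det M.
Proof.
elim: r => [|r [C C0 IH]].
  exists 1%N => // M _; exists 1%:M; first exact: unitmx1.
  by rewrite big_ord0 det_mx00 mulr1.
exists (4 ^ r * C)%N; first by rewrite muln_gt0 expn_gt0.
move=> M0 pM0.
have [U0 uU0 minU0] := min_orbit pM0.
have [M defM] : exists M : 'M[int]_(1 + r), M = U0 *m M0 *m U0^T by eexists.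
have pM : posdef M by rewrite defM; exact: posdef_cong.
pose o : 'I_(1 + r) := lshift r 0.
have minM V : V \in unitmx -> M o o <= (V *m M *m V^T) o o.
  have -> : o = 0 by apply: val_inj.
  move=> uV; have := minU0 (V *m U0); rewrite unitmx_mul uV => /(_ uU0).
  by rewrite defM trmx_mul !mulmxA.
have dM : \det M = \det M0.
  rewrite defM !det_mulmx det_tr mulrAC -expr2.
  by rewrite (unit_int_sqr uU0) mul1r.
pose N := M o o.
pose w : 'rV[int]_r := ursubmx M.
pose M' : 'M[int]_r := drsubmx M.
have Mblock : M = block_mx (N%:M : 'M[int]_1) w w^T M'.
  rewrite -[M in LHS]submxK; congr block_mx.
    apply/matrixP => i j; by rewrite !ord1 !mxE eqxx mulr1n.
  by rewrite /w trmx_ursub pM.1.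
have N0 : 0 < N by exact: posdef_diag.
pose M2 := N *: M' - w^T *m w.
have pM2 : posdef M2 by apply: schur_posdef => //; rewrite -Mblock.
have [U' uU' HU'] := IH _ pM2.
pose a := U' *m w^T.
have /choice[z hz] : forall i, exists z : int, 4 * (N * z + a i 0) ^+ 2 <= N ^+ 2.
  by move=> i; exact: round_exists.
pose Z : 'cV[int]_r := \col_i z i.
pose V := block_mx (1%:M : 'M[int]_1) 0 Z U'.
have uV : V \in unitmx by exact: unit_block_lower.
pose Mu := U' *m M' *m U'^T.
have VMV : V *m M *m V^T = block_mx (N%:M : 'M[int]_1) (N *: Z^T + a^T) (N *: Z + a)
    (N *: (Z *m Z^T) + Z *m a^T + a *m Z^T + Mu).
  rewrite Mblock /V tr_block_mx !mulmx_block !trmx1 !trmx0.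
  rewrite !mul1mx !mul0mx !mulmx0 !mulmx1 !addr0.
  rewrite !mul_scalar_mx !mul_mx_scalar /a /Mu !trmx_mul !trmxK !mulmxDl -!scalemxAl.
  by rewrite !mulmxA !addrA; congr block_mx; congr (_ + _); rewrite addrAC.
have diag0 : (V *m M *m V^T) (lshift r 0) (lshift r 0) = N.
  by rewrite VMV block_mxEul mxE.
have diag1 i : (V *m M *m V^T) (rshift 1 i) (rshift 1 i) =
    N * z i ^+ 2 + 2 * (z i * a i 0) + Mu i i.
  rewrite VMV block_mxEdr !mxE !big_ord1 !mxE; ring.
have diag2 i : (U' *m M2 *m U'^T) i i = N * Mu i i - a i 0 ^+ 2.
  rewrite /M2 mulmxBr mulmxBl -scalemxAr -scalemxAl.
  have -> : U' *m (w^T *m w) *m U'^T = a *m a^T.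
    by rewrite /a trmx_mul trmxK !mulmxA.
  by rewrite !mxE big_ord1 !mxE expr2.
(* Exchanging the [i]-th vector with the first one gives another basis. *)
have minV i : N <= N * z i ^+ 2 + 2 * (z i * a i 0) + Mu i i.
  rewrite -diag1.
  pose W := tperm_mx (lshift r 0) (rshift 1 i) *m V.
  have uW : W \in unitmx.
    by rewrite unitmx_mul uV andbT unitmx_perm.
  have := minM W uW; rewrite -/N.
  have -> : W *m M *m W^T = xcol (lshift r 0) (rshift 1 i)
      (xrow (lshift r 0) (rshift 1 i) (V *m M *m V^T)).
    by rewrite xcolE xrowE /W trmx_mul tr_tperm_mx !mulmxA.
  by rewrite !mxE !tpermL.
(* The constant 4/3 is rounded up to 4. *)
have diag4 i : N * (N * z i ^+ 2 + 2 * (z i * a i 0) + Mu i i) <=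
    4 * (U' *m M2 *m U'^T) i i.
  have key (N1 s t m : int) : 0 < N1 -> N1 <= N1 * s ^+ 2 + 2 * (s * t) + m ->
      4 * (N1 * s + t) ^+ 2 <= N1 ^+ 2 ->
      N1 * (N1 * s ^+ 2 + 2 * (s * t) + m) <= 4 * (N1 * m - t ^+ 2).
    set X := _ + m => N1_0 h1 h2.
    have : N1 ^+ 2 <= N1 * X by rewrite expr2 ler_pM2l.
    have -> : 4 * (N1 * m - t ^+ 2) = 4 * (N1 * X) - 4 * (N1 * s + t) ^+ 2.
      by rewrite /X; ring.
    have : 0 <= N1 ^+ 2 by apply: sqr_ge0.
    by move: (N1 * X) (N1 ^+ 2) ((N1 * s + t) ^+ 2) h2 => x y u; lia.
  by rewrite diag2; apply: key.
exists (V *m U0); first by rewrite unitmx_mul uV.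
have -> : V *m U0 *m M0 *m (V *m U0)^T = V *m M *m V^T.
  by rewrite defM trmx_mul !mulmxA.
rewrite (@big_split_ord _ _ _ 1%N r) big_ord1 /= diag0.
rewrite -(ler_pM2l (exprn_gt0 r N0)).
have -> : N ^+ r * ((4 ^ r * C)%N%:Z * \det M0) = 4 ^+ r * (N * (C%:Z * \det M2)).
  rewrite -dM Mblock PoszM mulrCA -!mulrA (mulrC (N ^+ r)) schur_det.
  by rewrite -natz natrX; ring.
rewrite mulrCA [leRHS]mulrCA ler_pM2l//.
apply: (@le_trans _ _ (4 ^+ r * \prod_i (U' *m M2 *m U'^T) i i)); last first.
  by rewrite ler_pM2l// exprn_gt0.
have pow (c : int) : c ^+ r = \prod_(i < r) c by rewrite prodr_const card_ord.
rewrite !pow -!big_split/=.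
apply: ler_prod => i _; rewrite diag1 diag4 andbT.
by rewrite mulr_ge0// ?(le_trans (ltW N0) (minV i))// ltW.
Qed.

(** * Primitive lattices and saturation *)

(** The saturation of the row lattice, as a rational row-space condition. *)
Definition sat (m n : nat) (A : 'M[int]_(m, n)) : set 'rV[int]_n :=
  [set x | (map_mx intr x <= (map_mx intr A : 'M[rat]_(m, n)))%MS].

Lemma map_mx_intr_inj (F : numFieldType) (m n : nat) :
  injective (fun A : 'M[int]_(m, n) => map_mx intr A : 'M[F]_(m, n)).
Proof.
move=> A B /matrixP h; apply/matrixP => i j; have := h i j.
by rewrite !mxE => /intr_inj.
Qed.

Lemma rows_in_range (k m n : nat) (B : 'M[int]_(k, n)) (A : 'M[int]_(m, n)) :
  (forall i, range (fun x : 'rV[int]_k => x *m B) (row i A)) ->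
  exists X : 'M[int]_(m, k), A = X *m B.
Proof.
move=> h; have /choice[f fE] : forall i, exists x : 'rV[int]_k, x *m B = row i A.
  by move=> i; have [x _ <-] := h i; exists x.
exists (\matrix_i f i); apply/row_matrixP => i.
by rewrite row_mul rowK fE.
Qed.

Lemma lspan_range (F : fieldType) (k n : nat) (B : 'M[int]_(k, n)) :
  lspan F (range (fun x : 'rV[int]_k => x *m B)) =
  range (fun c : 'rV[F]_k => c *m map_mx intr B).
Proof.
apply/seteqP; split=> v.
  move=> [m [A [c [hA ->]]]]; have [X ->] := rows_in_range hA.
  by exists (c *m map_mx intr X) => //; rewrite map_mxM mulmxA.
move=> [c _ <-]; exists k, B, c; split => // i.
by exists (delta_mx 0 i) => //; rewrite -rowE.
Qed.

(** A right inverse [Q] recovers the coordinates of a vector from the vector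
    itself; being integral, it makes them integers even for rational
    combinations of the rows. *)
Lemma primitive_range (k n : nat) (P : 'M[int]_(k, n)) (Q : 'M[int]_(n, k)) :
  P *m Q = 1%:M ->
  primitive k (range (fun x : 'rV[int]_k => x *m P)) /\
  Zbasis (range (fun x : 'rV[int]_k => x *m P)) P.
Proof.
move=> PQ.
have zb : Zbasis (range (fun x : 'rV[int]_k => x *m P)) P.
  split=> // x y /= /(congr1 (mulmx ^~ Q)).
  by rewrite -!mulmxA PQ !mulmx1.
split => //; split.
- split; first by exists 0 => //; rewrite mul0mx.
  by move=> _ _ [x _ <-] [y _ <-]; exists (x - y) => //; rewrite mulmxBl.
- by exists P.
- apply/seteqP; split=> x; rewrite /= lspan_range.
    by move=> [c _ <-]; exists (map_mx intr c) => //; rewrite map_mxM.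
  move=> [c _ cE]; exists (x *m Q) => //.
  apply: (@map_mx_intr_inj rat); rewrite !map_mxM -cE -(mulmxA c) -map_mxM PQ.
  by rewrite map_mx1 mulmx1.
Qed.

(** By the Smith normal form [A] equals [P *m D *m U] with [D] diagonal, and
    over the rationals the row space of [D *m U] is spanned by the rows of [U] at
    the nonzero diagonal entries.  These come first, because 0 divides only 0. *)
Lemma sat_completion (m n : nat) (A : 'M[int]_(m, n)) :
  exists2 U : 'M[int]_n, U \in unitmx &
    let k := \rank (map_mx intr A : 'M[rat]_(m, n)) in
    (k <= n)%N /\ sat A = range (fun x : 'rV[int]_k => x *m (pid_mx k *m U)).
Proof.
have [P uP [U uU [d sd AE]]] := int_Smith_normal_form A.
pose D : 'M[int]_(m, n) := \matrix_(i, j) (d`_i *+ (i == j :> nat)).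
(* The number of leading nonzero entries of [d]; past its end the default
   value 0 is the right one. *)
pose c := find (pred1 0) d.
pose k := minn c (minn m n).
have d0 i : (i < c)%N -> d`_i != 0.
  move=> ic; have := before_find 0 ic; rewrite /= => ->//.
have d1 i : (c <= i)%N -> d`_i = 0.
  move=> ci; have [si|] := ltnP i (size d); last by move=> h; rewrite nth_default.
  have hd : has (pred1 0) d by rewrite has_find (leq_ltn_trans ci).
  have /eqP d_c := nth_find 0 hd.
  have := sorted_leq_nth dvdz_trans dvdzz 0 sd.
  move=> /(_ c i); rewrite !inE /in_mem /= -has_find hd si => /(_ isT isT ci).
  by rewrite d_c => h; apply/eqP; rewrite -dvd0z.
pose toQ p q (X : 'M[int]_(p, q)) : 'M[rat]_(p, q) := map_mx intr X.
have unitQ p (X : 'M[int]_p) : X \in unitmx -> toQ _ _ X \in unitmx.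
  by move=> uX; rewrite unitmxE det_map_mx; apply: rmorph_unit; rewrite -unitmxE.
have key : (toQ _ _ A :=: toQ _ _ ((pid_mx k : 'M[int]_(k, n)) *m U))%MS.
  rewrite AE /toQ !map_mxM; apply: eqmxMr.
  apply: (eqmx_trans (eqmxMfull _ _)); first by rewrite row_full_unit unitQ.
  have -> : map_mx intr (pid_mx k : 'M[int]_(k, n)) = (pid_mx k : 'M[rat]_(k, n)).
    by rewrite map_pid_mx.
  apply/eqmxP/andP; split; apply/row_subP => i.
    have [ik|ki] := ltnP i k.
      apply: submx_trans _ (row_sub (Ordinal ik) _).
      apply/sub_rVP; exists (d`_i)%:~R; apply/rowP => j; rewrite !mxE /= ik andbT.
      by case: eqP => _; rewrite ?mulr1 ?mulr0// ?mulr1n ?mulr0n.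
    rewrite (_ : row i _ = 0) ?sub0mx//; apply/rowP => j; rewrite !mxE.
    case: eqP => [ij|_]; rewrite ?mulr0n// mulr1n d1//.
    move: ki; rewrite /k !geq_min => /or3P[//|mi|ni].
      by have := ltn_ord i; rewrite ltnNge mi.
    by have := ltn_ord j; rewrite -ij ltnNge ni.
  have im : (i < m)%N.
    by apply: (leq_trans (ltn_ord i)); rewrite /k minnCA geq_minl.
  apply: submx_trans _ (row_sub (Ordinal im) _).
  have di : (d`_i)%:~R != 0 :> rat.
    by rewrite intr_eq0; apply/d0/(leq_trans (ltn_ord i)); rewrite geq_minl.
  apply/sub_rVP; exists ((d`_i)%:~R^-1); apply/rowP => j; rewrite !mxE /= ltn_ord andbT.
  by case: eqP => _; rewrite ?mulr1n ?mulr0n ?mulr0// mulVf.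
have kn : (k <= n)%N by rewrite /k minnA geq_minr.
have rk : \rank (map_mx intr A : 'M[rat]_(m, n)) = k.
  rewrite -/(toQ _ _ A) key /toQ map_mxM mxrankMfree ?row_free_unit ?unitQ//.
  rewrite map_pid_mx rank_pid_mx// .
exists U => //=; rewrite rk; split => //.
have PQ : (pid_mx k *m U) *m (invmx U *m pid_mx k) = 1%:M :> 'M[int]_k.
  by rewrite -mulmxA (mulmxA U) mulmxV// mul1mx pid_mx_id// pid_mx_1.
have [[_ _ sE] _] := primitive_range PQ.
rewrite sE; apply/seteqP; split=> x; rewrite /sat/= lspan_range -/(toQ _ _ A) key.
  by move=> /submxP[c' ->]; exists c'.
by move=> [c' _ <-]; exact: submxMl.
Qed.

(** Two bases express each other by integral matrices which are mutually
    inverse, and this forces them to be square. *)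
Lemma Zbasis_rank (n r r' : nat) (L : set 'rV[int]_n) (B : 'M[int]_(r, n))
    (B' : 'M[int]_(r', n)) : Zbasis L B -> Zbasis L B' ->
  r = r' /\ exists Y : 'M[int]_(r', r), B' = Y *m B.
Proof.
move=> [iB LE] [iB' LE'].
have hB' i : range (fun x : 'rV[int]_r => x *m B) (row i B').
  by rewrite -LE LE'; exists (delta_mx 0 i) => //; rewrite -rowE.
have hB i : range (fun x : 'rV[int]_r' => x *m B') (row i B).
  by rewrite -LE' LE; exists (delta_mx 0 i) => //; rewrite -rowE.
have [Y YE] := rows_in_range hB'; have [Z ZE] := rows_in_range hB.
have inj m p (C : 'M[int]_(m, n)) (W V : 'M[int]_(p, m)) :
    injective (fun x : 'rV[int]_m => x *m C) -> W *m C = V *m C -> W = V.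
  by move=> iC e; apply/row_matrixP => i; apply: iC; rewrite -!row_mul e.
split; last by exists Y.
apply/eqP; rewrite eqn_leq; apply/andP; split.
  apply: (@mulmx1_min _ _ _ Z Y); apply: (inj _ _ B) => //.
  by rewrite -mulmxA -YE -ZE mul1mx.
apply: (@mulmx1_min _ _ _ Y Z); apply: (inj _ _ B') => //.
by rewrite -mulmxA -ZE -YE mul1mx.
Qed.

(** * Orthogonal lattices and reduced bases *)

Lemma primitive_sat (n r : nat) (L : set 'rV[int]_n) (B : 'M[int]_(r, n)) :
  primitive r L -> Zbasis L B -> sat B = L.
Proof.
move=> [_ _ LE] [_ LB]; rewrite [RHS]LE {1}LB lspan_range.
apply/seteqP; split=> x; rewrite /sat/=.
  by move=> /submxP[c ->]; exists c.
by move=> [c _ <-]; exact: submxMl.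
Qed.

Lemma sat_primitive (m n : nat) (A : 'M[int]_(m, n)) :
  primitive (\rank (map_mx intr A : 'M[rat]_(m, n))) (sat A).
Proof.
have [U uU [kn ->]] := sat_completion A; set k := \rank _ in kn *.
apply: (primitive_range (Q := invmx U *m pid_mx k) _).1.
by rewrite -mulmxA (mulmxA U) mulmxV// mul1mx pid_mx_id// pid_mx_1.
Qed.

Lemma primitive_rank_unique (n r r' : nat) (L : set 'rV[int]_n) :
  primitive r L -> primitive r' L -> r = r'.
Proof. by move=> [_ [B zB] _] [_ [B' zB'] _]; case: (Zbasis_rank zB zB'). Qed.

Lemma Zbasis_row_free (n r : nat) (L : set 'rV[int]_n) (B : 'M[int]_(r, n)) :
  primitive r L -> Zbasis L B -> \rank (map_mx intr B : 'M[rat]_(r, n)) = r.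
Proof.
move=> pL zB; apply: (@primitive_rank_unique n _ _ L) => //.
by rewrite -(primitive_sat pL zB); exact: sat_primitive.
Qed.

Lemma usubmx_pid (r s m : nat) (U : 'M[int]_(r + s, m)) :
  usubmx U = pid_mx r *m U.
Proof.
rewrite -[U in RHS]vsubmxK (_ : pid_mx r = row_mx 1%:M 0).
  by rewrite mul_row_col mul1mx mul0mx addr0.
by rewrite pid_mx_row.
Qed.

(** A basis of a primitive lattice is part of a basis of the whole of Z^n. *)
Lemma primitive_completion (r s : nat) (L : set 'rV[int]_(r + s)) :
  primitive r L ->
  exists2 U : 'M[int]_(r + s), U \in unitmx & Zbasis L (usubmx U).
Proof.
move=> pL; have [_ [B zB] _] := pL.
have [U uU] := sat_completion B.
rewrite (Zbasis_row_free pL zB) (primitive_sat pL zB) /= => -[_ LE].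
exists U => //; rewrite usubmx_pid {1}LE.
apply: (primitive_range (Q := invmx U *m pid_mx r) _).2.
by rewrite -mulmxA (mulmxA U) mulmxV// mul1mx pid_mx_id ?leq_addr// pid_mx_1.
Qed.

Lemma primitive_le (n r : nat) (L : set 'rV[int]_n) : primitive r L -> (r <= n)%N.
Proof.
move=> pL; have [_ [B zB] _] := pL.
by have := Zbasis_row_free pL zB => {1}<-; exact: rank_leq_col.
Qed.

Lemma orthlatticeE (k n : nat) (B : 'M[int]_(k, n)) :
  orthlattice (range (fun x : 'rV[int]_k => x *m B)) =
  [set x : 'rV[int]_n | x *m B^T = 0].
Proof.
apply/seteqP; split=> x; rewrite /orthlattice/= lspan_range.
  move=> h; apply/trmx_inj; rewrite trmx_mul trmxK trmx0; apply/row_matrixP => i.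
  rewrite row0 row_mul; apply: (@map_mx_intr_inj rat); rewrite raddf0.
  have := h _ (imageT (fun c : 'rV[rat]_k => c *m map_mx intr B) (delta_mx 0 i)).
  move=> /(congr1 trmx); rewrite trmx_mul trmxK trmx0 => <-.
  by rewrite rowE !map_mxM map_trmx map_delta_mx.
move=> xB _ [c _ <-]; rewrite trmx_mul mulmxA map_trmx -map_mxM xB.
by rewrite raddf0 mul0mx.
Qed.

Lemma dual_blocks (r s : nat) (U : 'M[int]_(r + s)) : U \in unitmx ->
  let W := (invmx U)^T in
  [/\ usubmx U *m (usubmx W)^T = 1%:M, usubmx U *m (dsubmx W)^T = 0,
      dsubmx U *m (dsubmx W)^T = 1%:M & dsubmx U *m (usubmx W)^T = 0].
Proof.
move=> uU W; have : U *m W^T = 1%:M by rewrite trmxK mulmxV.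
rewrite -{1}[U]vsubmxK -{1}[W]vsubmxK tr_col_mx mul_col_row.
by rewrite scalar_mx_block => /eq_block_mx[].
Qed.

(** In the dual basis of [U], being orthogonal to the first [r] rows of [U] means
    that the first [r] coordinates vanish. *)
Lemma dual_dsub_orth (r s : nat) (U : 'M[int]_(r + s)) : U \in unitmx ->
  orthlattice (range (fun x : 'rV[int]_r => x *m usubmx U)) =
  range (fun x : 'rV[int]_s => x *m dsubmx (invmx U)^T).
Proof.
move=> uU; rewrite orthlatticeE.
have [h1 h2 h3 h4] := dual_blocks uU.
set W := (invmx U)^T in h1 h2 h3 h4 *.
have WU : U^T *m W = 1%:M by rewrite /W -trmx_mul mulVmx ?trmx1.
apply/seteqP; split=> x /=.
  move=> xU; exists (x *m (dsubmx U)^T) => //.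
  rewrite -[RHS]mulmx1 -WU mulmxA -[U in RHS]vsubmxK -[W in RHS]vsubmxK.
  by rewrite tr_col_mx mul_mx_row mul_row_col xU mul0mx add0r.
move=> [z _ <-]; rewrite -mulmxA.
by have := congr1 trmx h2; rewrite trmx_mul trmxK trmx0 => ->; rewrite mulmx0.
Qed.

(** A unimodular matrix adapted to [L] yields, through its dual, a basis of the
    orthogonal lattice; the relation between the two is symmetric. *)
Lemma orth_frame (r s : nat) (L : set 'rV[int]_(r + s)) : primitive r L ->
  (exists2 U : 'M[int]_(r + s), U \in unitmx &
    Zbasis L (usubmx U) /\ Zbasis (orthlattice L) (dsubmx (invmx U)^T)) /\
  (primitive s (orthlattice L) /\ orthlattice (orthlattice L) = L).
Proof.
move=> pL; have [U uU zU] := primitive_completion pL.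
have [h1 h2 h3 h4] := dual_blocks uU.
set W := (invmx U)^T in h1 h2 h3 h4 *.
have LE : L = range (fun x : 'rV[int]_r => x *m usubmx U) by case: zU.
have oE := dual_dsub_orth uU; rewrite -LE -/W in oE.
have h3' : dsubmx W *m (dsubmx U)^T = 1%:M.
  by rewrite -[LHS]trmxK trmx_mul trmxK h3 trmx1.
have [p z] := primitive_range h3'; rewrite -oE in p z.
split; first by exists U.
split=> //; rewrite oE orthlatticeE.
have WU : W^T *m U = 1%:M by rewrite /W trmxK mulVmx.
apply/seteqP; split=> x /=.
  move=> xU; rewrite LE; exists (x *m (usubmx W)^T) => //.
  rewrite -[RHS]mulmx1 -WU mulmxA -[U in RHS]vsubmxK -[W in RHS]vsubmxK.
  by rewrite tr_col_mx mul_mx_row mul_row_col xU mul0mx addr0.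
by rewrite {1}LE => -[y _ <-]; rewrite -mulmxA h2 mulmx0.
Qed.

(** Jacobi's identity for complementary minors: the Gram matrices [M] of [U] and
    [N] of the dual basis are mutually inverse, so a leading minor of [M] is
    [\det M] times the complementary minor of [N], and [\det M = 1]. *)
Lemma dual_gram_det (r s : nat) (U : 'M[int]_(r + s)) : U \in unitmx ->
  let W := (invmx U)^T in
  \det (usubmx U *m (usubmx U)^T) = \det (dsubmx W *m (dsubmx W)^T).
Proof.
move=> uU W; pose M := U *m U^T; pose N := W *m W^T.
have MN : M *m N = 1%:M.
  rewrite /M /N /W trmxK -!mulmxA (mulmxA U^T) -trmx_mul mulVmx// trmx1 mul1mx.
  by rewrite mulmxV.
have MU : usubmx U *m (usubmx U)^T = ulsubmx M.
  by rewrite /M -{3 4}[U]vsubmxK tr_col_mx mul_col_row block_mxKul.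
have NW : dsubmx W *m (dsubmx W)^T = drsubmx N.
  by rewrite /N -{3 4}[W]vsubmxK tr_col_mx mul_col_row block_mxKdr.
rewrite MU NW; move: MN; rewrite -{1}[M]submxK -{1}[N]submxK mulmx_block.
rewrite [RHS]scalar_mx_block => /eq_block_mx[_ e12 _ e22].
have := mulmx_block (ulsubmx M) (ursubmx M) (dlsubmx M) (drsubmx M)
   1%:M (ursubmx N) 0 (drsubmx N).
rewrite e12 e22 !mulmx1 !mulmx0 !addr0 submxK => /(congr1 (@determinant _ _)).
rewrite det_mulmx det_ublock det_lblock !det1 mulr1 mul1r => <-.
by rewrite /M det_mulmx det_tr -expr2 unit_int_sqr// mul1r.
Qed.

Lemma Zbasis_unit_change (n r : nat) (L : set 'rV[int]_n) (B : 'M[int]_(r, n))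
    (Y : 'M[int]_r) : Zbasis L B -> Y \in unitmx -> Zbasis L (Y *m B).
Proof.
move=> [iB LE] uY; split.
  move=> x y /=; rewrite !mulmxA => /iB /(congr1 (mulmx ^~ (invmx Y))).
  by rewrite !mulmxK.
rewrite LE; apply/seteqP; split=> _ [x _ <-].
  by exists (x *m invmx Y) => //; rewrite mulmxA mulmxKV.
by exists (x *m Y) => //; rewrite mulmxA.
Qed.

Lemma Zbasis_change (n r : nat) (L : set 'rV[int]_n) (B B' : 'M[int]_(r, n)) :
  Zbasis L B -> Zbasis L B' -> exists2 Y, Y \in unitmx & B' = Y *m B.
Proof.
move=> zB zB'; have [_ [Y YE]] := Zbasis_rank zB zB'.
have [_ [Z ZE]] := Zbasis_rank zB' zB.
exists Y => //; suff : Y *m Z = 1%:M by case/mulmx1_unit.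
apply/row_matrixP => i; case: zB' => iB' _; apply: iB' => /=.
by rewrite -!row_mul -mulmxA -ZE -YE mul1mx.
Qed.

Lemma Zbasis_gram_det (n r : nat) (L : set 'rV[int]_n) (B B' : 'M[int]_(r, n)) :
  Zbasis L B -> Zbasis L B' -> \det (B *m B^T) = \det (B' *m B'^T).
Proof.
move=> zB zB'; have [Y uY ->] := Zbasis_change zB zB'.
rewrite trmx_mul !mulmxA det_mulmx -(mulmxA Y) det_mulmx det_tr mulrAC -expr2.
by rewrite unit_int_sqr// mul1r.
Qed.

Lemma row_sqr_gt0 (n : nat) (x : 'rV[int]_n) : x != 0 -> 0 < (x *m x^T) 0 0.
Proof.
move=> xn0; have [j xj] : exists j, x 0 j != 0.
  apply/existsP; apply: contraR xn0; rewrite negb_exists => /forallP h.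
  by apply/eqP/rowP => j; rewrite mxE; apply/eqP; have := h j; rewrite negbK.
rewrite mxE (bigD1 j)//= mxE -expr2 ltr_wpDr//; last by rewrite exprn_even_gt0.
by apply: sumr_ge0 => i _; rewrite mxE -expr2 sqr_ge0.
Qed.

Lemma gram_posdef (n r : nat) (B : 'M[int]_(r, n)) :
  injective (fun x : 'rV[int]_r => x *m B) -> posdef (B *m B^T).
Proof.
move=> iB; split; first by rewrite trmx_mul trmxK.
move=> x xn0; rewrite mulmxA -mulmxA -trmx_mul; apply: row_sqr_gt0.
by apply: contra_neq xn0 => h; apply: iB; rewrite h mul0mx.
Qed.

Lemma reduced_basis (r : nat) : exists2 C : nat, (0 < C)%N &
  forall n (L : set 'rV[int]_n), primitive r L ->
  exists2 B : 'M[int]_(r, n), Zbasis L B &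
    \prod_i (B *m B^T) i i <= C%:Z * \det (B *m B^T).
Proof.
have [C C0 HC] := gram_reduction r; exists C => // n L [_ [B zB] _].
have [U uU HU] := HC _ (gram_posdef zB.1).
exists (U *m B); first exact: Zbasis_unit_change.
have z' := Zbasis_unit_change zB uU.
by rewrite -(Zbasis_gram_det zB z') trmx_mul !mulmxA; rewrite !mulmxA in HU.
Qed.

Lemma lspan_sat (m n : nat) (A : 'M[int]_(m, n)) :
  lspan rat (sat A) = lspan rat (range (fun x : 'rV[int]_m => x *m A)).
Proof.
rewrite lspan_range; apply/seteqP; split=> v.
  move=> [k [B [c [hB ->]]]].
  have : (map_mx intr B <= (map_mx intr A : 'M[rat]_(m, n)))%MS.
    by apply/row_subP => i; rewrite -map_row; exact: hB.
  by move=> /submxP[X ->]; exists (c *m X) => //; rewrite mulmxA.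
move=> [c _ <-]; exists m, A, c; split => // i.
by rewrite /sat/= map_row row_sub.
Qed.

Lemma sat_orth (m n : nat) (A : 'M[int]_(m, n)) :
  orthlattice (sat A) = [set x : 'rV[int]_n | x *m A^T = 0].
Proof. by rewrite -orthlatticeE /orthlattice lspan_sat. Qed.

Lemma sat_mem_row (m n : nat) (A : 'M[int]_(m, n)) i : sat A (row i A).
Proof. by rewrite /sat/= map_row row_sub. Qed.

(** The column space of [B] lies in the kernel of [A], and the ranks make the
    two equal. *)
Lemma mul0_sat_orth (n : nat) (A B : 'M[int]_n) :
  A *m B = 0 ->
  (\rank (map_mx intr A : 'M[rat]_n) + \rank (map_mx intr B : 'M[rat]_n) = n)%N ->
  sat B^T = orthlattice (sat A).
Proof.
move=> AB rk; rewrite sat_orth.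
set AQ := map_mx intr A in rk; set BQ := map_mx intr B in rk.
have h : (BQ^T <= kermx AQ^T)%MS.
  by apply/sub_kermxP; rewrite -trmx_mul -map_mxM AB raddf0 trmx0.
have h' : (kermx AQ^T <= BQ^T)%MS.
  rewrite -(mxrank_leqif_sup h) mxrank_ker !mxrank_tr -[X in _ == (X - _)%N]rk.
  by rewrite addKn.
apply/seteqP; split=> x; rewrite /sat/= -map_trmx.
  move=> xB; have : (map_mx intr x <= kermx AQ^T)%MS by exact: submx_trans xB h.
  move=> /sub_kermxP; rewrite map_trmx -map_mxM => e.
  by apply: (@map_mx_intr_inj rat); rewrite e raddf0.
move=> xA; apply: submx_trans h'; apply/sub_kermxP.
by rewrite map_trmx -map_mxM xA raddf0.
Qed.

Lemma sat_orth_mul0 (n : nat) (A B : 'M[int]_n) :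
  sat B^T = orthlattice (sat A) ->
  A *m B = 0 /\
  (\rank (map_mx intr A : 'M[rat]_n) + \rank (map_mx intr B : 'M[rat]_n) = n)%N.
Proof.
move=> E; split.
  apply: trmx_inj; rewrite trmx_mul trmx0; apply/row_matrixP => i.
  rewrite row0 row_mul; have := sat_mem_row B^T i; rewrite E sat_orth /=.
  by [].
have pA := sat_primitive A.
have := primitive_le pA; move: pA; set r := \rank _ => pA rn.
have [s ns] : exists s, n = (r + s)%N by exists (n - r)%N; rewrite subnKC.
have ps : primitive s (orthlattice (sat A)).
  clearbody r; subst n; by have [_ []] := orth_frame pA.
have := sat_primitive B^T; rewrite E => pB.
by rewrite -mxrank_tr map_trmx (primitive_rank_unique pB ps).
Qed.

(** * Iterated Lebesgue measure: measurability, additivity, translations *)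

(** The image of Lebesgue measure under an affine map, rescaled by [`|a|], agrees
    with Lebesgue measure on intervals, hence everywhere. *)
Lemma integral_affine (R : realType) (a v : R) (f : R -> \bar R) :
  a != 0 -> measurable_fun [set: R] f -> (forall x, 0 <= f x)%E ->
  (`|a|%:E * \int[lebesgue_measure]_(x in [set: R]) f (a * x + v)%R =
   \int[lebesgue_measure]_(x in [set: R]) f x)%E.
Proof.
move=> a0 mf f0.
pose g : R -> measurableTypeR R := fun x => a * x + v.
have mg : measurable_fun [set: R] g.
  by apply: measurable_funD => //; apply: measurable_funM.
pose phi : {mfun R >-> measurableTypeR R} :=
  HB.pack g (isMeasurableFun.Build _ _ _ _ _ mg).
have na : 0 < `|a| by rewrite normr_gt0.
pose c : {nonneg R} := (NngNum (ltW na)).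
pose mu' := mscale c (pushforward lebesgue_measure phi).
have E A : measurable A -> lebesgue_measure A = mu' mg A.
  rewrite /mu'; apply: lebesgue_measure_unique => _ [[s t] _ <-].
  rewrite -[RHS]/(`|a|%:E * lebesgue_measure (g @^-1` `]s, t]))%E.
  have [a1|a1|/eqP] := ltgtP a 0; last by rewrite (negPf a0).
    rewrite (_ : g @^-1` _ = [set` `[(t - v) / a, (s - v) / a[]).
      rewrite !lebesgue_measure_itv/= !lte_fin ltr_nM2r ?invr_lt0// ltrD2r.
      case: ltP => st; last by rewrite mule0.
      rewrite -!EFinB -EFinM ltr0_norm//; congr EFin; by field.
    apply/seteqP; split=> x /=; rewrite !in_itv/= /g.
      by rewrite ler_ndivrMr// ltr_ndivlMr// lerBrDr ltrBlDr mulrC andbC.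
    by rewrite ler_ndivrMr// ltr_ndivlMr// lerBrDr ltrBlDr mulrC andbC.
  rewrite (_ : g @^-1` _ = [set` `](s - v) / a, (t - v) / a]]).
    rewrite !lebesgue_measure_itv/= !lte_fin ltr_pM2r ?invr_gt0// ltrD2r.
    case: ltP => st; last by rewrite mule0.
    rewrite -!EFinB -EFinM gtr0_norm//; congr EFin; by field.
  apply/seteqP; split=> x /=; rewrite !in_itv/= /g.
    by rewrite ler_pdivlMr// ltr_pdivrMr// lerBrDr ltrBlDr mulrC.
  by rewrite ler_pdivlMr// ltr_pdivrMr// lerBrDr ltrBlDr mulrC.
rewrite [RHS](eq_measure_integral (mu' mg)); last by move=> A mA _; exact: E.
rewrite ge0_integral_mscale//.
by rewrite ge0_integral_pushforward//.
Qed.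

(** Borel sets of row vectors, described without a sigma-algebra on them: [g]
    ranges over all coordinatewise measurable maps into the vectors.  In this form
    preimages under linear maps and slices are immediate. *)
Definition bmeas (R : realType) (d : nat) (A : set 'rV[R]_d) : Prop :=
  forall (dQ : measure_display) (Q : measurableType dQ)
    (g : Q -> 'rV[R]_d), 
    (forall i, measurable_fun setT (fun q => g q 0 i)) ->
    measurable [set q | A (g q)].

(** The variant of [bmeas] for families of sets indexed by a measurable space;
    it is needed because slices are such families and are sliced again. *)
Definition pmeas (R : realType) (d : nat) (dP : measure_display)
    (P : measurableType dP) (A : P -> set 'rV[R]_d) : Prop :=
  forall (dQ : measure_display) (Q : measurableType dQ) (h : Q -> P)
    (g : Q -> 'rV[R]_d), measurable_fun setT h ->
    (forall i, measurable_fun setT (fun q => g q 0 i)) ->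
    measurable [set q | A (h q) (g q)].

(** The sets whose measures are integrated in [lebesgue_rV]. *)
Definition slice (R : realType) (d : nat) (A : set 'rV[R]_(1 + d)) (x : R) :
  set 'rV[R]_d := [set y | A (row_mx (x%:M : 'M[R]_1) y)].

Lemma measurable_row_mx (R : realType) (d : nat) dQ (Q : measurableType dQ)
    (f : Q -> R) (g : Q -> 'rV[R]_d) :
  measurable_fun setT f -> (forall i, measurable_fun setT (fun q => g q 0 i)) ->
  forall i, measurable_fun setT
    (fun q => row_mx ((f q)%:M : 'M[R]_1) (g q) 0 i).
Proof.
move=> mf mg i; rewrite -[i]splitK; case: (fintype.split i) => j /=.
  by under eq_fun do rewrite row_mxEl !ord1 mxE eqxx mulr1n.
by under eq_fun do rewrite row_mxEr; exact: mg.
Qed.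

Lemma pmeas_slice (R : realType) (d : nat) (dP : measure_display)
    (P : measurableType dP) (A : P -> set 'rV[R]_(d.+1)) :
  pmeas A -> pmeas (fun px : P * R => @slice R d (A px.1) px.2).
Proof.
move=> mA dQ Q h g mh mg.
apply: (mA _ Q (fst \o h) (fun q => row_mx ((h q).2%:M : 'M[R]_1) (g q))).
  exact: measurableT_comp.
by apply: measurable_row_mx => //; exact: measurableT_comp.
Qed.

Lemma bmeas_slice (R : realType) (d : nat) (A : set 'rV[R]_(d.+1)) :
  bmeas A -> pmeas (@slice R d A).
Proof.
move=> mA dQ Q h g mh mg.
apply: (mA _ Q (fun q => row_mx ((h q)%:M : 'M[R]_1) (g q))).
exact: measurable_row_mx.
Qed.

Lemma pmeas_bmeas (R : realType) (d : nat) (dP : measure_display)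
    (P : measurableType dP) (A : P -> set 'rV[R]_d) p :
  pmeas A -> bmeas (A p).
Proof. by move=> mA dQ Q g mg; apply: (mA _ Q (cst p) g). Qed.

Lemma leb_ge0 (R : realType) (d : nat) (A : set 'rV[R]_d) :
  (0 <= lebesgue_rV A)%E.
Proof.
by elim: d A => [|d IH] A /=; [rewrite lee_fin | exact: integral_ge0].
Qed.

Lemma lebS (R : realType) (d : nat) (A : set 'rV[R]_(d.+1)) :
  lebesgue_rV A = (\int[lebesgue_measure]_(x in [set: R])
     lebesgue_rV (@slice R d A x))%E.
Proof. by []. Qed.

(** Slicing once adds a real parameter to the family, and integrating this
    parameter out preserves measurability by Tonelli's theorem. *)
Lemma measurable_leb (R : realType) (d : nat) (dP : measure_display)
    (P : measurableType dP) (A : P -> set 'rV[R]_d) :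
  pmeas A -> measurable_fun setT (fun p => lebesgue_rV (A p)).
Proof.
elim: d dP P A => [|d IH] dP P A mA.
  have m0 : measurable [set p | A p 0].
    by apply: (mA _ P id (fun _ => 0)) => // -[].
  have -> : (fun p => lebesgue_rV (A p)) =
      (fun p => (\1_([set p | A p 0]) p : R)%:E).
    by apply/funext => p /=; rewrite !indicE.
  exact/measurable_EFinP/measurable_indic.
under eq_fun do rewrite lebS.
have := @measurable_fun_fubini_tonelli_F _ _ P (measurableTypeR R) R
  lebesgue_measure (fun px : P * R => lebesgue_rV (@slice R d (A px.1) px.2)).
by apply=> //; [exact/IH/pmeas_slice | move=> x; exact: leb_ge0].
Qed.

Lemma measurable_leb_slice (R : realType) (d : nat) (A : set 'rV[R]_(d.+1)) :
  bmeas A -> measurable_fun setT (fun x : R => lebesgue_rV (@slice R d A x)).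
Proof. by move=> mA; exact/measurable_leb/bmeas_slice. Qed.

Lemma leb_subset (R : realType) (d : nat) (A B : set 'rV[R]_d) :
  bmeas A -> bmeas B -> A `<=` B -> (lebesgue_rV A <= lebesgue_rV B)%E.
Proof.
elim: d A B => [|d IH] A B mA mB AB.
  rewrite /= lee_fin !indicE ler_nat.
  by case: (boolP (0 \in A)) => // /set_mem/AB/mem_set ->.
rewrite !lebS; apply: ge0_le_integral => //.
- by move=> x _; exact: leb_ge0.
- exact: measurable_leb_slice.
- exact: measurable_leb_slice.
move=> x _; apply: IH.
- exact/pmeas_bmeas/bmeas_slice.
- exact/pmeas_bmeas/bmeas_slice.
- by move=> y; exact: AB.
Qed.

Lemma leb_set0 (R : realType) (d : nat) : lebesgue_rV (set0 : set 'rV[R]_d) = 0%E.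
Proof.
elim: d => [|d IH]; first by rewrite /= indic0.
by rewrite lebS; apply: integral0_eq => x _; exact: IH.
Qed.

Lemma leb_setU (R : realType) (d : nat) (A B : set 'rV[R]_d) :
  bmeas A -> bmeas B -> A `&` B = set0 ->
  (lebesgue_rV (A `|` B) = lebesgue_rV A + lebesgue_rV B)%E.
Proof.
elim: d A B => [|d IH] A B mA mB AB.
  rewrite /= -EFinD !indicE; congr EFin; rewrite in_setU -natrD.
  case: (boolP (0 \in A)) => [/set_mem A0|_]; last by rewrite add0n.
  case: (boolP (0 \in B)) => [/set_mem B0|_]; last by rewrite addn0.
  by have : set0 (0 : 'rV[R]_0) by rewrite -AB.
rewrite !lebS -ge0_integralD//=.
- apply: eq_integral => x _; apply: (IH (@slice R d A x) (@slice R d B x)).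
  + exact/pmeas_bmeas/bmeas_slice.
  + exact/pmeas_bmeas/bmeas_slice.
  + apply/seteqP; split=> // y [/= Ay By].
    by have : set0 (row_mx (x%:M : 'M[R]_1) y) by rewrite -AB.
- by move=> x _; exact: leb_ge0.
- exact: measurable_leb_slice.
- by move=> x _; exact: leb_ge0.
- exact: measurable_leb_slice.
Qed.

Lemma bmeas_affine (R : realType) (d e : nat) (A : set 'rV[R]_d) (G : 'M[R]_(e, d))
    (v : 'rV[R]_d) : bmeas A -> bmeas [set y | A (y *m G + v)].
Proof.
move=> mA dQ Q g mg; apply: (mA _ Q (fun q => g q *m G + v)) => i.
under eq_fun do rewrite !mxE.
apply: measurable_funD => //; apply: measurable_sum => j.
exact: measurable_funM.
Qed.

Lemma leb_shift (R : realType) (d : nat) (A : set 'rV[R]_d) (v : 'rV[R]_d) :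
  bmeas A -> lebesgue_rV [set y | A (y + v)] = lebesgue_rV A.
Proof.
elim: d A v => [|d IH] A v mA.
  by congr lebesgue_rV; apply/seteqP; split=> y /=; rewrite [v]thinmx0 addr0.
rewrite !lebS.
pose v0 := v 0 0; pose v' : 'rV[R]_d := rsubmx (v : 'rV[R]_(1 + d)).
rewrite -[RHS](@integral_affine _ 1 v0 _ (oner_neq0 R))//; last 2 first.
- exact: measurable_leb_slice.
- by move=> x; exact: leb_ge0.
rewrite normr1 mul1e; apply: eq_integral => x _.
rewrite -(IH (slice A (1 * x + v0)) v'); last exact/pmeas_bmeas/bmeas_slice.
congr lebesgue_rV; apply/seteqP; split=> y; rewrite /slice/=;
  suff -> : row_mx x%:M y + v = row_mx (1 * x + v0)%:M (y + v') by [];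
  rewrite -[v in LHS](@hsubmxK _ 1 1 d) add_row_mx mul1r raddfD/=;
  by congr (row_mx (_ + _) _); apply/matrixP => i j; rewrite !ord1 !mxE eqxx mulr1n;
  congr (v _ _); apply: val_inj.
Qed.

(** * Iterated Lebesgue measure under linear maps *)

Definition leb_scales (R : realType) (d : nat) (G : 'M[R]_d) : Prop :=
  forall A : set 'rV[R]_d, bmeas A ->
    (`|\det G|%:E * lebesgue_rV [set y | A (y *m G)] = lebesgue_rV A)%E.

Lemma bmeas_linear (R : realType) (d e : nat) (A : set 'rV[R]_d) (G : 'M[R]_(e, d)) :
  bmeas A -> bmeas [set y | A (y *m G)].
Proof.
move=> mA; have := bmeas_affine G 0 mA.
by under eq_set do rewrite addr0.
Qed.

Lemma bmeas_shift (R : realType) (d : nat) (A : set 'rV[R]_d) (v : 'rV[R]_d) :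
  bmeas A -> bmeas [set y | A (y + v)].
Proof.
move=> mA; have := bmeas_affine 1%:M v mA.
by under eq_set do rewrite mulmx1.
Qed.

Lemma leb_scales_mul (R : realType) (d : nat) (G H : 'M[R]_d) :
  leb_scales G -> leb_scales H -> leb_scales (G *m H).
Proof.
move=> sG sH A mA.
have := sG _ (bmeas_linear H mA); rewrite /= => e.
rewrite det_mulmx mulrC normrM EFinM -muleA.
under eq_set do rewrite mulmxA.
by rewrite e; exact: sH.
Qed.

(** Such a map scales the first coordinate, and acts on the slice over it by [G]
    followed by a translation. *)
Lemma leb_scales_block (R : realType) (d : nat) (a : R) (w : 'rV[R]_d) (G : 'M[R]_d) :
  a != 0 -> leb_scales G -> leb_scales (block_mx (a%:M : 'M[R]_1) w 0 G).
Proof.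
move=> a0 sG A mA.
rewrite det_ublock det_scalar1 !lebS.
rewrite -[RHS](@integral_affine _ a 0 _ a0); last 2 first.
- exact: measurable_leb_slice.
- by move=> x; exact: leb_ge0.
rewrite normrM EFinM -muleA; congr (_ * _)%E.
rewrite -ge0_integralZl//.
- apply: eq_integral => x _; rewrite addr0.
  have mS : bmeas (@slice R d A (a * x)) by exact/pmeas_bmeas/bmeas_slice.
  rewrite -[RHS](leb_shift (x *: w) mS) -(sG _ (bmeas_shift (x *: w) mS)).
  congr (_ * lebesgue_rV _)%E; apply/seteqP; split=> y; rewrite /slice/=;
    by rewrite mul_row_block mulmx0 addr0 -scalar_mxM mul_scalar_mx (mulrC x)
      (addrC (x *: w)).
- apply: measurable_leb_slice.
  exact: (bmeas_linear (block_mx (a%:M : 'M[R]_1) w 0 G) mA).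
- by move=> x _; exact: leb_ge0.
Qed.

Definition swap01 (R : realType) (d : nat) : 'M[R]_(1 + (1 + d)) :=
  block_mx (0 : 'M[R]_1) (row_mx (1%:M : 'M[R]_1) 0) (col_mx (1%:M : 'M[R]_1) 0)
    (block_mx (0 : 'M[R]_1) 0 0 1%:M).

Lemma mul_swap01 (R : realType) (d : nat) (x x' : 'M[R]_1) (y : 'rV[R]_d) :
  row_mx x (row_mx x' y) *m swap01 R d = row_mx x' (row_mx x y).
Proof.
rewrite /swap01 mul_row_block mulmx0 add0r mul_row_col mulmx1 mulmx0 addr0.
by rewrite mul_mx_row mulmx1 mulmx0 mul_row_block !mulmx0 mulmx1 !add0r add_row_mx
  addr0 add0r.
Qed.

Lemma swap01K (R : realType) (d : nat) : swap01 R d *m swap01 R d = 1%:M.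
Proof.
apply/row_matrixP => i; rewrite row_mul.
have e (y : 'rV[R]_(1 + (1 + d))) : y *m swap01 R d *m swap01 R d = y.
  by rewrite -[y]hsubmxK -[rsubmx y]hsubmxK !mul_swap01.
by rewrite rowE e row1.
Qed.

Lemma det_swap01 (R : realType) (d : nat) : `|\det (swap01 R d)| = 1.
Proof.
apply/eqP; rewrite -(@eqrXn2 _ 2)// -normrX expr1n expr2 -det_mulmx swap01K det1.
by rewrite normr1.
Qed.

(** The only place where the order of two integrations is exchanged. *)
Lemma leb_scales_swap (R : realType) (d : nat) : leb_scales (swap01 R d).
Proof.
move=> A mA; rewrite det_swap01 mul1e !lebS.
have -> : (fun x : R => lebesgue_rV (slice [set y | A (y *m swap01 R d)] x)) =
   (fun x : R => \int[lebesgue_measure]_(x' in [set: R])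
     lebesgue_rV (@slice R d (@slice R (1 + d) A x') x))%E.
  apply/funext => x; rewrite lebS; apply: eq_integral => x' _.
  congr lebesgue_rV; apply/seteqP; split=> y; rewrite /slice/=;
    by rewrite mul_swap01.
under [RHS]eq_integral do rewrite lebS.
have := @fubini_tonelli _ _ (measurableTypeR R) (measurableTypeR R) R
  lebesgue_measure lebesgue_measure
  (fun p : R * R => lebesgue_rV (@slice R d (@slice R (1 + d) A p.1) p.2)).
move=> ->//.
- exact/measurable_leb/(@pmeas_slice R d)/(@bmeas_slice R (1 + d)).
- by move=> p; exact: leb_ge0.
Qed.

Lemma reduce_col (R : realType) (d : nat) (c : 'cV[R]_(1 + d)) :
  exists (M : 'M[R]_(1 + d)) (t : R), [/\ M \in unitmx,
     M *m c = col_mx (t%:M : 'M[R]_1) 0 & (c != 0 -> t != 0)].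
Proof.
exists (invmx (col_ebase c)), (if c == 0 then 0 else row_ebase c 0 0).
have uc := col_ebase_unit c.
split; first by rewrite unitmx_inv.
  rewrite -{2}(mulmx_ebase c) !mulmxA mulVmx// mul1mx.
  case: eqVneq => [->|cn0].
    by rewrite mxrank0 pid_mx_0 mul0mx raddf0 col_mx0.
  have -> : \rank c = 1%N.
    by apply/eqP; rewrite eqn_leq rank_leq_col lt0n mxrank_eq0.
  rewrite pid_mx_col mul_col_mx mul1mx mul0mx; congr col_mx; exact: mx11_scalar.
move=> cn0; rewrite (negPf cn0).
by have := row_ebase_unit c; rewrite unitmxE det_mx11 unitfE.
Qed.

(** Every invertible matrix is a product of maps already treated: block triangular
    ones, and the exchange of the first two coordinates.  A block [M] acting on
    all coordinates but the first makes the first column of [G] vanish beyond its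
    second entry, a shear clears its first entry, and the exchange then brings the
    matrix into block triangular form. *)
Lemma leb_scales_unit (R : realType) (d : nat) (G : 'M[R]_d) :
  G \in unitmx -> leb_scales G.
Proof.
elim: d G => [|d IH] G uG.
  move=> A mA; rewrite det_mx00 normr1 mul1e; congr lebesgue_rV.
  by apply/seteqP; split=> y /=; rewrite [_ *m _]thinmx0 [y]thinmx0.
have sblock (a : R) (w : 'rV[R]_d) (H : 'M[R]_d) (K : 'M[R]_(1 + d)) :
    K = block_mx (a%:M : 'M[R]_1) w 0 H -> K \in unitmx -> leb_scales K.
  move=> ->; rewrite unitmxE det_ublock det_scalar1 unitrM unitfE => /andP[a0 uH].
  by apply: leb_scales_block => //; apply: IH; rewrite unitmxE.
case: d IH G uG sblock => [|d] IH G uG sblock.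
  apply: (sblock (G 0 0) 0 0) => //.
  rewrite -[LHS](@submxK _ 1 0 1 0); congr block_mx; last 3 first.
  - by rewrite [LHS]thinmx0.
  - by rewrite [LHS]flatmx0.
  - by rewrite [LHS]flatmx0.
  apply/matrixP => i j; rewrite !ord1 !mxE eqxx mulr1n.
  by congr (fun_of_matrix G _ _); apply: val_inj.
pose G1 : 'M[R]_(1 + (1 + d)) := G.
pose g0 := ulsubmx G1; pose w := ursubmx G1.
pose c := dlsubmx G1; pose G' := drsubmx G1.
have GE : G1 = block_mx g0 w c G' by rewrite submxK.
rewrite -/G1 in uG *; clearbody g0 w c G' G1; clear G.
have [c0|cn0] := eqVneq c 0.
  by apply: (sblock (g0 0 0) w G') => //; rewrite GE c0 -mx11_scalar.
have [M [dl [uM Mc /(_ cn0) dl0]]] := reduce_col c.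
(* The shear by [t] adds [t * dl], which is [- g0], to the corner. *)
pose t := - g0 0 0 / dl.
pose r1 : 'rV[R]_(1 + d) := row_mx (t%:M : 'M[R]_1) 0.
pose E := block_mx (1%:M : 'M[R]_1) r1 0 1%:M.
pose E' := block_mx (1%:M : 'M[R]_1) (- r1) 0 1%:M.
pose D := block_mx (1%:M : 'M[R]_1) 0 0 M.
pose D' := block_mx (1%:M : 'M[R]_1) 0 0 (invmx M).
have D'D : D' *m D = 1%:M.
  rewrite /D /D' mulmx_block !mul0mx !mulmx0 !mul1mx mulVmx// !addr0 !add0r.
  by rewrite -scalar_mx_block.
have E'E : E' *m E = 1%:M.
  rewrite /E /E' mulmx_block !mul0mx !mulmx0 !mulmx1 !mul1mx !addr0 !add0r addrN.
  by rewrite -scalar_mx_block.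
pose S := swap01 R d.
pose K := S *m (E *m (D *m G1)).
have KE : K = block_mx (dl%:M : 'M[R]_1)
     (row_mx (1%:M : 'M[R]_1) 0 *m (M *m G')) 0
     (col_mx (1%:M : 'M[R]_1) 0 *m (w + r1 *m (M *m G')) +
      block_mx (0 : 'M[R]_1) 0 0 1%:M *m (M *m G')).
  rewrite /K GE /D mulmx_block !mul0mx !mul1mx !addr0 !add0r Mc.
  rewrite /E mulmx_block !mul0mx !mul1mx !add0r.
  have -> : g0 + r1 *m col_mx (dl%:M : 'M[R]_1) 0 = 0.
    rewrite /r1 mul_row_col mulmx0 addr0 -scalar_mxM /t mulfVK// [g0]mx11_scalar.
    by rewrite mxE eqxx mulr1n -raddfD/= addrN raddf0.
  rewrite /S /swap01 mulmx_block !mul0mx !mulmx0 !add0r.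
  rewrite mul_row_col mul1mx mul0mx addr0 mul_block_col !mul0mx mul1mx addr0.
  by rewrite addr0 col_mx0.
have uS : S \in unitmx by case/mulmx1_unit: (swap01K R d).
have [uE' uE] := mulmx1_unit E'E.
have [uD' uD] := mulmx1_unit D'D.
have uK : K \in unitmx by rewrite !unitmx_mul uS uE uD uG.
have eG : D' *m (E' *m (S *m K)) = G1.
  by rewrite /K (mulmxA S) swap01K mul1mx (mulmxA E') E'E mul1mx mulmxA D'D mul1mx.
suff : leb_scales (D' *m (E' *m (S *m K))) by rewrite eG.
apply: leb_scales_mul; first by apply: sblock; rewrite ?uD'.
apply: leb_scales_mul; first by apply: sblock; rewrite ?uE'.
apply: leb_scales_mul; first exact: leb_scales_swap.
exact: sblock KE uK.
Qed.

(** * Counting lattice points by volume *)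

Lemma bmeas_box (R : realType) (d : nat) (I : 'I_d -> interval R) :
  bmeas [set y : 'rV[R]_d | forall i, y 0 i \in I i].
Proof.
move=> dQ Q g mg.
rewrite (_ : mkset _ = \bigcap_(i in [set: 'I_d]) [set q | g q 0 i \in I i]).
  apply: fin_bigcap_measurable => [|i _]; first exact: finite_finset.
  have := mg i measurableT [set` I i] (measurable_itv _).
  by rewrite setTI.
by apply/seteqP; split=> [q h i _|q h i]; exact: h.
Qed.

Lemma bmeasU (R : realType) (d : nat) (A B : set 'rV[R]_d) :
  bmeas A -> bmeas B -> bmeas (A `|` B).
Proof.
move=> mA mB dQ Q g mg.
rewrite (_ : mkset _ = [set q | A (g q)] `|` [set q | B (g q)])//.
by apply: measurableU; [exact: mA|exact: mB].
Qed.

Lemma bmeas0 (R : realType) (d : nat) : bmeas (set0 : set 'rV[R]_d).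
Proof. by move=> dQ Q g mg; exact: measurable0. Qed.

(** The unit cell is half open, so that its integral translates tile the space. *)
Definition cube (R : realType) (d : nat) : set 'rV[R]_d :=
  [set y | forall i, 0 <= y 0 i < 1].

Lemma bmeas_cube (R : realType) (d : nat) : bmeas (@cube R d).
Proof.
have := @bmeas_box R d (fun=> `[0, 1[).
by rewrite (_ : mkset _ = @cube R d)//; apply/seteqP; split=> y h i;
  have := h i; rewrite /= in_itv.
Qed.

Lemma leb_cube (R : realType) (d : nat) : lebesgue_rV (@cube R d) = 1%:E.
Proof.
elim: d => [|d IH].
  by rewrite /= indicE mem_set// => -[].
rewrite lebS.
transitivity (\int[lebesgue_measure]_(x in [set: R])
    (\1_(`[0%R, 1%R[%classic : set R) x)%:E)%E; last first.
  rewrite integral_indic// setIT; have := @lebesgue_measure_itv R `[0%R, 1%R[.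
  by rewrite /= lte_fin ltr01 oppr0 adde0 => ->.
apply: eq_integral => x _; rewrite indicE.
case: (boolP (x \in `[0, 1[%classic)) => [|/negP xI].
  move=> /set_mem; rewrite /= in_itv/= => xI; rewrite -IH; congr lebesgue_rV.
  apply/seteqP; split=> y h.
    by move=> i; have := h (rshift 1 i); rewrite (@row_mxEr R 1 1 d).
  move=> i; rewrite -[i](@splitK 1 d); case: (@fintype.split 1 d i) => j /=.
    by rewrite (@row_mxEl R 1 1 d) !ord1 mxE eqxx mulr1n.
  by rewrite (@row_mxEr R 1 1 d); exact: h.
rewrite (_ : slice _ _ = set0) ?leb_set0//.
apply/seteqP; split=> // y /(_ (@lshift 1 d 0)).
rewrite (@row_mxEl R 1 1 d) mxE eqxx mulr1n => h; exfalso; apply: xI.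
by apply: mem_set; rewrite /= in_itv.
Qed.

Lemma cube_int (R : realType) (d : nat) (y : 'rV[R]_d) (z z' : 'rV[int]_d) :
  cube (y - map_mx intr z) -> cube (y - map_mx intr z') -> z = z'.
Proof.
move=> h h'; apply/rowP => i; have := h i; have := h' i; rewrite !mxE.
move=> /andP[a b] /andP[a' b'].
have c : (z 0 i < z' 0 i + 1) by rewrite -(ltr_int R) rmorphD/=; lra.
have c' : (z' 0 i < z 0 i + 1) by rewrite -(ltr_int R) rmorphD/=; lra.
lia.
Qed.

Lemma cube_floor (R : realType) (d : nat) (y : 'rV[R]_d) :
  exists z : 'rV[int]_d, cube (y - map_mx intr z).
Proof.
exists (\row_i Num.floor (y 0 i)) => i; rewrite !mxE.
have /andP[] := @floor_itv R (y 0 i).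
by rewrite subr_ge0 => -> /=; rewrite rmorphD/= ltrBlDl addrC.
Qed.

Lemma leb_cells (R : realType) (d : nat) (s : seq 'rV[int]_d) : uniq s ->
  let A := [set y : 'rV[R]_d | exists2 z, z \in s & cube (y - map_mx intr z)] in
  bmeas A /\ lebesgue_rV A = (size s)%:R%:E.
Proof.
elim: s => [_|z s IH /= /andP[zs us]].
  rewrite /= (_ : mkset _ = set0) ?leb_set0; first by split=> //; exact: bmeas0.
  by apply/seteqP; split=> // y [].
have [mA eA] := IH us; set A := mkset _ in mA eA.
pose C := [set y : 'rV[R]_d | cube (y + - map_mx intr z)].
have mC : bmeas C by apply: bmeas_shift; exact: bmeas_cube.
have eC : lebesgue_rV C = 1%:E.
  by rewrite leb_shift ?leb_cube//; exact: bmeas_cube.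
rewrite (_ : mkset _ = C `|` A).
  split; first exact: bmeasU.
  rewrite leb_setU// ?eC ?eA -?EFinD -?natr1 1?addrC//.
  apply/seteqP; split=> // y [Cy [z' z's Cz']].
  by rewrite (cube_int Cy Cz') z's in zs.
apply/seteqP; split=> y.
  move=> [z']; rewrite inE => /orP[/eqP ->|z's] h; [by left|right].
  by exists z'.
move=> [h|[z' z's h]]; first by exists z; rewrite ?mem_head.
by exists z' => //; rewrite inE z's orbT.
Qed.

Definition normbody (R : realType) (r n : nat) (B : 'M[R]_(r, n)) : set 'rV[R]_r :=
  [set y | forall j, -1 <= (y *m B) 0 j <= 1].

Lemma bmeas_normbody (R : realType) (r n : nat) (B : 'M[R]_(r, n)) :
  bmeas (normbody B).
Proof.
have := bmeas_linear B (@bmeas_box R n (fun=> `[-1, 1])).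
by rewrite (_ : mkset _ = normbody B)//; apply/seteqP; split=> y h i;
  have := h i; rewrite /= in_itv.
Qed.

Lemma leb_normbody_scale (R : realType) (r n : nat) (B : 'M[R]_(r, n)) (c : R) :
  0 < c ->
  bmeas [set y : 'rV[R]_r | forall j, `|(y *m B) 0 j| <= c] /\
  lebesgue_rV [set y : 'rV[R]_r | forall j, `|(y *m B) 0 j| <= c] =
  ((c ^+ r)%:E * lebesgue_rV (normbody B))%E.
Proof.
move=> c0; have mK := bmeas_normbody B.
have E : [set y : 'rV[R]_r | forall j, `|(y *m B) 0 j| <= c] =
    [set y | normbody B (y *m (c^-1)%:M)].
  have e (y : 'rV[R]_r) j : (y *m (c^-1)%:M *m B) 0 j = c^-1 * (y *m B) 0 j.
    by rewrite mul_mx_scalar -scalemxAl mxE.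
  apply/seteqP; split=> y h j; have := h j;
    rewrite e -ler_norml normrM (@gtr0_norm _ c^-1) ?invr_gt0//;
    by rewrite ler_pdivrMl// mulr1.
rewrite E; split; first exact: bmeas_linear.
have uc : (c^-1)%:M \in @unitmx R r.
  by rewrite unitmxE det_scalar unitrX// unitfE invr_eq0 gt_eqF.
rewrite -(leb_scales_unit uc mK) det_scalar muleA -EFinM normrX.
rewrite gtr0_norm ?invr_gt0// -exprMn mulfV ?gt_eqF// expr1n mul1e//.
Qed.

(** The unit cells at the counted points are disjoint and contained in the dilate
    by [T + rho]. *)
Lemma count_upper (R : realType) (r n : nat) (B : 'M[int]_(r, n)) (T rho : R)
    (s : seq 'rV[int]_r) : uniq s ->
  (forall z, z \in s -> forall j, `|(z *m B) 0 j|%:~R <= T) ->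
  (forall u : 'rV[R]_r, cube u -> forall j, `|(u *m map_mx intr B) 0 j| <= rho) ->
  0 < T + rho ->
  ((size s)%:R%:E <= ((T + rho) ^+ r)%:E *
    lebesgue_rV (normbody (map_mx intr B : 'M[R]_(r, n))))%E.
Proof.
move=> us hs hrho h0.
have [mA <-] := @leb_cells R r s us.
have [mK <-] := leb_normbody_scale (map_mx intr B : 'M[R]_(r, n)) h0.
apply: leb_subset => // y [z zs cz] j.
have -> : y = map_mx intr z + (y - map_mx intr z) by rewrite addrC subrK.
rewrite mulmxDl mxE (le_trans (ler_normD _ _))// lerD//; last exact: hrho.
by rewrite -map_mxM mxE -intr_norm; exact: hs.
Qed.

(** Every point of the dilate by [T - rho] lies in the unit cell at its integral
    part, which is one of the counted points. *)
Lemma count_lower (R : realType) (r n : nat) (B : 'M[int]_(r, n)) (T rho : R)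
    (s : seq 'rV[int]_r) : uniq s ->
  (forall z, (forall j, `|(z *m B) 0 j|%:~R <= T) -> z \in s) ->
  (forall u : 'rV[R]_r, cube u -> forall j, `|(u *m map_mx intr B) 0 j| <= rho) ->
  0 < T - rho ->
  (((T - rho) ^+ r)%:E *
    lebesgue_rV (normbody (map_mx intr B : 'M[R]_(r, n))) <= (size s)%:R%:E)%E.
Proof.
move=> us hs hrho h0.
have [mA <-] := @leb_cells R r s us.
have [mK <-] := leb_normbody_scale (map_mx intr B : 'M[R]_(r, n)) h0.
apply: leb_subset => // y hy.
have [z cz] := cube_floor y; exists z => //; apply: hs => j.
rewrite intr_norm.
have -> : ((z *m B) 0 j)%:~R = (map_mx intr z *m map_mx intr B) 0 j :> R.
  by rewrite -map_mxM [RHS]mxE.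
have -> : map_mx intr z = y - (y - map_mx intr z) :> 'rV[R]_r by rewrite subKr.
rewrite mulmxBl mxE (le_trans (ler_normD _ _))// -[leRHS](subrK rho).
apply: lerD; first exact: hy.
by rewrite mxE normrN; exact: hrho.
Qed.

(** The body is contained in a box with sides [4 * a i]: the factor 4 instead of 2
    lets half-open boxes contain closed ones. *)
Lemma leb_normbody_le (R : realType) (r n : nat) (B : 'M[R]_(r, n)) (a : 'I_r -> R) :
  (forall i, 0 < a i) ->
  (forall y, normbody B y -> forall i, `|y 0 i| <= a i) ->
  (lebesgue_rV (normbody B) <= (\prod_i (4 * a i))%:E)%E.
Proof.
move=> a0 h.
pose D : 'M[R]_r := diag_mx (\row_i (4 * a i)^-1).
(* The unit cube is not centred at the origin. *)
pose v : 'rV[R]_r := const_mx 2^-1.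
have d0 i : 0 < (4 * a i)^-1 by rewrite invr_gt0 mulr_gt0.
have detD : \det D = \prod_i (4 * a i)^-1.
  by rewrite det_diag; apply: eq_bigr => i _; rewrite mxE.
have detD0 : 0 < \det D by rewrite detD; apply: prodr_gt0 => i _.
have uD : D \in unitmx by rewrite unitmxE unitfE gt_eqF.
have mC := bmeas_shift v (@bmeas_cube R r).
have sub : normbody B `<=` [set y | cube (y *m D + v)].
  move=> y /h hy i; have := hy i; rewrite mul_mx_diag !mxE ler_norml => /andP[h1 h2].
  have ai := a0 i.
  have -> : y 0 i / (4 * a i) + 2^-1 = (y 0 i + 2 * a i) / (4 * a i).
    by field; rewrite gt_eqF.
  by rewrite divr_ge0 ?ler_pdivrMr ?ltr_pdivrMr ?mulr_gt0//; lra.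
apply: le_trans (leb_subset (bmeas_normbody B) (bmeas_linear D mC) sub) _.
have := leb_scales_unit uD mC; rewrite leb_shift ?leb_cube; last exact: bmeas_cube.
rewrite gtr0_norm// => /(congr1 (fun x => (\prod_i (4 * a i))%:E * x)%E).
rewrite mule1 muleA -EFinM detD -big_split/= big1; first by rewrite mul1e => ->.
by move=> i _; rewrite mulfV// gt_eqF// mulr_gt0.
Qed.

(** * Covolume and section volume in terms of a basis *)

Lemma cholesky (R : realType) (r : nat) (M : 'M[R]_r) :
  M^T = M -> (forall x : 'rV[R]_r, x != 0 -> 0 < (x *m M *m x^T) 0 0) ->
  exists G : 'M[R]_r, G *m G^T = M.
Proof.
elim: r M => [|r IH] M0 sM0 pM0.
  by exists 0; apply/matrixP => -[].
pose M : 'M[R]_(1 + r) := M0.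
pose a := ulsubmx M 0 0; pose w : 'rV[R]_r := ursubmx M; pose M' := drsubmx M.
have ME : M = block_mx (a%:M : 'M[R]_1) w w^T M'.
  rewrite /a -mx11_scalar /w trmx_ursub (_ : M^T = M)//.
  by rewrite submxK.
have pM (x : 'rV[R]_(1 + r)) : x != 0 -> 0 < (x *m M *m x^T) 0 0 by exact: pM0.
have sM : M^T = M by exact: sM0.
rewrite -/M; clearbody a w M' M; clear M0 sM0 pM0.
move: sM; rewrite {1 2}ME tr_block_mx trmxK => /eq_block_mx[_ _ _ sM'].
have quad (u : R) (x : 'rV[R]_r) : (row_mx (u%:M : 'M[R]_1) x *m M *m
    (row_mx (u%:M : 'M[R]_1) x)^T) 0 0 =
    a * u ^+ 2 + 2 * (u * (x *m w^T) 0 0) + (x *m M' *m x^T) 0 0.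
  rewrite ME mul_row_block tr_row_mx mul_row_col !mulmxDl tr_scalar_mx.
  have e : u%:M *m w *m x^T = u *: (x *m w^T)^T :> 'M[R]_1.
    by rewrite trmx_mul trmxK mul_scalar_mx -scalemxAl.
  have e2 : x *m w^T *m u%:M = u *: (x *m w^T) :> 'M[R]_1 by rewrite mul_mx_scalar.
  rewrite e e2 -!scalar_mxM; move: (x *m w^T) (x *m M' *m x^T) => p q.
  by rewrite !mxE eqxx mulr1n; ring.
have a0 : 0 < a.
  have := pM (row_mx (1%:M : 'M[R]_1) 0).
  rewrite quad !mul0mx !mxE !mulr0 !addr0 expr1n mulr1; apply.
  apply/eqP => /(congr1 lsubmx); rewrite row_mxKl linear0 => /matrixP/(_ 0 0).
  by rewrite !mxE eqxx => /eqP; rewrite mulr1n oner_eq0.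
have [G' G'E] : exists G' : 'M[R]_r, G' *m G'^T = M' - a^-1 *: (w^T *m w).
  apply: IH.
    by rewrite linearB/= linearZ/= trmx_mul trmxK sM'.
  (* Completing the square: this [u] minimizes the form along the first axis. *)
  move=> x xn0; pose u := - (x *m w^T) 0 0 / a.
  have := pM (row_mx (u%:M : 'M[R]_1) x).
  have -> : row_mx (u%:M : 'M[R]_1) x != 0.
    by apply: contra_neq xn0 => /(congr1 rsubmx); rewrite row_mxKr linear0.
  move=> /(_ isT); rewrite quad.
  have -> : (x *m (M' - a^-1 *: (w^T *m w)) *m x^T) 0 0 =
     (x *m M' *m x^T) 0 0 - a^-1 * ((x *m w^T) 0 0) ^+ 2.
    rewrite mulmxBr mulmxBl -scalemxAr -scalemxAl mulmxA -(mulmxA _ w).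
    have -> : w *m x^T = (x *m w^T)^T by rewrite trmx_mul trmxK.
    move: (x *m w^T) (x *m M' *m x^T) => p q.
    by rewrite !mxE big_ord1 !mxE expr2.
  move: ((x *m w^T) 0 0) ((x *m M' *m x^T) 0 0) @u => p q u.
  suff -> : a * u ^+ 2 + 2 * (u * p) + q = q - a^-1 * p ^+ 2 by [].
  by rewrite /u; field; rewrite gt_eqF.
pose b := Num.sqrt a.
have b0 : b != 0 by rewrite sqrtr_eq0 -ltNge.
pose K : 'M[R]_(1 + r) := block_mx (b%:M : 'M[R]_1) 0 (b^-1 *: w^T) G'.
exists K; suff: K *m K^T = M by [].
rewrite ME /K tr_block_mx mulmx_block !trmx0 !mul0mx !mulmx0 !addr0.
rewrite tr_scalar_mx -scalar_mxM -expr2 sqr_sqrtr ?ltW// G'E.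
rewrite mul_scalar_mx mul_mx_scalar [(b^-1 *: w^T)^T]linearZ/= trmxK.
rewrite !scalerA mulfV// !scale1r -scalemxAr.
rewrite -scalemxAl scalerA -invfM -expr2 sqr_sqrtr ?ltW//.
by rewrite addrC subrK.
Qed.

(** If the Gram matrix is [G *m G^T], then [invmx G *m B] has orthonormal rows. *)
Lemma orthonormal_exists (R : realType) (r n : nat) (B : 'M[R]_(r, n)) :
  B *m B^T \in unitmx ->
  exists Q : 'M[R]_(r, n), orthonormal_basis (range (fun c : 'rV[R]_r => c *m B)) Q.
Proof.
move=> uB.
have [||G GE] := @cholesky R r (B *m B^T).
- by rewrite trmx_mul trmxK.
- move=> x xn0; have xB : x *m B != 0.
    apply: contra_neq xn0 => h; rewrite -[x](mulmxK uB) mulmxA h.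
    by rewrite !mul0mx.
  rewrite mulmxA -mulmxA -trmx_mul.
  have [j xj] : exists j, (x *m B) 0 j != 0.
    apply/existsP; apply: contraR xB; rewrite negb_exists => /forallP h.
    by apply/eqP/rowP => j; rewrite [RHS]mxE; apply/eqP; have := h j; rewrite negbK.
  move: (x *m B) xj => y yj.
  rewrite mxE (bigD1 j)//= mxE -expr2 ltr_wpDr//; last by rewrite exprn_even_gt0.
  by apply: sumr_ge0 => i _; rewrite mxE -expr2 sqr_ge0.
have uG : G \in unitmx.
  by move: uB; rewrite -GE unitmx_mul => /andP[].
exists (invmx G *m B); split.
  rewrite trmx_mul mulmxA -(mulmxA _ B) -GE mulmxA mulVmx// mul1mx -trmx_mul.
  by rewrite mulVmx// trmx1.
apply/seteqP; split=> _ [c _ <-].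
  by exists (c *m G) => //; rewrite mulmxA mulmxK.
by exists (c *m invmx G) => //; rewrite mulmxA.
Qed.

Lemma orthonormal_frame (R : realType) (r n d : nat) (B : 'M[R]_(r, n))
    (Q : 'M[R]_(d, n)) : B *m B^T \in unitmx ->
  orthonormal_basis (range (fun c : 'rV[R]_r => c *m B)) Q ->
  d = r /\ exists G : 'M[R]_(r, d), B = G *m Q.
Proof.
move=> uB [QQ WE].
have BG : B = (B *m Q^T) *m Q.
  apply/row_matrixP => i; rewrite !row_mul.
  have : range (fun c : 'rV[R]_r => c *m B) (row i B).
    by exists (delta_mx 0 i) => //; rewrite -rowE.
  by rewrite WE => -[c _ <-]; rewrite -(mulmxA c) QQ mulmx1.
have [H QH] : exists H : 'M[R]_(d, r), Q = H *m B.
  have /choice[f fE] : forall i, exists c : 'rV[R]_r, c *m B = row i Q.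
    move=> i; have : range (fun x : 'rV[R]_d => x *m Q) (row i Q).
      by exists (delta_mx 0 i) => //; rewrite -rowE.
    by rewrite -WE => -[c _ <-]; exists c.
  exists (\matrix_i f i); apply/row_matrixP => i.
  by rewrite row_mul rowK fE.
split; last by exists (B *m Q^T).
apply/eqP; rewrite eqn_leq; apply/andP; split.
  by apply: (@mulmx1_min _ _ _ H (B *m Q^T)); rewrite mulmxA -QH.
apply: (@mulmx1_min _ _ _ (B *m Q^T) (Q *m B^T *m invmx (B *m B^T))).
by rewrite !mulmxA -BG mulmxV.
Qed.

(** The volume, in lattice coordinates, of the points of sup norm at most 1. *)
Definition bodyvol (R : realType) (r n : nat) (B : 'M[int]_(r, n)) : R :=
  fine (lebesgue_rV (normbody (map_mx intr B : 'M[R]_(r, n)))).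

Lemma leb_parallelepiped (R : realType) (r n : nat) (B : 'M[int]_(r, n))
    (Q : 'M[R]_(r, n)) (G : 'M[R]_r) :
  Q *m Q^T = 1%:M -> G \in unitmx -> map_mx intr B = G *m Q ->
  lebesgue_rV [set x : 'rV[R]_r | parallelepiped R B (x *m Q)] = `|\det G|%:E.
Proof.
move=> QQ uG BE.
have -> : [set x : 'rV[R]_r | parallelepiped R B (x *m Q)] =
    [set x | cube (x *m invmx G)].
  apply/seteqP; split=> x /=.
    move=> [t tc]; rewrite BE mulmxA => /(congr1 (mulmx ^~ Q^T)).
    rewrite -!mulmxA !QQ !mulmx1 => <-; rewrite mulmxK//.
  by move=> h; exists (x *m invmx G) => //; rewrite BE mulmxA mulmxKV.
have uG' : invmx G \in unitmx by rewrite unitmx_inv.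
have := leb_scales_unit uG' (@bmeas_cube R r).
rewrite leb_cube det_inv => /(congr1 (fun x => `|\det G|%:E * x)%E).
rewrite mule1 muleA -EFinM normrV ?mulfV ?mul1e//.
by rewrite normr_eq0 -unitfE -unitmxE.
Qed.

Lemma gram_unit (R : realType) (r n : nat) (L : set 'rV[int]_n)
    (B : 'M[int]_(r, n)) : Zbasis L B ->
  (map_mx intr B : 'M[R]_(r, n)) *m (map_mx intr B)^T \in unitmx.
Proof.
move=> [iB _]; rewrite map_trmx -map_mxM unitmxE det_map_mx unitfE intr_eq0.
apply/negP => /det0P[x xn0 h].
have := (gram_posdef iB).2 x xn0.
by rewrite h mul0mx mxE ltxx.
Qed.

(** Both volumes are read in coordinates with respect to some orthonormal basis
    [Q] of the span.  If [G] is the matrix of the lattice basis in terms of [Q],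
    then passing to lattice coordinates divides volumes by [`|\det G|], which is
    the covolume, and [G *m G^T] is the Gram matrix of the lattice basis. *)
Lemma nu_latdet (R : realType) (r n : nat) (L : set 'rV[int]_n)
    (B : 'M[int]_(r, n)) : Zbasis L B ->
  [/\ 0 <= latdet R L, latdet R L ^+ 2 = (\det (B *m B^T))%:~R &
      nu R L = latdet R L * bodyvol R B].
Proof.
move=> zB; have uB := gram_unit R zB.
have WE : lspan R L = range (fun c : 'rV[R]_r => c *m map_mx intr B).
  by case: (zB) => _ ->; rewrite lspan_range.
rewrite /nu /latdet /subspace_measure.
set dQ := xget _ _; set rB := xget _ _.
have hQ : orthonormal_basis (lspan R L) (tagged dQ).
  rewrite /dQ; case: xgetP => [x _ //|].
  have [Q oQ] := orthonormal_exists uB; rewrite -WE in oQ.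
  by move=> /(_ (Tagged (fun d : nat => 'M[R]_(d, n)) Q)) /(_ oQ).
have hB : Zbasis L (tagged rB).
  rewrite /rB; case: xgetP => [x _ //|].
  by move=> /(_ (Tagged (fun d : nat => 'M[int]_(d, n)) B)) /(_ zB).
clearbody dQ rB; case: dQ hQ => d Q /= hQ; case: rB hB => r' B' /= zB'.
have [er' _] := Zbasis_rank zB zB'; subst r'.
rewrite WE in hQ; have [ed [G BG]] := orthonormal_frame uB hQ; subst d.
have WE' : lspan R L = range (fun c : 'rV[R]_r => c *m map_mx intr B').
  by case: (zB') => _ ->; rewrite lspan_range.
have hQ' := hQ; rewrite -WE WE' in hQ'.
have [_ [G' BG']] := orthonormal_frame (gram_unit R zB') hQ'.
have QQ := hQ.1.
have gr (C : 'M[int]_(r, n)) (H : 'M[R]_r) : map_mx intr C = H *m Q ->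
    `|\det H| ^+ 2 = (\det (C *m C^T))%:~R.
  move=> e; rewrite -normrX ger0_norm ?sqr_ge0// -det_map_mx map_mxM -map_trmx e.
  by rewrite trmx_mul mulmxA -(mulmxA H) QQ mulmx1 det_mulmx det_tr expr2.
have un (C : 'M[int]_(r, n)) (H : 'M[R]_r) : Zbasis L C ->
    map_mx intr C = H *m Q -> H \in unitmx.
  move=> zC e; have := gram_unit R zC; rewrite e trmx_mul mulmxA -(mulmxA H) QQ.
  by rewrite mulmx1 unitmx_mul => /andP[].
have uG := un _ _ zB BG; have uG' := un _ _ zB' BG'.
rewrite (leb_parallelepiped QQ uG' BG') /=.
have eG : `|\det G'| = `|\det G|.
  apply/eqP; rewrite -(@eqrXn2 _ 2)// (gr _ _ BG) (gr _ _ BG').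
  by rewrite (Zbasis_gram_det zB zB').
split => //; first by rewrite (gr _ _ BG') (Zbasis_gram_det zB zB').
rewrite eG /bodyvol.
have -> : [set x : 'rV[R]_r | (lspan R L `&`
    [set x0 : 'rV[R]_n | forall i, -1 <= x0 0 i <= 1]) (x *m Q)] = normbody Q.
  apply/seteqP; split=> x; first by case.
  by move=> h; split=> //; rewrite WE hQ.2; exists x.
rewrite -(leb_scales_unit uG (bmeas_normbody Q)).
have -> : [set y | normbody Q (y *m G)] = normbody (map_mx intr B).
  by rewrite BG; apply/seteqP; split=> y h j; have := h j; rewrite mulmxA.
have [f|] := boolP (lebesgue_rV (normbody (map_mx intr B : 'M[R]_(r, n))) \is a fin_num).
  by rewrite fineM.
(* For an infinite volume both sides vanish, by the convention for [fine]. *)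
rewrite ge0_fin_numE ?leb_ge0// -leNgt leye_eq => /eqP ->.
by rewrite gt0_muley ?lte_fin ?normr_gt0 -?unitfE -?unitmxE// mulr0.
Qed.

(** * Coordinates with respect to a reduced basis *)

(** Each term of the Leibniz formula is at most [c ^+ m] times the product of all
    [u i] and all [v i]. *)
Lemma det_bound (R : realDomainType) (m : nat) (M : 'M[R]_m) (u v : 'I_m -> R) (c : R) :
  (forall i j, `|M i j| <= c * (u i * v j)) ->
  `|\det M| <= m`!%:R * (c ^+ m * (\prod_i u i * \prod_i v i)).
Proof.
move=> h; rewrite /determinant (le_trans (ler_norm_sum _ _ _))//.
rewrite -card_Sn mulr_natl -sumr_const.
rewrite [leRHS](eq_bigl predT)//; apply: ler_sum => s _.
rewrite normrM normrX normrN1 expr1n mul1r normr_prod.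
have -> : \prod_i v i = \prod_i v (s i) by exact: (reindex_perm s).
have -> : c ^+ m = \prod_(i < m) c by rewrite prodr_const card_ord.
rewrite -!big_split/=.
by apply: ler_prod => i _; rewrite normr_ge0 h.
Qed.

Definition supn (n : nat) (x : 'rV[int]_n) : nat := (\max_(j < n) `|x ord0 j|)%N.

Lemma supnP (n : nat) (x : 'rV[int]_n) j : (`|x ord0 j| <= supn x)%N.
Proof. exact: (leq_bigmax (F := fun j => `|x ord0 j|%N)). Qed.

Lemma supn_eq0 (n : nat) (x : 'rV[int]_n) : supn x = 0%N -> x = 0.
Proof.
move=> h; apply/rowP => j; rewrite mxE; apply/eqP; rewrite -absz_eq0 -leqn0.
by apply: leq_trans (supnP x j) _; rewrite h.
Qed.

Definition rnorm (R : realType) (r n : nat) (B : 'M[int]_(r, n)) (i : 'I_r) : R :=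
  (supn (row i B))%:R.
Arguments rnorm R {r n} B i.

Lemma rnorm_ge1 (R : realType) (r n : nat) (B : 'M[int]_(r, n)) i :
  injective (fun x : 'rV[int]_r => x *m B) -> 1 <= rnorm R B i.
Proof.
move=> iB; rewrite /rnorm ler1n lt0n; apply/eqP => /supn_eq0 h.
have : (delta_mx 0 i : 'rV[int]_r) = 0 by apply: iB; rewrite mul0mx -rowE.
by move=> /rowP/(_ i); rewrite !mxE !eqxx.
Qed.

Lemma rnormP (R : realType) (r n : nat) (B : 'M[int]_(r, n)) i j :
  `|(B i j)%:~R| <= rnorm R B i.
Proof.
have := supnP (row i B) j; rewrite mxE => h.
by rewrite -intr_norm -abszE -pmulrn ler_nat.
Qed.

Definition gramR (R : realType) (r n : nat) (B : 'M[int]_(r, n)) : 'M[R]_r :=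
  map_mx intr B *m (map_mx intr B)^T.
Arguments gramR R {r n} B.

Lemma gramR_le (R : realType) (r n : nat) (B : 'M[int]_(r, n)) i j :
  `|gramR R B i j| <= n%:R * (rnorm R B i * rnorm R B j).
Proof.
rewrite mxE (le_trans (ler_norm_sum _ _ _))//.
rewrite -[X in X%:R * _](card_ord n) mulr_natl -sumr_const ler_sum// => k _.
by rewrite !mxE normrM ler_pM// rnormP.
Qed.

Lemma gramR_diag_ge (R : realType) (r n : nat) (B : 'M[int]_(r, n)) i :
  rnorm R B i ^+ 2 <= gramR R B i i.
Proof.
have [->|] := eqVneq (rnorm R B i) 0.
  rewrite expr0n /= mxE; apply: sumr_ge0 => j _.
  by rewrite !mxE -expr2 sqr_ge0.
rewrite /rnorm pnatr_eq0 -lt0n /supn => h.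
have [j _ jE] : exists2 j : 'I_n, true &
    (\max_(j < n) `|row i B ord0 j| = `|row i B ord0 j|)%N.
  have n0 : (0 < #|'I_n|)%N.
    rewrite card_ord lt0n; apply/eqP => n0; subst n.
    by move: h; rewrite big_ord0.
  by have [j jE] := bigop.eq_bigmax (fun j => `|row i B ord0 j|%N) n0; exists j.
rewrite jE [leRHS]mxE (bigD1 j)//= !mxE -expr2 -[leLHS]addr0 lerD//.
  by rewrite pmulrn abszE intr_norm real_normK ?num_real.
by apply: sumr_ge0 => k _; rewrite !mxE -expr2 sqr_ge0.
Qed.

Lemma gramR_det (R : realType) (r n : nat) (B : 'M[int]_(r, n)) :
  \det (gramR R B) = (\det (B *m B^T))%:~R.
Proof. by rewrite /gramR map_trmx -map_mxM det_map_mx. Qed.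

Lemma gramR_det_le (R : realType) (r n : nat) (B : 'M[int]_(r, n)) :
  \det (gramR R B) <= r`!%:R * n%:R ^+ r * (\prod_i rnorm R B i) ^+ 2.
Proof.
rewrite (le_trans (ler_norm _))// -mulrA expr2.
exact/det_bound/gramR_le.
Qed.

Definition reduced (C : nat) (r n : nat) (B : 'M[int]_(r, n)) : Prop :=
  injective (fun x : 'rV[int]_r => x *m B) /\
  \prod_i (B *m B^T) i i <= C%:Z * \det (B *m B^T).

Lemma reduced_prod (R : realType) (C r n : nat) (B : 'M[int]_(r, n)) :
  reduced C B -> (\prod_i rnorm R B i) ^+ 2 <= C%:R * \det (gramR R B).
Proof.
move=> [_ h].
have : \prod_i (gramR R B i i) <= C%:R * \det (gramR R B).
  rewrite gramR_det pmulrn -rmorphM/=.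
  have -> : \prod_i gramR R B i i = (\prod_i (B *m B^T) i i)%:~R.
    rewrite rmorph_prod; apply: eq_bigr => i _.
    by rewrite /gramR map_trmx -map_mxM mxE.
  by rewrite ler_int.
apply: le_trans; rewrite -prodrXl; apply: ler_prod => i _.
by rewrite sqr_ge0 gramR_diag_ge.
Qed.

Lemma gramR_det_gt0 (R : realType) (r n : nat) (B : 'M[int]_(r, n)) C :
  reduced C B -> 0 < \det (gramR R B).
Proof.
move=> rB; have h := reduced_prod R rB; have [iB _] := rB.
have : 0 < (\prod_i rnorm R B i) ^+ 2.
  apply: exprn_gt0; apply: prodr_gt0 => i _.
  by apply: lt_le_trans (rnorm_ge1 R i iB).
move=> /lt_le_trans/(_ h); have [->|C0] := posnP C; first by rewrite mul0r ltxx.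
by rewrite pmulr_rgt0// ltr0n.
Qed.

(** Multiplying [y *m B] by the transpose of [B] gives [y *m G] with [G] the Gram
    matrix; so [\det G *: y] is obtained from it through the adjugate.  Each
    cofactor of [G], at places [k] and [i], is at most a constant times the
    product of all row norms but the [k]-th and of all row norms but the [i]-th;
    and for a reduced basis the square of the product of all row norms is at most
    [C * \det G]. *)
Lemma reduced_box (R : realType) (C r n : nat) (B : 'M[int]_(r, n)) (T : R)
    (y : 'rV[R]_r) : reduced C B ->
  (forall j, `|(y *m map_mx intr B) 0 j| <= T) ->
  forall i, `|y 0 i| * rnorm R B i <= (r`! * n ^ r * C)%:R * T.
Proof.
move=> rB hy i.
have T0 : 0 <= T.
  case: n B rB hy => [|n] B rB hy; last exact: le_trans (hy 0).
  exfalso; have [iB _] := rB.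
  have /rowP/(_ i) : (delta_mx 0 i : 'rV[int]_r) = 0.
    by apply: iB; rewrite [LHS]thinmx0 [RHS]thinmx0.
  by rewrite !mxE !eqxx.
case: r B y rB hy i => [|r] B y rB hy i; first by case: i.
pose G := gramR R B; have dG : 0 < \det G := gramR_det_gt0 R rB.
pose b := rnorm R B; have b0 k : 0 <= b k by rewrite /b/rnorm ler0n.
pose h := y *m map_mx intr B *m (map_mx intr B)^T.
have hk k : `|h 0 k| <= n%:R * T * b k.
  rewrite mxE (le_trans (ler_norm_sum _ _ _))//.
  rewrite -[X in X%:R * _ * _](card_ord n) -mulrA mulr_natl -sumr_const ler_sum// => j _.
  by rewrite normrM ler_pM// !mxE rnormP.
have yE : y 0 i * \det G = \sum_k h 0 k * \adj G k i.
  have : y *m G *m \adj G = \det G *: y by rewrite -mulmxA mul_mx_adj mul_mx_scalar.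
  move=> /matrixP/(_ 0 i); rewrite [RHS]mxE mulrC => <-.
  by rewrite [LHS]mxE /h /G /gramR mulmxA.
have adjb k : `|\adj G k i| * (b i * b k) <= r`!%:R * (n%:R ^+ r * (\prod_j b j) ^+ 2).
  rewrite mxE /cofactor normrM normrX normrN1 expr1n mul1r.
  have := @det_bound R r (row' i (col' k G)) (fun a => b (lift i a))
    (fun a => b (lift k a)) n%:R.
  have hh : forall a a',
      `|row' i (col' k G) a a'| <= n%:R * (b (lift i a) * b (lift k a')).
    move=> a a'; rewrite !mxE -/(gramR R B).
    by have := gramR_le R B (lift i a) (lift k a'); rewrite mxE.
  move=> /(_ hh) => db.
  apply: le_trans (ler_wpM2r _ db) _; first by rewrite mulr_ge0.
  have -> : (\prod_j b j) ^+ 2 = (b i * \prod_a b (lift i a)) *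
      (b k * \prod_a b (lift k a)).
    by rewrite expr2 {1}(bigD1_ord i)// (bigD1_ord k).
  by rewrite le_eqVlt; apply/orP; left; apply/eqP; ring.
rewrite -(ler_pM2r dG) mulrAC.
rewrite -[X in `|_| * X * _](gtr0_norm dG) -normrM yE.
have : `|\sum_k h 0 k * \adj G k i| * b i <=
    r.+1%:R * (n%:R * T * (r`!%:R * (n%:R ^+ r * (\prod_j b j) ^+ 2))).
  rewrite (le_trans (ler_wpM2r (b0 i) (ler_norm_sum _ _ _)))// mulr_suml.
  rewrite -[X in X%:R * _](card_ord r.+1) mulr_natl -sumr_const ler_sum// => k _.
  rewrite normrM (le_trans (ler_wpM2r (b0 i) (ler_wpM2r (normr_ge0 _) (hk k))))//.
  have nT : 0 <= n%:R * T by rewrite mulr_ge0// ler0n.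
  rewrite (_ : _ * b k * _ * _ = n%:R * T * (`|\adj G k i| * (b i * b k))); last by ring.
  exact: ler_wpM2l (adjb k).
move=> /le_trans; apply.
have := reduced_prod R rB; rewrite -/b -/G => P2.
have c0 : 0 <= r.+1%:R * (n%:R * T * (r`!%:R * n%:R ^+ r)).
  by rewrite !mulr_ge0// ?ler0n// exprn_ge0// ler0n.
have -> : r.+1%:R * (n%:R * T * (r`!%:R * (n%:R ^+ r * (\prod_j b j) ^+ 2))) =
  r.+1%:R * (n%:R * T * (r`!%:R * n%:R ^+ r)) * (\prod_j b j) ^+ 2 by ring.
apply: le_trans (ler_wpM2l c0 P2) _.
rewrite le_eqVlt; apply/orP; left; apply/eqP.
by rewrite factS !natrM natrX exprS; ring.
Qed.

(** * Sums over integer matrices *)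

Lemma esum_subset (R : realType) (T : choiceType) (S S' : set T) (f : T -> \bar R) :
  S `<=` S' -> (\esum_(x in S) f x <= \esum_(x in S') f x)%E.
Proof.
move=> SS'; apply: le_ereal_sup => _ [A [fA AS] <-]; exists A => //.
by split=> // x /AS/SS'.
Qed.

Lemma esum_ge_term (R : realType) (T : choiceType) (S : set T) (f : T -> \bar R) x :
  S x -> (f x <= \esum_(y in S) f y)%E.
Proof.
move=> Sx; apply: esum_ge; exists [set x]; last by rewrite fsbig_set1.
by split; [exact: finite_set1|move=> _ ->].
Qed.

Lemma esum_scale_le (R : realType) (T : choiceType) (S : set T) (r : R)
    (f : T -> \bar R) : 0 <= r -> (forall x, (0 <= f x)%E) ->
  (\esum_(x in S) (r%:E * f x) <= r%:E * \esum_(x in S) f x)%E.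
Proof.
move=> r0 f0; apply: ge_ereal_sup => _ [A [fA AS] <-].
rewrite -ge0_mule_fsumr//; apply: lee_wpmul2l; first by rewrite lee_fin.
by apply: esum_ge; exists A.
Qed.

Lemma esumZl (R : realType) (T : choiceType) (S : set T) (c : \bar R)
    (f : T -> \bar R) : (0 <= c)%E -> (forall x, (0 <= f x)%E) ->
  (\esum_(x in S) (c * f x) = c * \esum_(x in S) f x)%E.
Proof.
move=> c0 f0; case: c c0 => [r| |//] c0.
  have {c0} r0 : 0 <= r by [].
  have [->|rn0] := eqVneq r 0.
    by rewrite mul0e esum1// => x _; rewrite mul0e.
  have rp : 0 < r by rewrite lt_neqAle eq_sym rn0.
  apply/eqP; rewrite eq_le esum_scale_le//=.
  have {1}-> : \esum_(x in S) f x = \esum_(x in S) (r^-1%:E * (r%:E * f x))%E.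
    by apply: eq_esum => x _; rewrite muleA -EFinM mulVf// mul1e.
  have h := @esum_scale_le _ _ S r^-1 (fun x => r%:E * f x)%E.
  apply: (@le_trans _ _ (r%:E * (r^-1%:E * \esum_(x in S) (r%:E * f x)))%E).
    apply: lee_wpmul2l => //; apply: h; first by rewrite invr_ge0.
    by move=> x; rewrite mule_ge0// f0.
  by rewrite muleA -EFinM mulfV// mul1e.
have [f00|/existsNP[x /not_implyP[Sx /eqP fx]]] :=
    pselect (forall x, S x -> f x = 0%E).
  by rewrite esum1 ?(esum1 f00) ?mule0// => x /f00 ->; rewrite mule0.
have fx0 : (0 < f x)%E by rewrite lt_neqAle eq_sym fx f0.
rewrite gt0_mulye; last exact: lt_le_trans fx0 (esum_ge_term _ Sx).
apply/eqP; rewrite -leye_eq.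
apply: le_trans (@esum_ge_term _ _ S (fun x => +oo * f x)%E x Sx).
by rewrite gt0_mulye.
Qed.

Lemma esumZr (R : realType) (T : choiceType) (S : set T) (c : \bar R)
    (f : T -> \bar R) : (0 <= c)%E -> (forall x, (0 <= f x)%E) ->
  (\esum_(x in S) (f x * c) = (\esum_(x in S) f x) * c)%E.
Proof.
move=> c0 f0; rewrite muleC -esumZl//; apply: eq_esum => x _; exact: muleC.
Qed.

Lemma esum_inj_le (R : realType) (T T' : choiceType) (S : set T) (S' : set T')
    (e : T -> T') (f : T' -> \bar R) :
  (forall x y, S x -> S y -> e x = e y -> x = y) ->
  (forall x, S x -> S' (e x)) ->
  (\esum_(x in S) f (e x) <= \esum_(y in S') f y)%E.
Proof.
move=> ie eS; rewrite -(@esum_image _ _ _ S e f).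
  by apply: esum_subset => _ [x Sx <-]; exact: eS.
by move=> x y /set_mem Sx /set_mem Sy; exact: ie.
Qed.

Lemma esum_pair (R : realType) (T1 T2 : choiceType) (S1 : set T1) (S2 : T1 -> set T2)
    (f : T1 -> T2 -> \bar R) : (forall i j, S1 i -> S2 i j -> (0 <= f i j)%E) ->
  (\esum_(i in S1) \esum_(j in S2 i) f i j =
   \esum_(k in [set k | S1 k.1 /\ S2 k.1 k.2]) f k.1 k.2)%E.
Proof. by move=> f0; rewrite esum_esum. Qed.

Lemma esum_col_mx (R : realType) (m n : nat) (f : 'M[int]_(1 + m, n) -> \bar R) :
  (forall X, (0 <= f X)%E) ->
  (\esum_(X in [set: 'M[int]_(1 + m, n)]) f X =
   \esum_(x in [set: 'rV[int]_n]) \esum_(Y in [set: 'M[int]_(m, n)]) f (col_mx x Y))%E.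
Proof.
move=> f0; rewrite esum_pair//.
apply: (@reindex_esum _ _ _ _ _ (fun k : 'rV[int]_n * 'M[int]_(m, n) => col_mx k.1 k.2)).
split=> //.
  move=> [x Y] [x' Y'] _ _ /= /eq_col_mx[]; by move=> -> ->.
move=> X _; exists (usubmx X, dsubmx X) => //=; exact: vsubmxK.
Qed.

(** A sum of products over all choices of the rows is the product of the sums. *)
Lemma esum_rows (R : realType) (m n : nat) (f : 'I_m -> 'rV[int]_n -> R) :
  (forall i x, 0 <= f i x) ->
  (\esum_(X in [set: 'M[int]_(m, n)]) (\prod_i f i (row i X))%:E =
   \prod_i \esum_(x in [set: 'rV[int]_n]) (f i x)%:E)%E.
Proof.
elim: m f => [|m IH] f f0.
  rewrite big_ord0 (_ : setT = [set 0 : 'M[int]_(0, n)]).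
    by rewrite esum_set1 big_ord0.
  by apply/seteqP; split=> // X _; rewrite [X]flatmx0.
rewrite big_ord_recl -(IH (fun i => f (lift ord0 i)))//.
have p0 X : 0 <= \prod_(i < m) f (lift ord0 i) (row i X) by apply: prodr_ge0.
rewrite -esumZr; last 2 first.
- by apply: esum_ge0 => X _; rewrite lee_fin.
- by move=> x; rewrite lee_fin.
rewrite (@esum_col_mx _ m n (fun X => (\prod_i f i (row i X))%:E)).
  apply: eq_esum => x _; rewrite -esumZl ?lee_fin//.
    apply: eq_esum => Y _; rewrite -EFinM; congr EFin; rewrite big_ord_recl; congr (_ * _).
      congr (f _ _); apply/rowP => j; rewrite mxE.
      have := @col_mxEu int 1 m n x Y 0 j.
      by rewrite (_ : lshift m 0 = ord0)//; apply: val_inj.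
    apply: eq_bigr => i _; congr (f _ _); apply/rowP => j; rewrite [LHS]mxE [RHS]mxE.
    have := @col_mxEd int 1 m n x Y i j.
    by rewrite (_ : rshift 1 i = lift ord0 i)//; apply: val_inj.
by move=> X; rewrite lee_fin; apply: prodr_ge0.
Qed.

(** * Counting integer matrices in boxes *)

(** Cardinality as an extended real number, so that the counts of possibly
    infinite families can be compared with the main terms as sums. *)
Definition cnt (R : realType) (T : choiceType) (S : set T) : \bar R :=
  \esum_(x in S) 1%E.
Arguments cnt R {T} S.

Lemma cnt_ge0 (R : realType) (T : choiceType) (S : set T) : (0 <= cnt R S)%E.
Proof. by apply: esum_ge0. Qed.

Lemma cntE (R : realType) (T : choiceType) (S : set T) :
  cnt R S = \esum_(x in [set: T]) ((x \in S)%:R)%:E.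
Proof.
rewrite /cnt esum_mkcond; apply: eq_esum => x _.
by case: (x \in S).
Qed.

Lemma cnt_subset (R : realType) (T : choiceType) (S S' : set T) :
  S `<=` S' -> (cnt R S <= cnt R S')%E.
Proof. exact: esum_subset. Qed.

Lemma cnt_image (R : realType) (T T' : choiceType) (S : set T) (e : T -> T') :
  injective e -> cnt R (e @` S) = cnt R S.
Proof. by move=> ie; rewrite /cnt esum_image// => x y _ _; exact: ie. Qed.

Lemma cnt_tr (R : realType) (m n : nat) (S : set 'M[int]_(m, n)) :
  cnt R [set X : 'M[int]_(n, m) | S X^T] = cnt R S.
Proof.
rewrite -(cnt_image R S (@trmx_inj int m n)); congr (cnt R _).
apply/seteqP; split=> [X SX|_ [X SX <-]]; last by rewrite /= trmxK.
by exists X^T => //; rewrite trmxK.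
Qed.

Lemma cnt_rows (R : realType) (m n : nat) (S : 'I_m -> set 'rV[int]_n) :
  cnt R [set X : 'M[int]_(m, n) | forall i, S i (row i X)] =
  (\prod_i cnt R (S i))%E.
Proof.
under eq_bigr do rewrite cntE.
rewrite -(esum_rows (f := fun i x => (x \in S i)%:R))// cntE.
apply: eq_esum => X _; congr EFin.
have [h|h] := pselect (forall i, S i (row i X)).
  rewrite mem_set// big1// => i _; rewrite mem_set//; exact: h.
rewrite memNset//; have /existsNP[i hi] := h.
by rewrite (bigD1 i)//= memNset// mul0r.
Qed.

Lemma finite_box (m n : nat) (Y : nat) :
  finite_set [set X : 'M[int]_(m, n) | forall i j, (`|X i j| <= Y)%N].
Proof.
pose e (X : 'M['I_(Y + Y).+1]_(m, n)) : 'M[int]_(m, n) :=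
  \matrix_(i, j) ((X i j : nat)%:Z - Y%:Z).
apply: (@sub_finite_set _ _ (e @` [set: 'M['I_(Y + Y).+1]_(m, n)])).
  move=> X h; exists (\matrix_(i, j) inord (`|(X i j + Y%:Z)%R|%N)) => //.
  apply/matrixP => i j; rewrite !mxE inordK; have := h i j; lia.
exact: finite_image.
Qed.

Lemma cnt_finite (R : realType) (T : choiceType) (S : set T) : finite_set S ->
  exists s : seq T, [/\ uniq s, (forall x, (x \in s) <-> S x) & cnt R S = (size s)%:R%:E].
Proof.
move=> fS; exists (enum_fset (fset_set S)); split.
- exact: fset_uniq.
- by move=> x; rewrite in_fset_set//; split=> [/set_mem|/mem_set].
- rewrite /cnt esum_fset// fsbig_finite//= big_const_seq count_predT.
  elim: (size _) => //= k ->; rewrite -EFinD; congr EFin.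
  by rewrite -natr1 addrC.
Qed.

Lemma cnt_box1 (R : realType) (Y : nat) :
  cnt R [set x : 'rV[int]_1 | (`|x ord0 ord0| <= Y)%N] = ((Y.*2.+1)%:R)%:E.
Proof.
pose e (i : nat) : 'rV[int]_1 := const_mx (i%:Z - Y%:Z).
have ie : injective e.
  by move=> i j /rowP/(_ 0); rewrite !mxE; lia.
have -> : [set x : 'rV[int]_1 | (`|x ord0 ord0| <= Y)%N] = e @` `I_(Y.*2.+1).
  apply/seteqP; split=> [x /= h|_ [i /= iY <-]]; last by rewrite mxE; lia.
  exists `|(x ord0 ord0 + Y%:Z)%R|%N => /=; first lia.
  apply/rowP => j; rewrite (_ : j = ord0); last by rewrite [j]ord1.
  rewrite mxE gez0_abs ?addrK//; lia.
rewrite cnt_image// /cnt esum_fset// -fsbig_ord sumEFin; congr EFin.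
by rewrite sumr_const card_ord.
Qed.

Lemma cnt_box (R : realType) (n Y : nat) :
  cnt R [set x : 'rV[int]_n | forall j, (`|x ord0 j| <= Y)%N] =
  ((Y.*2.+1)%:R ^+ n)%:E.
Proof.
pose S (i : 'I_n) := [set x : 'rV[int]_1 | (`|x ord0 ord0| <= Y)%N].
have -> : [set x : 'rV[int]_n | forall j, (`|x ord0 j| <= Y)%N] =
    [set x : 'rV[int]_n | [set X : 'cV[int]_n | forall i, S i (row i X)] x^T].
  by apply/seteqP; split=> x h j; have := h j; rewrite /S/= !mxE.
rewrite cnt_tr cnt_rows; under eq_bigr do rewrite cnt_box1.
by rewrite prodEFin prodr_const card_ord.
Qed.

(** One coordinate [k] with [phi k 0 != 0] is determined by the others. *)
Lemma cnt_subspace (R : realType) (n Y : nat) (phi : 'cV[rat]_n) : phi != 0 ->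
  (cnt R [set x : 'rV[int]_n | (forall j, (`|x ord0 j| <= Y)%N) /\
    (map_mx intr x *m phi = 0)%R] <= ((Y.*2.+1)%:R ^+ n.-1)%:E)%E.
Proof.
case: n phi => [|n] phi phi0; first by move: phi0; rewrite [phi]flatmx0 eqxx.
have [k pk] : exists k, phi k 0 != 0.
  apply/existsP; apply: contraR phi0; rewrite negb_exists => /forallP h.
  by apply/eqP/colP => j; rewrite [RHS]mxE; apply/eqP; have := h j; rewrite negbK.
rewrite -(cnt_box R n Y) /cnt.
apply: (@esum_inj_le _ _ _ _ _ (fun x : 'rV[int]_n.+1 => col' k x) (fun=> 1%E)).
  move=> x y [_ xp] [_ yp] xy.
  have : map_mx intr (x - y) *m phi = 0 by rewrite raddfB/= mulmxBl xp yp subrr.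
  have d j : (x - y) 0 (lift k j) = 0.
    by have /rowP/(_ j) := xy; rewrite !mxE => ->; rewrite subrr.
  move=> /matrixP/(_ 0 0); rewrite mxE (bigD1_ord k)//= big1 ?addr0; last first.
    by move=> j _; rewrite mxE d mul0r.
  rewrite mxE [RHS]mxE => /eqP; rewrite mulf_eq0 (negPf pk) orbF intr_eq0 => /eqP dk.
  apply/eqP; rewrite -subr_eq0; apply/eqP/rowP => j; rewrite [RHS]mxE.
  by case: (unliftP k j) => [j' ->|->].
by move=> x [bx _] j; rewrite mxE.
Qed.

(** * Matrices of deficient rank in a box *)

Lemma esum_col_mxC (R : realType) (m n : nat) (f : 'M[int]_(1 + m, n) -> \bar R) :
  (forall X, (0 <= f X)%E) ->
  (\esum_(X in [set: 'M[int]_(1 + m, n)]) f X =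
   \esum_(Y in [set: 'M[int]_(m, n)]) \esum_(x in [set: 'rV[int]_n]) f (col_mx x Y))%E.
Proof.
move=> f0; rewrite esum_pair//.
apply: (@reindex_esum _ _ _ _ _ (fun k : 'M[int]_(m, n) * 'rV[int]_n => col_mx k.2 k.1)).
split=> //.
  by move=> [x Y] [x' Y'] _ _ /= /eq_col_mx[] -> ->.
by move=> X _; exists (dsubmx X, usubmx X) => //=; exact: vsubmxK.
Qed.

Lemma cnt_fibers (R : realType) (m n : nat) (S : set 'M[int]_(1 + m, n))
    (S2 : set 'M[int]_(m, n)) (F : 'M[int]_(m, n) -> set 'rV[int]_n) (c : \bar R) :
  (0 <= c)%E ->
  (forall x Y, S (col_mx x Y) -> S2 Y /\ F Y x) ->
  (forall Y, S2 Y -> (cnt R (F Y) <= c)%E) ->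
  (cnt R S <= c * cnt R S2)%E.
Proof.
move=> c0 hS hF; rewrite cntE esum_col_mxC//.
rewrite (cntE R S2) -esumZl//.
apply: le_esum => Y _.
have [S2Y|nS2Y] := pselect (S2 Y).
  rewrite (mem_set S2Y) mule1; apply: le_trans (hF _ S2Y).
  rewrite cntE; apply: le_esum => x _; rewrite lee_fin ler_nat.
  case: (boolP (_ \in S)) => // /set_mem /hS[_ h]; by rewrite mem_set.
rewrite memNset// mule0 esum1// => x _.
by rewrite memNset// => /hS[].
Qed.

Lemma cntU_le (R : realType) (T : choiceType) (S A B : set T) :
  S `<=` A `|` B -> (cnt R S <= cnt R A + cnt R B)%E.
Proof.
move=> h; rewrite !cntE -esumD//; apply: le_esum => x _.
rewrite -EFinD lee_fin -natrD ler_nat.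
case: (boolP (x \in S)) => // /set_mem/h [Ax|Bx]; first by rewrite (mem_set Ax) ltn_addr.
by rewrite (mem_set Bx) ltn_addl.
Qed.

(** If [X] is dependent, then either its rows after the first one are dependent,
    which is the inductive case, or the first row lies in their span.  The span
    has dimension less than [n], so by [cnt_subspace] the second alternative saves
    a factor of the size of the range of one entry of the first row. *)
Lemma cnt_singular (R : realType) (r n : nat) (Y : 'I_r -> nat) : (r <= n)%N ->
  (cnt R [set X : 'M[int]_(r, n) | (forall i j, (`|X i j| <= Y i)%N) /\
     (\rank (map_mx intr X : 'M[rat]_(r, n)) < r)%N] <=
   ((\prod_i ((Y i).*2.+1)%:R ^+ n) * \sum_i (((Y i).*2.+1)%:R)^-1)%:E)%E.
Proof.
elim: r Y => [|r IH] Y rn.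
  rewrite /cnt (_ : mkset _ = set0) ?esum_set0.
    by rewrite lee_fin big_ord0 mul1r big_ord0.
  by apply/seteqP; split=> // X [_].
pose M i : R := ((Y i).*2.+1)%:R.
have M0 i : 0 < M i by rewrite ltr0n.
pose Y' i := Y (lift ord0 i).
pose S' := [set X : 'M[int]_(r, n) | (forall i j, (`|X i j| <= Y' i)%N) /\
     (\rank (map_mx intr X : 'M[rat]_(r, n)) < r)%N].
pose F' := [set X : 'M[int]_(r, n) | (forall i j, (`|X i j| <= Y' i)%N) /\
     (\rank (map_mx intr X : 'M[rat]_(r, n)) = r)%N].
pose box := [set x : 'rV[int]_n | forall j, (`|x ord0 j| <= Y ord0)%N].
set S := mkset _.
pose A := [set X : 'M[int]_(1 + r, n) | S' (dsubmx X) /\ box (usubmx X)].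
pose D (Z : 'M[int]_(r, n)) := [set x : 'rV[int]_n | box x /\
   ((map_mx intr x : 'rV[rat]_n) <= map_mx intr Z)%MS].
pose B := [set X : 'M[int]_(1 + r, n) | F' (dsubmx X) /\ D (dsubmx X) (usubmx X)].
have box0 : (0 <= (M ord0 ^+ n)%:E)%E by rewrite lee_fin exprn_ge0// ltW.
have SAB : S `<=` A `|` B.
  move=> X0; pose X : 'M[int]_(1 + r, n) := X0.
  rewrite /S /= => -[hX rX].
  have bx : box (usubmx X).
    by move=> j; rewrite mxE (_ : lshift r ord0 = ord0)//; apply: val_inj.
  have bd i j : (`|(dsubmx X) i j| <= Y' i)%N.
    by rewrite mxE (_ : rshift 1 i = lift ord0 i)//; apply: val_inj.
  have [rd|rd] := ltnP (\rank (map_mx intr (dsubmx X) : 'M[rat]_(r, n))) r.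
    by left; split.
  have rd' : \rank (map_mx intr (dsubmx X) : 'M[rat]_(r, n)) = r.
    by apply/eqP; rewrite eqn_leq rank_leq_row.
  right; split=> //; split=> //.
  pose XQ : 'M[rat]_(1 + r, n) := map_mx intr X.
  have : (XQ <= map_mx intr (dsubmx X))%MS.
    have h : (map_mx intr (dsubmx X) <= XQ)%MS.
      by apply/row_subP => i; rewrite -map_row row_dsubmx map_row row_sub.
    by rewrite -(mxrank_leqif_sup h) rd' eqn_leq -{1}rd' mxrankS.
  by apply: submx_trans; apply/row_subP => i; rewrite -map_row row_usubmx map_row row_sub.
apply: le_trans (cntU_le R SAB) _.
have hA : (cnt R A <= (M ord0 ^+ n)%:E * cnt R S')%E.
  apply: (@cnt_fibers R r n A S' (fun _ => box)) => //.
    by move=> x Z; rewrite /A/= col_mxKd col_mxKu.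
  by move=> Z _; rewrite cnt_box.
have hB : (cnt R B <= (M ord0 ^+ n.-1)%:E * cnt R F')%E.
  apply: (@cnt_fibers R r n B F' D).
  - by rewrite lee_fin exprn_ge0// ltW.
  - by move=> x Z; rewrite /B/= col_mxKd col_mxKu.
  move=> Z [_ rZ].
  (* A rational functional [v] which vanishes on the span of the rows of [Z]. *)
  have : kermx (map_mx intr Z : 'M[rat]_(r, n))^T != 0.
    by rewrite -mxrank_eq0 mxrank_ker mxrank_tr rZ -lt0n subn_gt0.
  case/rowV0Pn => v /sub_kermxP vZ v0.
  apply: le_trans (cnt_subspace R (Y ord0) (phi := v^T) _); last first.
    by rewrite -(inj_eq (@trmx_inj _ _ _)) trmxK trmx0.
  apply: cnt_subset => x [bx /submxP[c xE]]; split => //.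
  rewrite xE -mulmxA (_ : _ *m v^T = 0) ?mulmx0//.
  by apply: trmx_inj; rewrite trmx_mul trmxK vZ trmx0.
have hF' : (cnt R F' <= (\prod_i M (lift ord0 i) ^+ n)%:E)%E.
  pose bx (i : 'I_r) := [set x : 'rV[int]_n | forall j, (`|x ord0 j| <= Y' i)%N].
  apply: (@le_trans _ _ (cnt R [set X : 'M[int]_(r, n) | forall i, bx i (row i X)])).
    by apply: cnt_subset => X [h _] i j; rewrite mxE.
  rewrite cnt_rows (eq_bigr (fun i => (M (lift ord0 i) ^+ n)%:E)) ?prodEFin// => i _.
  by rewrite /bx (cnt_box R n (Y' i)).
apply: (@le_trans _ _ ((M ord0 ^+ n)%:E *
   ((\prod_i M (lift ord0 i) ^+ n) * \sum_i (M (lift ord0 i))^-1)%:E +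
   (M ord0 ^+ n.-1)%:E * (\prod_i M (lift ord0 i) ^+ n)%:E)%E).
  apply: leeD.
    apply: le_trans hA _; apply: lee_wpmul2l => //.
    exact: (IH Y' (ltnW rn)).
  apply: le_trans hB _; apply: lee_wpmul2l => //.
  by rewrite lee_fin exprn_ge0// ltW.
rewrite -!EFinM -EFinD lee_fin 2!big_ord_recl -/(M ord0).
rewrite le_eqVlt; apply/orP; left; apply/eqP.
have -> : M ord0 ^+ n.-1 = M ord0 ^+ n * (M ord0)^-1.
  by rewrite -{2}(@prednK n) ?exprSr ?mulfK ?gt_eqF//; exact: leq_trans rn.
set P := \prod_(i < r) _; set Q := \sum_(i < r) _.
by rewrite -/(M ord0); ring.
Qed.

(** * Matrices spanning a given lattice *)

(** The mean value bound for powers, multiplied by [s] to keep the exponent [m]. *)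
Lemma expr_sub_le (R : realFieldType) (m : nat) (s t : R) : 0 <= t -> t <= s ->
  (s ^+ m - t ^+ m) * s <= m%:R * (s - t) * s ^+ m.
Proof.
move=> t0 ts; have s0 : 0 <= s by exact: le_trans ts.
elim: m => [|m IH]; first by rewrite !expr0 subrr !mul0r.
have -> : (s ^+ m.+1 - t ^+ m.+1) * s =
    s * ((s ^+ m - t ^+ m) * s) + s * (s - t) * t ^+ m by rewrite !exprS; ring.
have -> : m.+1%:R * (s - t) * s ^+ m.+1 =
    s * (m%:R * (s - t) * s ^+ m) + s * (s - t) * s ^+ m.
  by rewrite -natr1 exprS; ring.
apply: lerD; first exact: ler_wpM2l.
by apply: ler_wpM2l; [rewrite mulr_ge0// subr_ge0 | exact: lerXn2r].
Qed.

Lemma nat_le_truncn (R : realType) (T : R) (k : nat) : 0 <= T ->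
  (k%:R <= T) = (k <= Num.truncn T)%N.
Proof. by move=> T0; rewrite truncn_ge_nat. Qed.

Lemma maxnorm_le (n : nat) (A : 'M[int]_n) (k : nat) :
  (maxnorm A <= k)%N <-> (forall i j, (`|A i j| <= k)%N).
Proof.
split=> [h i j|h].
  apply: leq_trans h.
  apply: leq_trans (leq_bigmax (F := fun i => \max_(j < n) `|A i j|)%N i).
  exact: (leq_bigmax (F := fun j => `|A i j|%N)).
by apply/bigmax_leqP => i _; apply/bigmax_leqP => j _.
Qed.

Definition satset (R : realType) (n : nat) (T : R) (L : set 'rV[int]_n) :
    set 'M[int]_n := [set A | (maxnorm A)%:R <= T /\ sat A = L].

(** The coordinates of the lattice vectors of sup norm at most [T]. *)
Definition shortset (R : realType) (r n : nat) (T : R) (B : 'M[int]_(r, n)) :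
    set 'rV[int]_r := [set z | forall j, `|(z *m B) 0 j|%:~R <= T].

Lemma abs_le_nat (R : realType) (x : int) (T : R) : 0 <= T ->
  (`|x|%:~R <= T) = (`|x|%N <= Num.truncn T)%N.
Proof. by move=> T0; rewrite -nat_le_truncn// -abszE -pmulrn. Qed.

(** In coordinates, a matrix with rows in [L] spans [L] over the rationals exactly
    when its coordinate matrix has full rank. *)
Lemma satset_image (R : realType) (r n : nat) (T : R) (L : set 'rV[int]_n)
    (B : 'M[int]_(r, n)) : 0 <= T -> primitive r L -> Zbasis L B ->
  satset T L = (fun X : 'M[int]_(n, r) => X *m B) @`
    [set X | (forall i, shortset T B (row i X)) /\
             \rank (map_mx intr X : 'M[rat]_(n, r)) = r].
Proof.
move=> T0 pL zB; have [iB LE] := zB.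
have rB := Zbasis_row_free pL zB.
have fB : row_free (map_mx intr B : 'M[rat]_(r, n)) by rewrite /row_free rB.
apply/seteqP; split=> [A [mA sA]|_ [X [hX rX] <-]].
  have [X AE] : exists X : 'M[int]_(n, r), A = X *m B.
    by apply: rows_in_range => i; rewrite -LE -sA; exact: sat_mem_row.
  exists X => //; split.
    move=> i j; rewrite -row_mul -AE mxE abs_le_nat//.
    by move: mA; rewrite nat_le_truncn// => /maxnorm_le.
  rewrite -(mxrankMfree _ fB) -map_mxM -AE.
  by apply: (@primitive_rank_unique n _ _ L) => //; rewrite -sA; exact: sat_primitive.
split.
  rewrite nat_le_truncn//; apply/maxnorm_le => i j.
  by rewrite -abs_le_nat//; have := hX i j; rewrite -row_mul mxE.
rewrite -[RHS](primitive_sat pL zB).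
have h : (map_mx intr (X *m B) <= (map_mx intr B : 'M[rat]_(r, n)))%MS.
  by rewrite map_mxM submxMl.
have h' : (map_mx intr B <= (map_mx intr (X *m B) : 'M[rat]_(n, n)))%MS.
  by rewrite -(mxrank_leqif_sup h) map_mxM mxrankMfree// rX rB.
apply/seteqP; split=> x; rewrite /sat/= => hx; exact: submx_trans hx _.
Qed.

(** All choices of [n] short vectors give [size s ^+ n] matrices; those which do
    not span [L] are counted by [cnt_singular], in the box that [Y] describes. *)
Lemma cnt_satset_bounds (R : realType) (r n : nat) (T : R) (L : set 'rV[int]_n)
    (B : 'M[int]_(r, n)) (Y : 'I_r -> nat) : 0 <= T -> (r <= n)%N ->
  primitive r L -> Zbasis L B ->
  (forall z, shortset T B z -> forall i, (`|z ord0 i| <= Y i)%N) ->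
  exists (s : seq 'rV[int]_r) (a : R),
   [/\ uniq s, (forall z, z \in s <-> shortset T B z),
       cnt R (satset T L) = a%:E, 0 <= a <= (size s)%:R ^+ n &
       (size s)%:R ^+ n <= a + (\prod_i ((Y i).*2.+1)%:R ^+ n) *
         \sum_i (((Y i).*2.+1)%:R)^-1].
Proof.
move=> T0 rn pL zB hY.
pose Ym := (\max_i Y i)%N.
have fS : finite_set (shortset T B).
  apply: sub_finite_set (finite_box 1 r Ym) => z hz i j; rewrite [i]ord1.
  by apply: leq_trans (hY z hz j) _; exact: (leq_bigmax (F := Y)).
have [s [us sE cs]] := cnt_finite R fS.
pose full := [set X : 'M[int]_(n, r) | forall i, shortset T B (row i X)].
pose good := [set X : 'M[int]_(n, r) | (forall i, shortset T B (row i X)) /\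
             \rank (map_mx intr X : 'M[rat]_(n, r)) = r].
pose bad := [set X : 'M[int]_(n, r) | full X /\
             (\rank (map_mx intr X : 'M[rat]_(n, r)) < r)%N].
have cfull : cnt R full = ((size s)%:R ^+ n)%:E.
  rewrite (cnt_rows R (fun i : 'I_n => shortset T B)) cs prodEFin.
  by rewrite prodr_const card_ord.
have cgood : cnt R (satset T L) = cnt R good.
  rewrite (satset_image T0 pL zB) cnt_image//.
  move=> X X' /= e; apply/row_matrixP => i; case: zB => iB _; apply: iB => /=.
  by rewrite -!row_mul e.
have gf : (cnt R good <= cnt R full)%E by apply: cnt_subset => X [].
have fg : (cnt R full <= cnt R good + cnt R bad)%E.
  apply: cntU_le => X hX.
  have [h|h] := ltnP (\rank (map_mx intr X : 'M[rat]_(n, r))) r; first by right.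
  by left; split=> //; apply/eqP; rewrite eqn_leq h rank_leq_col.
have cb : (cnt R bad <= ((\prod_i ((Y i).*2.+1)%:R ^+ n) *
         \sum_i (((Y i).*2.+1)%:R)^-1)%:E)%E.
  apply: le_trans (cnt_singular R Y rn).
  rewrite -(cnt_tr R (n:=r) (m:=n) bad); apply: cnt_subset => X [hX rX]; split.
    move=> i j; have := hY _ (hX j) i; by rewrite !mxE.
  by rewrite -mxrank_tr map_trmx.
have gfin : cnt R good \is a fin_num.
  by rewrite ge0_fin_numE ?cnt_ge0//; apply: le_lt_trans gf _; rewrite cfull ltry.
exists s, (fine (cnt R good)); split => //.
- by rewrite cgood fineK.
- by rewrite fine_ge0 ?cnt_ge0//= -lee_fin fineK// -cfull.
rewrite -lee_fin EFinD fineK// -cfull; apply: le_trans fg _.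
by apply: leeD.
Qed.

(** * Uniform asymptotics for one lattice *)

Lemma prod_ge1 (R : realDomainType) (I : Type) (s : seq I) (P : pred I) (f : I -> R) :
  (forall i, P i -> 1 <= f i) -> 1 <= \prod_(i <- s | P i) f i.
Proof. by move=> h; elim/big_ind: _ => // x y; exact: mulr_ege1. Qed.

Lemma cube_row_le (R : realType) (r n : nat) (B : 'M[int]_(r, n)) (u : 'rV[R]_r) :
  cube u -> forall j, `|(u *m map_mx intr B) 0 j| <= \sum_i rnorm R B i.
Proof.
move=> hu j; rewrite mxE (le_trans (ler_norm_sum _ _ _))// ler_sum// => i _.
rewrite normrM mxE -[leRHS]mul1r ler_pM// ?rnormP//.
by have /andP[u0 u1] := hu i; rewrite ger0_norm// ltW.
Qed.

Lemma bodyvol_bounds (R : realType) (C r n : nat) (B : 'M[int]_(r, n)) :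
  reduced C B -> (0 < (r`! * n ^ r * C))%N ->
  let c : R := (r`! * n ^ r * C)%:R in
  [/\ lebesgue_rV (normbody (map_mx intr B : 'M[R]_(r, n))) = (bodyvol R B)%:E,
      0 <= bodyvol R B & bodyvol R B <= (4 * c) ^+ r / \prod_i rnorm R B i].
Proof.
move=> rB c0 c; have [iB _] := rB.
have b0 i : 0 < rnorm R B i by apply: lt_le_trans (rnorm_ge1 R i iB).
have cp : 0 < c by rewrite /c ltr0n.
have := @leb_normbody_le R r n (map_mx intr B) (fun i => c / rnorm R B i).
have h1 : forall i, 0 < c / rnorm R B i by move=> i; rewrite divr_gt0.
have h2 : forall y, normbody (map_mx intr B : 'M[R]_(r, n)) y ->
    forall i, `|y 0 i| <= c / rnorm R B i.
  move=> y hy i; rewrite ler_pdivlMr// -[leRHS]mulr1.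
  by apply: (reduced_box rB) => j; rewrite ler_norml; exact: hy.
move=> /(_ h1 h2) le.
have fin : lebesgue_rV (normbody (map_mx intr B : 'M[R]_(r, n))) \is a fin_num.
  by rewrite ge0_fin_numE ?leb_ge0//; apply: le_lt_trans le _; rewrite ltry.
have E : lebesgue_rV (normbody (map_mx intr B : 'M[R]_(r, n))) = (bodyvol R B)%:E.
  by rewrite /bodyvol fineK.
split=> //; first by rewrite -lee_fin -E leb_ge0.
rewrite -lee_fin -E; apply: le_trans le _; rewrite lee_fin.
rewrite le_eqVlt; apply/orP; left; apply/eqP.
have -> : (4 * c) ^+ r = \prod_(i < r) (4 * c) by rewrite prodr_const card_ord.
by rewrite -prodfV -big_split/=; apply: eq_bigr => i _; rewrite mulrA.
Qed.

Lemma prod_ge_term (R : realType) (r n : nat) (B : 'M[int]_(r, n)) i :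
  injective (fun x : 'rV[int]_r => x *m B) ->
  rnorm R B i <= \prod_j rnorm R B j.
Proof.
move=> iB; rewrite (bigD1 i)//= -[leLHS]mulr1; apply: ler_wpM2l.
  by apply: le_trans ler01 _; exact: rnorm_ge1.
by apply: prod_ge1 => j _; exact: rnorm_ge1.
Qed.

(** Let [rho] be the sum of the row norms, which bounds the vectors of a unit cell
    and is at most [r * p].  If every row norm is at most [c * T], the count
    [N] of short vectors lies between the volumes of the dilates by [T - rho] and
    [T + rho], which changes its [n]-th power by a relative error of order
    [rho / T]; and the ranges [x i] of the coordinates are at least 1, so the
    deficient matrices have relative frequency of the same order.  Otherwise
    nothing is counted, and the claimed main term is itself within the error since
    [p / T >= 1]. *)
Lemma satset_asymp (R : realType) (C r n : nat) : (0 < C)%N -> (0 < n)%N -> (r <= n)%N ->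
  (0 < r)%N ->
  exists2 K : R, 0 <= K & forall (L : set 'rV[int]_n) (B : 'M[int]_(r, n)),
   primitive r L -> Zbasis L B -> reduced C B -> forall T : R, 1 <= T ->
   let p := \prod_i rnorm R B i in let V := bodyvol R B in
   exists a : R, [/\ cnt R (satset T L) = a%:E,
     0 <= a <= K * (T ^+ r / p) ^+ n,
     (a = 0 \/ forall i, rnorm R B i <= K * T),
     0 <= V ^+ n <= K * p ^- n &
     `|a - (V * T ^+ r) ^+ n| <= K * (T ^+ r / p) ^+ n * (p / T)].
Proof.
move=> C0 n0 rn r0.
have c0 : (0 < r`! * n ^ r * C)%N by rewrite !muln_gt0 fact_gt0 expn_gt0 n0 C0.
pose c : R := (r`! * n ^ r * C)%:R.
have c1 : 1 <= c by rewrite ler1n.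
have cp : 0 < c by exact: lt_le_trans ltr01 c1.
(* [K1] bounds the volume of the body, [K2] the dilation by [T + rho], and [K3]
   the box of coordinates, each raised to the power needed for [n] rows. *)
pose m := (r * n)%N.
pose K1 : R := (4 * c) ^+ m; pose K2 : R := (1 + r%:R * c) ^+ m.
pose K3 : R := (3 * c) ^+ m.
have K1p : 0 <= K1 by rewrite exprn_ge0// mulr_ge0// ltW.
have K2p : 0 <= K2 by rewrite exprn_ge0// addr_ge0// mulr_ge0// ltW.
have K3p : 0 <= K3 by rewrite exprn_ge0// mulr_ge0// ltW.
pose K4 : R := K1 * K2 * m%:R * r%:R.
have K4p : 0 <= K4 by rewrite !mulr_ge0.
pose K : R := c + K1 + K1 * K2 + K1 * r%:R + K4 + K3 * r%:R.
have K12p : 0 <= K1 * K2 by rewrite mulr_ge0.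
have K1rp : 0 <= K1 * r%:R by rewrite mulr_ge0.
have K3rp : 0 <= K3 * r%:R by rewrite mulr_ge0.
exists K; first by rewrite /K; lra.
move=> L B pL zB rB T T1 p V.
have [iB _] := rB.
have b1 i : 1 <= rnorm R B i by exact: rnorm_ge1.
have b0 i : 0 < rnorm R B i by exact: lt_le_trans ltr01 (b1 i).
have T0 : 0 < T by exact: lt_le_trans ltr01 T1.
have p1 : 1 <= p by apply: prod_ge1 => i _.
have p0 : 0 < p by exact: lt_le_trans ltr01 p1.
have [lebE V0 Vle] := bodyvol_bounds R rB c0; rewrite -/V -/p -/c in lebE V0 Vle.
pose x i := c * T / rnorm R B i.
have x0 i : 0 <= x i by rewrite /x divr_ge0 ?mulr_ge0// ltW.
pose Y i := Num.truncn (x i).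
have hY z : shortset T B z -> forall i, (`|z ord0 i| <= Y i)%N.
  move=> hz i; rewrite /Y -nat_le_truncn// /x ler_pdivlMr//.
  have := @reduced_box R C r n B T (map_mx intr z) rB.
  rewrite -/c => /(_ _ i); rewrite mxE -intr_norm -abszE -pmulrn; apply.
  by move=> j; rewrite -map_mxM mxE -intr_norm; exact: hz.
have [s [a [us sE ca /andP[a0 aN] Na]]] :=
  cnt_satset_bounds (ltW T0) rn pL zB hY.
pose N : R := (size s)%:R; rewrite -/N in aN Na.
pose rho := \sum_i rnorm R B i.
have rho_p : rho <= r%:R * p.
  rewrite -[X in X%:R * _](card_ord r) mulr_natl -sumr_const ler_sum// => i _.
  exact: prod_ge_term.
have rho0 : 0 <= rho by apply: sumr_ge0 => i _; exact: ltW.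
have Nup : N <= (T + rho) ^+ r * V.
  rewrite -lee_fin EFinM -lebE; apply: (@count_upper _ _ _ _ T rho) => //.
  - by move=> z /sE hz j; exact: hz.
  - exact: cube_row_le.
  - by rewrite ltr_wpDr.
have Nlow : 0 < T - rho -> (T - rho) ^+ r * V <= N.
  move=> h; rewrite -lee_fin EFinM -lebE; apply: (@count_lower _ _ _ _ T rho) => //.
  - by move=> z hz; apply/sE.
  - exact: cube_row_le.
have N0 : 0 <= N by rewrite ler0n.
pose W := (T ^+ r / p) ^+ n.
have W0 : 0 <= W by rewrite exprn_ge0// divr_ge0// ?exprn_ge0// ltW.
have VnK : V ^+ n <= K1 * p ^- n.
  apply: (@le_trans _ _ (((4 * c) ^+ r / p) ^+ n)).
    by apply: lerXn2r; rewrite ?nnegrE// divr_ge0 ?exprn_ge0 ?mulr_ge0// ltW.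
  by rewrite exprMn -exprM exprVn.
have VTW : (V * T ^+ r) ^+ n <= K1 * W.
  rewrite exprMn; apply: le_trans (ler_wpM2r _ VnK) _.
    by rewrite !exprn_ge0// ltW.
  by rewrite /W exprMn exprVn; rewrite mulrAC mulrA.
have pT0 : 0 <= p / T by rewrite divr_ge0// ltW.
have Wpt0 : 0 <= W * (p / T) by rewrite mulr_ge0.
have pn0 : 0 <= p ^- n by rewrite invr_ge0 exprn_ge0// ltW.
have Vn : 0 <= V ^+ n <= K * p ^- n.
  rewrite exprn_ge0//=; apply: le_trans VnK _; apply: ler_wpM2r => //.
  by rewrite /K; lra.
exists a.
(* If some basis vector is longer than [c * T], its coordinate vanishes on all
   short vectors, so that no matrix of norm at most [T] spans [L]. *)
have [/forallP hb|] := boolP [forall i, rnorm R B i <= c * T]; last first.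
  rewrite negb_forall => /existsP[i]; rewrite -ltNge => bi.
  have a00 : a = 0.
    have : satset T L = set0.
      rewrite (satset_image (ltW T0) pL zB); apply/seteqP; split=> // A [X [hX rX] _].
      have Yi : Y i = 0%N.
        apply/eqP; rewrite -leqn0 leqNgt /Y -nat_le_truncn// -ltNge.
        by rewrite /x ltr_pdivrMr// mul1r.
      have : \rank (map_mx intr X : 'M[rat]_(n, r))^T = r by rewrite mxrank_tr.
      move=> rk; have /row_freeP[D DE] : row_free (map_mx intr X : 'M[rat]_(n, r))^T.
        by rewrite /row_free rk.
      have : row i ((map_mx intr X : 'M[rat]_(n, r))^T) = 0.
        apply/rowP => k; rewrite !mxE; have := hY _ (hX k) i.
        by rewrite Yi leqn0 absz_eq0 mxE => /eqP ->.
      move=> h; have : row i (1%:M : 'M[rat]_r) = 0 by rewrite -DE row_mul h mul0mx.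
      by move=> /rowP/(_ i); rewrite !mxE eqxx.
    by move=> h; move: ca; rewrite h /cnt esum_set0 => -[].
  split=> //.
  - by rewrite a00 lexx mulr_ge0// /K; lra.
  - by left.
  rewrite a00 sub0r normrN ger0_norm; last first.
    by rewrite exprn_ge0// mulr_ge0// exprn_ge0// ltW.
  have pT1 : 1 <= p / T.
    rewrite ler_pdivlMr// mul1r; apply: le_trans (prod_ge_term R i iB).
    apply: le_trans (ltW bi); rewrite -[leLHS]mul1r ler_wpM2r//; exact: ltW.
  apply: le_trans VTW _; rewrite -mulrA.
  apply: (@le_trans _ _ (K1 * (W * (p / T)))).
    by rewrite ler_wpM2l// -[leLHS]mulr1 ler_wpM2l.
  by apply: ler_wpM2r => //; rewrite /K; lra.
have KcT i : rnorm R B i <= K * T.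
  by apply: le_trans (hb i) _; rewrite ler_wpM2r ?(ltW T0)// /K; lra.
have rhoT : rho <= r%:R * c * T.
  rewrite -mulrA mulr_natl -[X in _ *+ X](card_ord r) -sumr_const.
  by apply: ler_sum => i _; exact: hb.
pose s1 := T + rho.
have s1le : s1 <= (1 + r%:R * c) * T by rewrite /s1; lra.
have s10 : 0 <= s1 by rewrite /s1; lra.
have s1m : s1 ^+ m <= K2 * T ^+ m.
  by rewrite -exprMn; apply: lerXn2r; rewrite ?nnegrE// (le_trans s10).
have VE y : 0 <= y -> (y ^+ r * V) ^+ n = V ^+ n * y ^+ m.
  by move=> y0; rewrite exprMn -exprM mulrC.
have Vn0 : 0 <= V ^+ n by rewrite exprn_ge0.
have WE : W = T ^+ m / p ^+ n by rewrite /W exprMn -exprM exprVn.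
have Nn_up : N ^+ n <= V ^+ n * s1 ^+ m.
  rewrite -VE//; apply: lerXn2r; rewrite ?nnegrE ?mulr_ge0// exprn_ge0//.
have NnW : N ^+ n <= K1 * K2 * W.
  apply: le_trans Nn_up _; rewrite WE.
  apply: (@le_trans _ _ (K1 * p ^- n * (K2 * T ^+ m))).
    by apply: ler_pM => //; rewrite exprn_ge0.
  by rewrite le_eqVlt; apply/orP; left; apply/eqP; ring.
have VT : (V * T ^+ r) ^+ n = V ^+ n * T ^+ m by rewrite exprMn -exprM.
have rT0 : 0 <= rho / T by rewrite divr_ge0// ltW.
have rhopT : rho / T <= r%:R * (p / T).
  by rewrite mulrA ler_wpM2r// invr_ge0 ltW.
have K2_1 : 1 <= K2 by rewrite exprn_ege1// lerDl mulr_ge0// ltW.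
rewrite VT in VTW *.
set X := V ^+ n * T ^+ m in VTW *.
have X0 : 0 <= X by rewrite /X mulr_ge0// exprn_ge0// ltW.
have mZ : m%:R * (rho / T) * X <= m%:R * r%:R * K1 * (W * (p / T)).
  apply: (@le_trans _ _ (m%:R * (r%:R * (p / T)) * (K1 * W))).
    apply: ler_pM => //; first by rewrite mulr_ge0.
    by apply: ler_wpM2l.
  by rewrite le_eqVlt; apply/orP; left; apply/eqP; ring.
have main_up : N ^+ n - X <= K4 * (W * (p / T)).
  have h := @expr_sub_le R m s1 T (ltW T0) (_ : T <= s1).
  have h1 : (s1 ^+ m - T ^+ m) <= m%:R * (rho / T) * (K2 * T ^+ m).
    have sp : 0 < s1 by rewrite /s1; lra.
    rewrite -(ler_pM2r sp); apply: le_trans (h _) _; first by rewrite /s1; lra.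
    have -> : s1 - T = rho by rewrite /s1 addrC addKr.
    apply: (@le_trans _ _ (m%:R * rho * (K2 * T ^+ m))).
      by apply: ler_wpM2l => //; rewrite mulr_ge0.
    rewrite (_ : _ * s1 = m%:R * (rho / T * s1) * (K2 * T ^+ m)); last by ring.
    apply: ler_wpM2r; first by rewrite mulr_ge0// exprn_ge0// ltW.
    apply: ler_wpM2l => //; rewrite mulrAC -mulrA ler_peMr// ler_pdivlMr// mul1r.
    by rewrite /s1; lra.
  apply: (@le_trans _ _ (V ^+ n * (s1 ^+ m - T ^+ m))).
    by rewrite mulrBr lerD2r.
  apply: (@le_trans _ _ (K2 * (m%:R * (rho / T) * X))).
    apply: le_trans (ler_wpM2l Vn0 h1) _.
    by rewrite le_eqVlt; apply/orP; left; apply/eqP; rewrite /X; ring.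
  apply: le_trans (ler_wpM2l K2p mZ) _.
  by rewrite le_eqVlt; apply/orP; left; apply/eqP; rewrite /K4; ring.
have main_low : X - N ^+ n <= (K4 + K1 * r%:R) * (W * (p / T)).
  have [Tr|Tr] := ltP 0 (T - rho).
    have Tr' : T - rho <= T by lra.
    have h := @expr_sub_le R m T (T - rho) (ltW Tr) Tr'.
    have h1 : (T ^+ m - (T - rho) ^+ m) <= m%:R * (rho / T) * T ^+ m.
      rewrite -(ler_pM2r T0); apply: le_trans h _.
      rewrite (_ : T - (T - rho) = rho); last by ring.
      rewrite le_eqVlt; apply/orP; left; apply/eqP; field; exact: lt0r_neq0.
    have NV : V ^+ n * (T - rho) ^+ m <= N ^+ n.
      rewrite -VE ?(ltW Tr)//; apply: lerXn2r; rewrite ?nnegrE//.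
        by rewrite mulr_ge0// exprn_ge0// ltW.
      exact: Nlow.
    apply: (@le_trans _ _ (V ^+ n * (T ^+ m - (T - rho) ^+ m))).
      by rewrite mulrBr lerD2l lerN2.
    apply: (@le_trans _ _ (m%:R * (rho / T) * X)).
      apply: le_trans (ler_wpM2l Vn0 h1) _.
      by rewrite le_eqVlt; apply/orP; left; apply/eqP; rewrite /X; ring.
    apply: le_trans mZ _; rewrite ler_wpM2r//.
    apply: (@le_trans _ _ K4); last by rewrite lerDl.
    rewrite /K4 (_ : K1 * K2 * _ * _ = (m%:R * r%:R * K1) * K2); last by ring.
    by rewrite ler_peMr// !mulr_ge0.
  apply: (@le_trans _ _ X); first by rewrite lerBlDr lerDl exprn_ge0.
  apply: (@le_trans _ _ (K1 * r%:R * (W * (p / T)))); last first.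
    by rewrite ler_wpM2r// lerDr.
  apply: le_trans VTW _.
  rewrite (_ : K1 * r%:R * _ = K1 * W * (r%:R * (p / T))); last by ring.
  rewrite ler_peMr ?mulr_ge0//; apply: le_trans rhopT.
  by rewrite ler_pdivlMr// mul1r; lra.
have sing : (\prod_i ((Y i).*2.+1)%:R ^+ n) * \sum_i (((Y i).*2.+1)%:R)^-1 <=
    K3 * r%:R * (W * (p / T)).
  have x1 i : 1 <= x i by rewrite /x ler_pdivlMr// mul1r.
  have Mup i : ((Y i).*2.+1)%:R <= 3 * x i.
    have : (Y i)%:R <= x i by rewrite /Y truncn_le.
    rewrite -natr1 -muln2 natrM; have := x1 i; lra.
  have Mlow i : x i <= ((Y i).*2.+1)%:R.
    apply: le_trans (ltW (truncnS_gt (x i))) _; by rewrite ler_nat ltnS -addnn leq_addr.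
  rewrite mulrA (_ : K3 * r%:R * W * (p / T) = (K3 * W) * (r%:R * (p / T))); last by ring.
  apply: ler_pM.
  - by apply: prodr_ge0 => i _; rewrite exprn_ge0.
  - by apply: sumr_ge0 => i _; rewrite invr_ge0.
  - apply: (@le_trans _ _ (\prod_i (3 * x i) ^+ n)).
      apply: ler_prod => i _; rewrite exprn_ge0//=.
      apply: lerXn2r; [by rewrite nnegrE| |exact: Mup].
      by rewrite nnegrE; apply: mulr_ge0.
    have xprod : \prod_i (3 * x i) = (3 * c) ^+ r * (T ^+ r / p).
      rewrite (eq_bigr (fun i => 3 * c * T * (rnorm R B i)^-1)); last first.
        by move=> i _; rewrite /x !mulrA.
      by rewrite big_split/= prodfV prodr_const card_ord exprMn mulrA.
    by rewrite prodrXl xprod /K3 /m exprM -exprMn.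
  apply: le_trans rhopT; rewrite /rho mulr_suml; apply: ler_sum => i _.
  apply: (@le_trans _ _ (x i)^-1); first by rewrite lef_pV2 ?posrE// (lt_le_trans ltr01).
  rewrite /x invf_div ler_wpM2l ?(ltW (b0 i))// lef_pV2 ?posrE ?mulr_gt0//.
  by rewrite ler_peMl// ltW.
split => //.
- rewrite a0 /=; apply: le_trans aN _; apply: le_trans NnW _.
  by apply: ler_wpM2r => //; rewrite /K; lra.
- by right.
have Kexp : K * W * (p / T) = K * (W * (p / T)) by rewrite -mulrA.
rewrite -/W Kexp; set Z := W * (p / T) in Wpt0 main_up main_low sing *.
have KZ : (K4 + K1 * r%:R + K3 * r%:R) * Z <= K * Z.
  by apply: ler_wpM2r => //; rewrite /K; lra.
have K3Z : 0 <= K3 * r%:R * Z by rewrite mulr_ge0.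
have K1Z : 0 <= K1 * r%:R * Z by rewrite mulr_ge0.
rewrite ler_norml; move: KZ main_low; rewrite !mulrDl => KZ main_low.
by apply/andP; split; lra.
Qed.

(** * Convergence of sums over lattices *)

(** Write [m = q * r + t] with [t < r]; then [m + 1 <= r * (q + 1) <= r * 2 ^ q]. *)
Lemma expn_log_bound (r m : nat) : (0 < r)%N -> ((m.+1) ^ r <= r ^ r * 2 ^ m)%N.
Proof.
move=> r0; have mE := divn_eq m r; set q := (m %/ r)%N in mE.
have : (m.+1 <= r * 2 ^ q)%N.
  have h1 : (m < q.+1 * r)%N by rewrite -ltn_divLR.
  have h2 : (q.+1 <= 2 ^ q)%N by exact: ltn_expl.
  by apply: leq_trans h1 _; rewrite mulnC leq_mul2l h2 orbT.
rewrite -(leq_exp2r _ _ r0) => /leq_trans; apply.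
rewrite expnMn -expnM leq_mul2l; apply/orP; right.
by rewrite leq_exp2l// [leqRHS]mE leq_addr.
Qed.

Definition dyadic (n k : nat) : set 'rV[int]_n :=
  [set b | (2 ^ k <= supn b < 2 ^ k.+1)%N].
Arguments dyadic n k : clear implicits.

(** On the [k]-th shell every term is at most [2 ^- (k * s)], and the shell lies in
    a box of at most [2 ^ ((k + 2) * n)] points. *)
Lemma dyadic_sum (R : realType) (n s : nat) (K : set nat) : (n <= s)%N ->
  (\esum_(b in \bigcup_(k in K) dyadic n k) (((supn b)%:R : R) ^- s)%:E <=
   \esum_(k in K) ((4 ^+ n / 2 ^+ (k * (s - n)) : R))%:E)%E.
Proof.
move=> ns; rewrite esum_bigcupT; first last.
- by move=> b; rewrite lee_fin invr_ge0 exprn_ge0.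
- move=> i j _ _ [b [/= /andP[h1 h2] /andP[h3 h4]]].
  have : (i < j.+1)%N by rewrite -(ltn_exp2l _ _ (isT : 1 < 2)%N) (leq_ltn_trans h1).
  have : (j < i.+1)%N by rewrite -(ltn_exp2l _ _ (isT : 1 < 2)%N) (leq_ltn_trans h3).
  by move=> a1 a2; apply/eqP; rewrite eqn_leq -(ltnS i) -(ltnS j) a1 a2.
apply: le_esum => k _.
apply: (@le_trans _ _ (\esum_(b in dyadic n k) ((2 ^+ (k * s))^-1%:E * 1))%E).
  apply: le_esum => b /= /andP[h1 _]; rewrite mule1 lee_fin exprM.
  have h0 : 0 < (2 : R) ^+ k by rewrite exprn_gt0.
  rewrite lef_pV2 ?posrE ?exprn_gt0//; last first.
    by rewrite ltr0n (leq_trans _ h1)// expn_gt0.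
  apply: lerXn2r; rewrite ?nnegrE; [exact: ltW|exact: ler0n|].
  by rewrite -natrX ler_nat.
have cpos : (0 <= ((2 ^+ (k * s))^-1 : R)%:E)%E by rewrite lee_fin invr_ge0 exprn_ge0.
rewrite esumZl//.
apply: (@le_trans _ _ ((2 ^+ (k * s))^-1%:E * ((2 ^+ (k + 2)) ^+ n)%:E)%E).
  apply: lee_wpmul2l; first by rewrite lee_fin invr_ge0 exprn_ge0.
  apply: (@le_trans _ _ (cnt R [set x : 'rV[int]_n |
     forall j, (`|x ord0 j| <= (2 ^ k.+1).-1)%N])).
    apply: cnt_subset => b /= /andP[_ h2] j; apply: leq_trans (supnP b j) _.
    by rewrite -ltnS prednK// expn_gt0.
  rewrite cnt_box lee_fin; apply: lerXn2r; rewrite ?nnegrE// ?exprn_ge0//.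
  have e : (2 ^ (k + 2) = (2 ^ k.+1).*2)%N by rewrite addn2 expnS mul2n.
  rewrite -natrX ler_nat e; have := expn_gt0 2 k.+1.
  by case: (2 ^ k.+1)%N => // a _; rewrite doubleS.
rewrite -EFinM lee_fin.
have -> : (k * s = k * n + k * (s - n))%N by rewrite -mulnDr subnKC.
rewrite !exprD exprMn -exprM mulnC (_ : 4 = 2 ^+ 2 :> R); last by rewrite -natrX.
rewrite le_eqVlt; apply/orP; left; apply/eqP.
have h0 j : (2 : R) ^+ j != 0 by rewrite expf_neq0.
by field; rewrite !h0.
Qed.

Lemma geo_esum (R : realType) (c : R) (t : nat) : 0 <= c -> (0 < t)%N ->
  (\esum_(k in [set: nat]) (c / 2 ^+ (k * t))%:E <= (c * 2)%:E)%E.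
Proof.
move=> c0 t0; rewrite -nneseries_esumT; last first.
  by move=> k; rewrite lee_fin divr_ge0// exprn_ge0.
apply: lime_le.
  by apply: is_cvg_nneseries => k _ _; rewrite lee_fin divr_ge0// exprn_ge0.
apply: nearW => N; rewrite big_mkord sumEFin lee_fin.
apply: (@le_trans _ _ (\sum_(k < N) (c / 2 ^+ k))).
  apply: ler_sum => k _; apply: ler_wpM2l => //.
  rewrite lef_pV2 ?posrE ?exprn_gt0//; apply: ler_weXn2l; first by rewrite ler1n.
  by rewrite leq_pmulr.
rewrite -mulr_sumr; apply: ler_wpM2l => //.
suff -> : \sum_(k < N) ((2 : R) ^+ k)^-1 = 2 - 2 / 2 ^+ N.
  by rewrite lerBlDr lerDl divr_ge0// exprn_ge0.
elim: N => [|N IH]; first by rewrite big_ord0 expr0 divr1 subrr.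
rewrite big_ord_recr/= IH exprS.
have h0 : (2 : R) ^+ N != 0 by rewrite expf_neq0.
by field; rewrite h0.
Qed.

Lemma nonzero_dyadic (n : nat) :
  [set b : 'rV[int]_n | (0 < supn b)%N] = \bigcup_(k in [set: nat]) dyadic n k.
Proof.
apply/seteqP; split=> [b /= b0|b [k _ /= /andP[h _]]].
  exists (trunc_log 2 (supn b)) => //=.
  by apply/andP; split; [exact: trunc_logP|exact: trunc_log_ltn].
by apply: leq_trans h; rewrite expn_gt0.
Qed.

Lemma sup_sum_fin (R : realType) (n s : nat) : (n < s)%N ->
  (\esum_(b in [set b : 'rV[int]_n | (0 < supn b)%N]) (((supn b)%:R : R) ^- s)%:E
   < +oo)%E.
Proof.
move=> ns; rewrite nonzero_dyadic.
apply: le_lt_trans (dyadic_sum R _ (ltnW ns)) _.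
have t0 : (0 < s - n)%N by rewrite subn_gt0.
have c0 : 0 <= (4 : R) ^+ n by rewrite exprn_ge0.
by apply: le_lt_trans (geo_esum c0 t0) _; rewrite ltry.
Qed.

Lemma sup_sum_cut (R : realType) (n m : nat) :
  (\esum_(b in [set b : 'rV[int]_n | (0 < supn b < 2 ^ m)%N])
     (((supn b)%:R : R) ^- n)%:E <= (4 ^+ n * m%:R)%:E)%E.
Proof.
apply: (@le_trans _ _ (\esum_(b in \bigcup_(k in `I_m) dyadic n k)
    (((supn b)%:R : R) ^- n)%:E)).
  apply: esum_subset => b /= /andP[b0 bm].
  exists (trunc_log 2 (supn b)) => /=.
    by rewrite -(ltn_exp2l _ _ (isT : 1 < 2)%N) (leq_ltn_trans _ bm)// trunc_logP.
  by apply/andP; split; [exact: trunc_logP|exact: trunc_log_ltn].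
apply: le_trans (dyadic_sum R _ (leqnn n)) _.
rewrite esum_fset; [|exact: finite_II|by move=> k _; rewrite lee_fin divr_ge0// exprn_ge0].
rewrite -fsbig_ord sumEFin lee_fin.
rewrite (eq_bigr (fun=> 4 ^+ n)); last by move=> k _; rewrite subnn muln0 expr0 divr1.
by rewrite sumr_const card_ord mulr_natr.
Qed.

Lemma esum_rows_set (R : realType) (m n : nat) (D : set 'rV[int]_n)
    (f : 'rV[int]_n -> R) : (forall x, 0 <= f x) ->
  (\esum_(X in [set X : 'M[int]_(m, n) | forall i, D (row i X)])
     (\prod_i f (row i X))%:E = \prod_(i < m) \esum_(x in D) (f x)%:E)%E.
Proof.
move=> f0.
transitivity (\prod_(i < m) \esum_(x in [set: 'rV[int]_n])
    ((if x \in D then f x else 0)%:E))%E; last first.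
  apply: eq_bigr => i _; rewrite [RHS]esum_mkcond; apply: eq_esum => x _.
  by case: ifP.
rewrite -(esum_rows (f := fun i x => if x \in D then f x else 0)); last first.
  by move=> i x; case: ifP.
rewrite esum_mkcond; apply: eq_esum => X _.
have [h|h] := pselect (forall i, D (row i X)).
  rewrite mem_set//; congr EFin; apply: eq_bigr => i _; rewrite mem_set//; exact: h.
rewrite memNset//; have /existsNP[i hi] := h.
by rewrite (bigD1 i)//= memNset// mul0r.
Qed.

Lemma lattice_sum_le (R : realType) (r n s : nat) (Q : set (set 'rV[int]_n))
    (red : set 'rV[int]_n -> 'M[int]_(r, n)) (D : set 'rV[int]_n) :
  (forall L, Q L -> Zbasis L (red L)) -> (forall L i, Q L -> D (row i (red L))) ->
  (\esum_(L in Q) ((\prod_i rnorm R (red L) i) ^- s)%:E <=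
   \prod_(i < r) \esum_(b in D) (((supn b)%:R : R) ^- s)%:E)%E.
Proof.
move=> hQ hD; rewrite -esum_rows_set; last by move=> x; rewrite invr_ge0 exprn_ge0.
rewrite (eq_esum (b := fun L => (\prod_i ((supn (row i (red L)))%:R : R) ^- s)%:E)).
  apply: (@esum_inj_le _ _ _ _ _ red
     (fun X : 'M[int]_(r, n) => (\prod_i ((supn (row i X))%:R : R) ^- s)%:E)).
    move=> L L' hL hL' e; have [_ ->] := hQ _ hL; have [_ ->] := hQ _ hL'.
    by rewrite e.
  by move=> L hL i; exact: hD.
by move=> L _; rewrite prodfV prodrXl.
Qed.

Lemma prode_const_fin (R : realType) (r : nat) (x : \bar R) (c : R) :
  (0 <= x)%E -> (x <= c%:E)%E -> (\prod_(i < r) x <= (c ^+ r)%:E)%E.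
Proof.
move=> x0 xc; elim: r => [|r IH]; first by rewrite big_ord0 expr0.
rewrite big_ord_recl exprS EFinM; apply: lee_pmul => //.
by apply: prode_ge0.
Qed.

Lemma lattice_sum_fin (R : realType) (r n s : nat)
    (red : set 'rV[int]_n -> 'M[int]_(r, n)) : (n < s)%N ->
  (forall L, primitive r L -> Zbasis L (red L)) ->
  (\esum_(L in @primitive n r) ((\prod_i rnorm R (red L) i) ^- s)%:E < +oo)%E.
Proof.
move=> ns hred; set S := (\esum_(b in [set b : 'rV[int]_n | (0 < supn b)%N])
    (((supn b)%:R : R) ^- s)%:E)%E.
have S0 : (0 <= S)%E by apply: esum_ge0 => b _; rewrite lee_fin invr_ge0 exprn_ge0.
have Sf : S \is a fin_num by rewrite ge0_fin_numE//; exact: sup_sum_fin.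
apply: le_lt_trans (@lattice_sum_le R r n s _ red
   [set b : 'rV[int]_n | (0 < supn b)%N] hred _) _.
  move=> L i /hred[iB _]; have := rnorm_ge1 R i iB.
  by rewrite /rnorm ler1n.
apply: (@le_lt_trans _ _ (fine S ^+ r)%:E); last exact: ltry.
by apply: prode_const_fin => //; rewrite fineK.
Qed.

(** The sum over one vector has a bounded contribution from each of the dyadic
    shells up to [X]; the [r]-th power of their number is absorbed by
    [expn_log_bound]. *)
Lemma lattice_sum_cut (R : realType) (r n : nat)
    (red : set 'rV[int]_n -> 'M[int]_(r, n)) : (0 < r)%N ->
  (forall L, primitive r L -> Zbasis L (red L)) ->
  exists2 K : R, 0 <= K & forall X : R, 1 <= X ->
  (\esum_(L in [set L | primitive r L /\ forall i, (rnorm R (red L) i <= X)%R])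
     ((\prod_i rnorm R (red L) i) ^- n)%:E <= (K * X)%:E)%E.
Proof.
move=> r0 hred; exists ((4 ^+ n) ^+ r * (2 * r ^ r)%:R).
  by rewrite mulr_ge0// exprn_ge0// exprn_ge0.
move=> X X1; have X0 : 0 <= X by exact: le_trans ler01 X1.
(* [m] is the exponent with 2 ^ (m - 1) <= X < 2 ^ m. *)
pose m := (trunc_log 2 (Num.truncn X)).+1.
have tX : (0 < Num.truncn X)%N by rewrite -nat_le_truncn.
pose D := [set b : 'rV[int]_n | (0 < supn b < 2 ^ m)%N].
apply: le_trans (@lattice_sum_le R r n n _ red D _ _) _.
- by move=> L [/hred].
- move=> L i [/hred[iB _] hX]; rewrite /D/=.
  have := rnorm_ge1 R i iB; rewrite /rnorm ler1n => ->/=.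
  apply: leq_ltn_trans (trunc_log_ltn _ (isT : 1 < 2)%N).
  by rewrite -nat_le_truncn//; exact: hX.
apply: le_trans (prode_const_fin r _ (sup_sum_cut R n m)) _.
  by apply: esum_ge0 => b _; rewrite lee_fin invr_ge0 exprn_ge0.
rewrite lee_fin exprMn -mulrA ler_wpM2l// ?exprn_ge0// ?exprn_ge0//.
apply: (@le_trans _ _ ((r ^ r * 2 ^ m)%:R)).
  rewrite -natrX ler_nat; apply: leq_trans (expn_log_bound m r0).
  by rewrite leq_exp2r.
apply: (@le_trans _ _ ((2 * r ^ r)%:R * (2 ^ (trunc_log 2 (Num.truncn X)))%:R)).
  by rewrite -natrM ler_nat /m expnS mulnCA mulnA.
apply: ler_wpM2l => //; rewrite nat_le_truncn//.
exact: trunc_logP.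
Qed.

(** * Pairs of matrices attached to one lattice *)

Definition main_term (R : realType) (n : nat) (L : set 'rV[int]_n) : R :=
  nu R L ^+ n * nu R (orthlattice L) ^+ n / latdet R L ^+ (2 * n).

Lemma reduced_choice (r n : nat) : exists2 C : nat, (0 < C)%N &
  exists red : set 'rV[int]_n -> 'M[int]_(r, n),
    forall L, primitive r L -> Zbasis L (red L) /\ reduced C (red L).
Proof.
have [C C0 HC] := reduced_basis r; exists C => //.
have /choice[red redE] : forall L : set 'rV[int]_n, exists B : 'M[int]_(r, n),
    primitive r L -> Zbasis L B /\ reduced C B.
  move=> L; have [pL|npL] := pselect (primitive r L); last by exists 0.
  have [B zB hB] := HC n L pL; exists B => _.
  by split=> //; split=> //; case: zB.
by exists red.
Qed.

Lemma orth_primitive (n r : nat) (L : set 'rV[int]_n) : primitive r L ->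
  primitive (n - r) (orthlattice L).
Proof.
move=> pL; have rn := primitive_le pL.
have [s ns] : exists s, n = (r + s)%N by exists (n - r)%N; rewrite subnKC.
by subst n; have [_ [+ _]] := orth_frame pL; rewrite addKn.
Qed.

(** A primitive lattice and its orthogonal lattice have the same determinant. *)
Lemma orth_gram_det (n r s : nat) (L : set 'rV[int]_n) (B : 'M[int]_(r, n))
    (B' : 'M[int]_(s, n)) : primitive r L -> Zbasis L B ->
  Zbasis (orthlattice L) B' -> \det (B *m B^T) = \det (B' *m B'^T).
Proof.
move=> pL zB zB'; have rn := primitive_le pL.
have [s' ns] : exists s, n = (r + s)%N by exists (n - r)%N; rewrite subnKC.
subst n; have [[U uU [zU zW]] _] := orth_frame pL.
have [e _] := Zbasis_rank zW zB'; subst s'.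
by rewrite (Zbasis_gram_det zB zU) (dual_gram_det uU) (Zbasis_gram_det zW zB').
Qed.

Lemma main_termE (R : realType) (n r s : nat) (L : set 'rV[int]_n)
    (B : 'M[int]_(r, n)) (B' : 'M[int]_(s, n)) : primitive r L -> Zbasis L B ->
  Zbasis (orthlattice L) B' ->
  main_term R L = bodyvol R B ^+ n * bodyvol R B' ^+ n.
Proof.
move=> pL zB zB'.
have [d0 d2 nuL] := nu_latdet R zB; have [d0' d2' nuL'] := nu_latdet R zB'.
have dd : latdet R (orthlattice L) = latdet R L.
  by apply/eqP; rewrite -(@eqrXn2 _ 2)// d2 d2' (orth_gram_det pL zB zB').
have dn0 : latdet R L != 0.
  apply/eqP => h; have := gram_unit R zB.
  rewrite map_trmx -map_mxM unitmxE det_map_mx unitfE intr_eq0.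
  by move: d2; rewrite h expr0n /= => /esym/eqP; rewrite intr_eq0 => ->.
rewrite /main_term nuL nuL' dd !exprMn mulnC exprM.
rewrite mulrACA -expr2 mulrAC mulfV ?mul1r//.
by rewrite expf_neq0// expf_neq0.
Qed.

(** Both products are, up to bounded factors, the square root of the common Gram
    determinant. *)
Lemma prod_comparable (R : realType) (n r s C C' : nat) : exists2 K : R, 1 <= K &
  forall (L : set 'rV[int]_n) (B : 'M[int]_(r, n)) (B' : 'M[int]_(s, n)),
  primitive r L -> Zbasis L B -> Zbasis (orthlattice L) B' ->
  reduced C B -> reduced C' B' ->
  let p := \prod_i rnorm R B i in let q := \prod_i rnorm R B' i in
  p <= K * q /\ q <= K * p.
Proof.
pose K1 : R := C%:R * (s`!%:R * n%:R ^+ s); pose K2 : R := C'%:R * (r`!%:R * n%:R ^+ r).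
have K10 : 0 <= K1 by rewrite !mulr_ge0// exprn_ge0.
have K20 : 0 <= K2 by rewrite !mulr_ge0// exprn_ge0.
exists (1 + K1 + K2); first by lra.
move=> L B B' pL zB zB' rB rB' p q.
have p0 : 0 <= p by apply: prodr_ge0 => i _; rewrite ler0n.
have q0 : 0 <= q by apply: prodr_ge0 => i _; rewrite ler0n.
have dd : \det (gramR R B) = \det (gramR R B').
  by rewrite !gramR_det (orth_gram_det pL zB zB').
have h1 : p ^+ 2 <= K1 * q ^+ 2.
  apply: le_trans (reduced_prod R rB) _; rewrite dd /K1 -mulrA.
  by apply: ler_wpM2l => //; exact: gramR_det_le.
have h2 : q ^+ 2 <= K2 * p ^+ 2.
  apply: le_trans (reduced_prod R rB') _; rewrite -dd /K2 -mulrA.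
  by apply: ler_wpM2l => //; exact: gramR_det_le.
set K := 1 + K1 + K2; have K0 : 0 <= K by rewrite /K; lra.
have KK a : 0 <= a -> a <= K1 + K2 -> a <= K ^+ 2.
  move=> a0 aK; apply: (@le_trans _ _ K); first by rewrite /K; lra.
  by rewrite expr2 ler_peMr// /K; lra.
split; rewrite -(@ler_pXn2r _ 2)// ?nnegrE ?mulr_ge0// exprMn.
  apply: le_trans h1 _; apply: ler_wpM2r; first exact: sqr_ge0.
  by apply: KK => //; lra.
apply: le_trans h2 _; apply: ler_wpM2r; first exact: sqr_ge0.
by apply: KK => //; lra.
Qed.

Lemma maxnorm_tr (n : nat) (A : 'M[int]_n) : maxnorm A^T = maxnorm A.
Proof.
apply/eqP; rewrite eqn_leq; apply/andP; split; apply/maxnorm_le => i j.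
  by rewrite mxE; apply: (maxnorm_le A (maxnorm A)).1.
by have := (maxnorm_le A^T (maxnorm A^T)).1 (leqnn _) j i; rewrite mxE.
Qed.

Lemma cnt_prod (R : realType) (T1 T2 : choiceType) (S1 : set T1) (S2 : set T2) :
  cnt R [set x : T1 * T2 | S1 x.1 /\ S2 x.2] = (cnt R S1 * cnt R S2)%E.
Proof.
rewrite muleC /cnt -(@esum_pair _ _ _ S1 (fun _ => S2) (fun _ _ => 1%E))//.
rewrite -esumZl//; last exact: esum_ge0.
by apply: eq_esum => x _; rewrite mule1.
Qed.

Definition pairset (R : realType) (n : nat) (T : R) (L : set 'rV[int]_n) :
    set ('M[int]_n * 'M[int]_n) :=
  [set AB | satset T L AB.1 /\ satset T (orthlattice L) AB.2^T].

Lemma cnt_pairset (R : realType) (n : nat) (T : R) (L : set 'rV[int]_n) :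
  cnt R (pairset T L) = (cnt R (satset T L) * cnt R (satset T (orthlattice L)))%E.
Proof.
rewrite -(cnt_tr R (satset T (orthlattice L))) -cnt_prod.
by congr (cnt R _).
Qed.

Lemma pair_error (R : realFieldType) (a a' X X' A A' d d' : R) :
  0 <= a' <= A' -> 0 <= X <= A -> `|a - X| <= A * d -> `|a' - X'| <= A' * d' ->
  0 <= d' -> `|a * a' - X * X'| <= A * A' * (d + d').
Proof.
move=> /andP[a0 aA] /andP[X0 XA] h h' d'0.
have -> : a * a' - X * X' = (a - X) * a' + X * (a' - X') by ring.
apply: le_trans (ler_normD _ _) _; rewrite [leRHS]mulrDr !normrM; apply: lerD.
  by rewrite (ger0_norm a0) mulrAC; apply: ler_pM.
by rewrite (ger0_norm X0) -mulrA; apply: ler_pM.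
Qed.

(** The error is the sum of the relative errors [p / T] and [q / T] of the two
    factors, times the size [T ^+ (n ^ 2) * p ^- n * q ^- n] of the product; [q]
    is then replaced by the comparable [p]. *)
Lemma pairset_asymp (R : realType) (n r : nat) : (0 < r < n)%N ->
  exists2 red : set 'rV[int]_n -> 'M[int]_(r, n),
    (forall L, primitive r L -> Zbasis L (red L)) &
  exists2 K : R, 0 <= K & forall L, primitive r L ->
    let p := \prod_i rnorm R (red L) i in
    0 <= main_term R L <= K * p ^- (2 * n - 1) /\
    forall T : R, 1 <= T -> exists2 g : R, cnt R (pairset T L) = g%:E &
      `|g - main_term R L * T ^+ (n ^ 2)| <= K * T ^+ (n ^ 2 - 1) * p ^- (2 * n - 1).
Proof.
move=> /andP[r0 rn].
have n0 : (0 < n)%N by exact: leq_trans rn.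
pose s := (n - r)%N.
have s0 : (0 < s)%N by rewrite subn_gt0.
have sn : (s <= n)%N by exact: leq_subr.
have [C C0 [red redP]] := reduced_choice r n.
have [C' C'0 [red' red'P]] := reduced_choice s n.
exists red; first by move=> L /redP[].
have [K1 K10 H1] := @satset_asymp R C r n C0 n0 (ltnW rn) r0.
have [K2 K20 H2] := @satset_asymp R C' s n C'0 n0 sn s0.
have [K3 K31 H3] := @prod_comparable R n r s C C'.
have K30 : 0 <= K3 by lra.
exists (K1 * K2 * K3 ^+ n * (1 + K3)).
  by rewrite !mulr_ge0// ?exprn_ge0//; lra.
move=> L pL p.
have pL' : primitive s (orthlattice L) := orth_primitive pL.
have [zB rB] := redP _ pL; have [zB' rB'] := red'P _ pL'.
set B := red L in p zB rB *; set B' := red' (orthlattice L) in zB' rB'.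
pose q := \prod_i rnorm R B' i.
have [pq qp] := H3 L B B' pL zB zB' rB rB'; rewrite -/p -/q in pq qp.
have p1 : 1 <= p by apply: prod_ge1 => i _; apply: rnorm_ge1; case: zB.
have q1 : 1 <= q by apply: prod_ge1 => i _; apply: rnorm_ge1; case: zB'.
have p0 : 0 < p by lra.
have q0 : 0 < q by lra.
have mE := main_termE R pL zB zB'.
have qn : q ^- n <= K3 ^+ n * p ^- n.
  have h : q^-1 <= K3 / p by rewrite ler_pdivlMr// mulrC ler_pdivrMr.
  rewrite -!exprVn -exprMn; apply: lerXn2r; rewrite ?nnegrE//.
    by rewrite invr_ge0 ltW.
  by rewrite divr_ge0// ltW.
have pn0 : 0 <= p ^- n by rewrite invr_ge0 exprn_ge0// ltW.
have qn0 : 0 <= q ^- n by rewrite invr_ge0 exprn_ge0// ltW.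
have K3n : 0 <= K3 ^+ n by rewrite exprn_ge0.
have pnn : p ^- n * p ^- n * p = p ^- (2 * n - 1).
  rewrite -invfM -exprD addnn -mul2n -{1}[(2 * n)%N](@subnK 1); last by rewrite muln_gt0.
  by rewrite exprD expr1 invfM -mulrA mulVf ?mulr1// gt_eqF.
have pqn : p ^- n * q ^- n * (p + q) <= K3 ^+ n * (1 + K3) * p ^- (2 * n - 1).
  apply: (@le_trans _ _ (p ^- n * (K3 ^+ n * p ^- n) * ((1 + K3) * p))).
    apply: ler_pM; rewrite ?mulr_ge0//; first by lra.
      by apply: ler_wpM2l.
    by rewrite mulrDl mul1r lerD2l.
  by rewrite -pnn le_eqVlt; apply/orP; left; apply/eqP; ring.
split.
  have [_ [_ _ _ /andP[V0 Vn] _]] := H1 L B pL zB rB 1 (lexx _).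
  have [_ [_ _ _ /andP[V0' Vn'] _]] := H2 _ B' pL' zB' rB' 1 (lexx _).
  rewrite mE mulr_ge0//=.
  apply: (@le_trans _ _ (K1 * p ^- n * (K2 * q ^- n))); first exact: ler_pM.
  rewrite (_ : K1 * _ * _ = K1 * K2 * (p ^- n * q ^- n)); last by ring.
  rewrite -!(mulrA (K1 * K2)); apply: ler_wpM2l; first exact: mulr_ge0.
  apply: le_trans pqn.
  by rewrite ler_peMr ?mulr_ge0//; lra.
move=> T T1; have T0 : 0 < T by lra.
have [a [ca /andP[a0 aW] _ /andP[V0 Vn] ha]] := H1 L B pL zB rB T T1.
have [a' [ca' /andP[a'0 a'W] _ /andP[V0' Vn'] ha']] := H2 _ B' pL' zB' rB' T T1.
exists (a * a'); first by rewrite cnt_pairset ca ca' EFinM.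
rewrite -/p in aW Vn ha; rewrite -/q in a'W Vn' ha'.
have Tn k : 0 <= T ^+ k by rewrite exprn_ge0// ltW.
have X0 : 0 <= (bodyvol R B * T ^+ r) ^+ n <= K1 * (T ^+ r / p) ^+ n.
  have Trn : 0 <= (T ^+ r) ^+ n by rewrite exprn_ge0.
  rewrite exprMn; apply/andP; split; first exact: mulr_ge0.
  apply: le_trans (ler_wpM2r Trn Vn) _.
  by rewrite exprMn exprVn le_eqVlt; apply/orP; left; apply/eqP; ring.
have qT : 0 <= q / T by rewrite divr_ge0 ?ltW.
have a'A : 0 <= a' <= K2 * (T ^+ s / q) ^+ n by rewrite a'0 a'W.
have := pair_error a'A X0 ha ha' qT.
have nn : (n ^ 2 = r * n + s * n)%N by rewrite -mulnDl /s subnKC ?(ltnW rn)// mulnn.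
have -> : (bodyvol R B * T ^+ r) ^+ n * (bodyvol R B' * T ^+ s) ^+ n =
    main_term R L * T ^+ (n ^ 2).
  by rewrite mE !exprMn -!exprM nn exprD mulrACA.
move=> /le_trans; apply.
have Tn1 : T ^+ (r * n) * T ^+ (s * n) / T = T ^+ (n ^ 2 - 1).
  rewrite -exprD -nn -{1}[(n ^ 2)%N](@subnK 1); last by rewrite expn_gt0 n0.
  by rewrite exprD expr1 mulfK// gt_eqF.
apply: (@le_trans _ _ (K1 * K2 * T ^+ (n ^ 2 - 1) * (p ^- n * q ^- n * (p + q)))).
  rewrite -Tn1 !exprMn !exprVn -!exprM -mulrDl.
  by rewrite le_eqVlt; apply/orP; left; apply/eqP; ring.
have K12 : 0 <= K1 * K2 * T ^+ (n ^ 2 - 1) by rewrite !mulr_ge0.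
apply: le_trans (ler_wpM2l K12 pqn) _.
by rewrite le_eqVlt; apply/orP; left; apply/eqP; ring.
Qed.

(** * Summation over all lattices *)

Lemma cnt_fiber_sum (R : realType) (T U : choiceType) (S : set T) (f : T -> U)
    (Q : set U) : (forall x, S x -> Q (f x)) ->
  cnt R S = \esum_(u in Q) cnt R [set x | S x /\ f x = u].
Proof.
move=> SQ; rewrite /cnt (@esum_pair _ _ _ Q _ (fun _ _ => 1%E))//.
apply/esym; apply: (@reindex_esum _ _ _ S _ (fun x => (f x, x))); split.
- by move=> x Sx /=; split=> //; exact: SQ.
- by move=> x y _ _ [].
- by move=> [u x] /= [_ [Sx <-]]; exists x.
Qed.

Lemma cnt_bigU_le (R : realType) (T : choiceType) (I : eqType) (s : seq I)
    (S : set T) (F : I -> set T) :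
  (forall x, S x -> exists2 i, i \in s & F i x) ->
  (cnt R S <= \sum_(i <- s) cnt R (F i))%E.
Proof.
elim: s S => [|i s IH] S h.
  rewrite big_nil (_ : S = set0); first by rewrite /cnt esum_set0.
  by apply/seteqP; split=> // x /h[].
rewrite big_cons.
apply: le_trans (@cntU_le R T S (F i) [set x | exists2 j, j \in s & F j x] _) _.
  move=> x /h[j]; rewrite inE => /orP[/eqP ->|js] Fx; first by left.
  by right; exists j.
by apply: leeD => //; exact: IH.
Qed.

Definition rankQ (n : nat) (A : 'M[int]_n) : nat := \rank (map_mx intr A : 'M[rat]_n).

(** The condition on saturations says that [AB.1 *m AB.2 = 0] with ranks adding up
    to [n]. *)
Definition rank_pairs (R : realType) (n : nat) (T : R) (r : nat) :
    set ('M[int]_n * 'M[int]_n) :=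
  [set AB | [/\ (maxnorm AB.1)%:R <= T, (maxnorm AB.2)%:R <= T, rankQ AB.1 = r &
     sat AB.2^T = orthlattice (sat AB.1)]].

(** The main terms are themselves bounded by [p ^- (2 * n - 1)], so that the same
    convergent sum controls the constant and the error. *)
Lemma rank_pairs_asymp (R : realType) (n r : nat) : (1 < n)%N -> (0 < r < n)%N ->
  exists t e : R, [/\ \esum_(L in @primitive n r) (main_term R L)%:E = t%:E, 0 <= t,
    0 <= e & forall T : R, 1 <= T -> exists2 g : R,
      cnt R (@rank_pairs R n T r) = g%:E &
      `|g - t * T ^+ (n ^ 2)| <= e * T ^+ (n ^ 2 - 1)].
Proof.
move=> n1 rn.
have [red redZ [K K0 HK]] := pairset_asymp R rn.
pose w (L : set 'rV[int]_n) : R := (\prod_i rnorm R (red L) i) ^- (2 * n - 1).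
have w0 L : 0 <= w L.
  by rewrite invr_ge0 exprn_ge0// prodr_ge0// => i _; rewrite ler0n.
have ns : (n < 2 * n - 1)%N by lia.
have wfin := lattice_sum_fin R ns redZ.
set W := (\esum_(L in _) _)%E in wfin.
have W0 : (0 <= W)%E by apply: esum_ge0 => L _; rewrite lee_fin; exact: w0.
have Wf : W \is a fin_num by rewrite ge0_fin_numE.
have WE : W = (fine W)%:E by rewrite fineK.
have Wr0 : 0 <= fine W by exact: fine_ge0.
set t := \esum_(L in _) _.
have t0 : (0 <= t)%E.
  by apply: esum_ge0 => L /HK[/andP[]]; rewrite lee_fin.
have tf : t \is a fin_num.
  rewrite ge0_fin_numE//; apply: (@le_lt_trans _ _ (K%:E * W)%E).
    rewrite /W -esumZl; [|by rewrite lee_fin|by move=> L; rewrite lee_fin; exact: w0].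
    by apply: le_esum => L /HK[/andP[_ h] _]; rewrite -EFinM lee_fin.
  by rewrite WE -EFinM ltry.
have tE : t = (fine t)%:E by rewrite fineK.
have tr0 : 0 <= fine t by exact: fine_ge0.
exists (fine t), (K * fine W); split => //; first exact: mulr_ge0.
move=> T T1; have T0 : 0 <= T by exact: le_trans ler01 T1.
have Tn k : 0 <= T ^+ k by exact: exprn_ge0.
have cE : cnt R (@rank_pairs R n T r) =
    \esum_(L in @primitive n r) cnt R (pairset T L).
  rewrite (@cnt_fiber_sum R _ _ _ (fun AB : 'M[int]_n * 'M[int]_n => sat AB.1)
     (@primitive n r)).
    apply: eq_esum => L pL; congr (cnt R _); apply/seteqP; split=> -[A B] /=.
      move=> [[mA mB rA sB] sA]; split; split=> //=; first by rewrite maxnorm_tr.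
      by rewrite sB sA.
    move=> [[/= mA sA] [/= mB sB]]; rewrite maxnorm_tr in mB.
    split=> //; split=> //; last by rewrite sB sA.
    by apply: (@primitive_rank_unique n _ _ L) => //; rewrite -sA; exact: sat_primitive.
  by move=> [A B] [_ _ /= <- _]; exact: sat_primitive.
have mt0 (L : set 'rV[int]_n) : primitive r L -> 0 <= main_term R L.
  by move=> pL; have [/andP[]] := HK L pL.
have sumT (c : R) (f : set 'rV[int]_n -> R) : 0 <= c ->
    (forall L : set 'rV[int]_n, primitive r L -> 0 <= f L) ->
    \esum_(L in @primitive n r) ((c * f L)%:E) =
    (c%:E * \esum_(L in @primitive n r) (f L)%:E)%E.
  move=> c0 f0; pose f' (L : set 'rV[int]_n) := if `[< primitive r L >] then f L else 0.
  have f'0 L : (0 <= (f' L)%:E)%E.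
    by rewrite lee_fin /f'; case: asboolP => // /f0.
  have e (L : set 'rV[int]_n) : primitive r L -> f L = f' L by move=> pL; rewrite /f' asboolT.
  rewrite (eq_esum (b := fun L => (c%:E * (f' L)%:E)%E)); last first.
    by move=> L pL; rewrite (e L pL) EFinM.
  rewrite esumZl ?lee_fin//; congr (_ * _)%E; apply: eq_esum => L pL.
  by rewrite (e L pL).
have eT : \esum_(L in @primitive n r) ((T ^+ (n ^ 2) * main_term R L)%:E) =
    (fine t * T ^+ (n ^ 2))%:E.
  by rewrite sumT// -/t tE -EFinM mulrC.
have eW : \esum_(L in @primitive n r) ((K * T ^+ (n ^ 2 - 1) * w L)%:E) =
    (K * fine W * T ^+ (n ^ 2 - 1))%:E.
  rewrite sumT//; last by rewrite mulr_ge0.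
  by rewrite -/W WE -EFinM mulrAC.
have mT0 (L : set 'rV[int]_n) : primitive r L -> (0 <= (T ^+ (n ^ 2) * main_term R L)%:E)%E.
  by move=> pL; rewrite lee_fin mulr_ge0// mt0.
have KW0 (L : set 'rV[int]_n) : primitive r L -> (0 <= (K * T ^+ (n ^ 2 - 1) * w L)%:E)%E.
  by move=> pL; rewrite lee_fin !mulr_ge0.
have up : (cnt R (@rank_pairs R n T r) <=
    (fine t * T ^+ (n ^ 2) + K * fine W * T ^+ (n ^ 2 - 1))%:E)%E.
  rewrite cE EFinD -eT -eW -esumD//; apply: le_esum => L pL.
  have [_ /(_ T T1)[g -> hg]] := HK L pL; rewrite -EFinD lee_fin.
  rewrite -lerBlDl (mulrC (T ^+ _)); apply: le_trans (ler_norm _) _.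
  exact: hg.
have low : ((fine t * T ^+ (n ^ 2))%:E <= cnt R (@rank_pairs R n T r) +
     (K * fine W * T ^+ (n ^ 2 - 1))%:E)%E.
  rewrite cE -eT -eW -esumD//; last by move=> L _; exact: cnt_ge0.
  apply: le_esum => L pL.
  have [_ /(_ T T1)[g -> hg]] := HK L pL; rewrite -EFinD lee_fin.
  rewrite -lerBlDl (mulrC (T ^+ _)); apply: le_trans (ler_norm _) _.
  by rewrite distrC; exact: hg.
have cf : cnt R (@rank_pairs R n T r) \is a fin_num.
  by rewrite ge0_fin_numE ?cnt_ge0//; apply: le_lt_trans up _; rewrite ltry.
exists (fine (cnt R (@rank_pairs R n T r))); first by rewrite fineK.
rewrite ler_norml lerBlDl; apply/andP; split; last by rewrite -lee_fin fineK.
by rewrite lerBrDr addrC lerBlDr -lee_fin EFinD fineK.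
Qed.

Definition rankset (R : realType) (n : nat) (T : R) (r : nat) : set 'M[int]_n :=
  [set A | (maxnorm A)%:R <= T /\ rankQ A = r].
Arguments rankset {R} n T r.

(** Sum the upper bounds of [satset_asymp] over the lattices with basis vectors
    of norm << T, the only ones that contribute. *)
Lemma rank_count (R : realType) (n r : nat) : (0 < r <= n)%N ->
  exists2 K : R, 0 <= K & forall T : R, 1 <= T ->
   (cnt R (rankset n T r) <=
    (K * T ^+ (r * n + 1))%:E)%E.
Proof.
move=> /andP[r0 rn]; have n0 : (0 < n)%N by exact: leq_trans rn.
have [C C0 [red redP]] := reduced_choice r n.
have redZ (L : set 'rV[int]_n) : primitive r L -> Zbasis L (red L) by move=> /redP[].
have [K K0 HK] := @satset_asymp R C r n C0 n0 rn r0.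
have [K' K'0 HK'] := lattice_sum_cut R r0 redZ.
exists (K * K' * (K + 1)); first by rewrite !mulr_ge0//; lra.
move=> T T1; have T0 : 0 <= T by exact: le_trans ler01 T1.
pose X := (K + 1) * T.
have X1 : 1 <= X by rewrite /X mulr_ege1//; lra.
pose cut := [set L : set 'rV[int]_n | primitive r L /\ forall i, rnorm R (red L) i <= X].
pose v L : R := (\prod_i rnorm R (red L) i) ^- n.
have v0 L : 0 <= v L.
  by rewrite invr_ge0 exprn_ge0// prodr_ge0// => i _; rewrite ler0n.
rewrite (@cnt_fiber_sum R _ _ _ (fun A : 'M[int]_n => sat A) (@primitive n r)); last first.
  by move=> A [_ /= <-]; exact: sat_primitive.
apply: (@le_trans _ _ (\esum_(L in cut) ((K * T ^+ (r * n))%:E * (v L)%:E)%E)).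
  rewrite [leLHS]esum_mkcond [leRHS]esum_mkcond; apply: le_esum => L _.
  have cut0 : (0 <= (if L \in cut then ((K * T ^+ (r * n))%:E * (v L)%:E) else 0))%E.
    by case: ifP => // _; rewrite -EFinM lee_fin !mulr_ge0// exprn_ge0.
  case: ifP => // /set_mem pL; have [zB rB] := redP _ pL.
  have [a [ca /andP[a0 aW] acase _ _]] := HK L _ pL zB rB T T1.
  apply: (@le_trans _ _ (cnt R (satset T L))).
    by apply: cnt_subset => A /= [[mA _] sA].
  rewrite ca; case: acase => [->//|hb].
  rewrite mem_set; last first.
    split=> // i; apply: le_trans (hb i) _; rewrite /X ler_wpM2r//; lra.
  rewrite -EFinM lee_fin; apply: le_trans aW _.
  by rewrite exprMn exprVn -exprM mulrA.
rewrite esumZl; [|by rewrite lee_fin mulr_ge0// exprn_ge0|by move=> L; rewrite lee_fin].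
apply: le_trans (lee_wpmul2l _ (HK' X X1)) _.
  by rewrite lee_fin mulr_ge0// exprn_ge0.
rewrite -EFinM lee_fin /X exprD expr1 le_eqVlt; apply/orP; left; apply/eqP; ring.
Qed.

Lemma cnt_maxnorm (R : realType) (n : nat) (T : R) : 0 <= T ->
  cnt R [set A : 'M[int]_n | (maxnorm A)%:R <= T] =
  (((Num.truncn T).*2.+1)%:R ^+ (n ^ 2))%:E.
Proof.
move=> T0; set t := Num.truncn T.
have -> : [set A : 'M[int]_n | (maxnorm A)%:R <= T] =
   [set A : 'M[int]_n | forall i, [set x : 'rV[int]_n |
      forall j, (`|x ord0 j| <= t)%N] (row i A)].
  apply/seteqP; split=> A /=; rewrite nat_le_truncn//.
    by move=> /maxnorm_le h i j; rewrite mxE.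
  by move=> h; apply/maxnorm_le => i j; have := h i j; rewrite mxE.
rewrite (cnt_rows R (fun i : 'I_n => [set x : 'rV[int]_n |
      forall j, (`|x ord0 j| <= t)%N])) cnt_box prodEFin.
by rewrite prodr_const card_ord -exprM mulnn.
Qed.

Lemma box_asymp (R : realType) (m : nat) (T : R) : 1 <= T -> (0 < m)%N ->
  `|((Num.truncn T).*2.+1)%:R ^+ m - (2 * T) ^+ m| <= (m%:R * 3 ^+ m) * T ^+ (m - 1).
Proof.
move=> T1 m0; have T0 : 0 < T by exact: lt_le_trans ltr01 T1.
set u : R := (Num.truncn T).*2.+1%:R.
have uE : u = 2 * (Num.truncn T)%:R + 1 by rewrite /u -natr1 -muln2 natrM mulrC.
have u1 : u <= 2 * T + 1.
  have : (Num.truncn T)%:R <= T by rewrite truncn_le ltW.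
  by rewrite uE; lra.
have u2 : 2 * T - 1 <= u.
  have : T < (Num.truncn T).+1%:R by exact: truncnS_gt.
  by rewrite -natr1 uE; lra.
have key s t : T <= s -> 0 <= t -> t <= s -> s - t <= 1 -> s <= 3 * T ->
    s ^+ m - t ^+ m <= m%:R * 3 ^+ m * T ^+ (m - 1).
  move=> Ts t0 ts st s3; have s0 : 0 < s by exact: lt_le_trans Ts.
  have := expr_sub_le m t0 ts.
  rewrite -ler_pdivlMr// => /le_trans; apply.
  rewrite ler_pdivrMr// -[in X in X <= _](@subnK 1 m)// exprD expr1 !mulrA.
  rewrite ler_wpM2r// ?(ltW s0)//; apply: (@le_trans _ _ (m%:R * 1 * (3 * T) ^+ (m - 1))).
    have T3 : 0 <= 3 * T by rewrite mulr_ge0// ltW.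
    apply: ler_pM.
    - by rewrite mulr_ge0// subr_ge0.
    - by rewrite exprn_ge0// ltW.
    - by rewrite subnK//; exact: ler_wpM2l.
    - by apply: lerXn2r => //; rewrite nnegrE ltW.
  rewrite mulr1 exprMn mulrA; apply: ler_wpM2r; first by rewrite exprn_ge0// ltW.
  by apply: ler_wpM2l => //; apply: ler_weXn2l; rewrite ?ler1n ?leq_subr.
have u0 : 0 <= u by rewrite ler0n.
rewrite ler_norml; apply/andP; split.
  rewrite lerNl opprB; have [h|h] := leP u (2 * T); first by apply: key; lra.
  apply: (@le_trans _ _ 0).
    by rewrite subr_le0; apply: lerXn2r; rewrite ?nnegrE; lra.
  by rewrite !mulr_ge0 ?exprn_ge0// ltW.
have [h|h] := leP (2 * T) u; first by apply: key; lra.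
apply: (@le_trans _ _ 0).
  by rewrite subr_le0; apply: lerXn2r; rewrite ?nnegrE; lra.
by rewrite !mulr_ge0 ?exprn_ge0// ltW.
Qed.

Definition deficient_pairs (R : realType) (n : nat) (T : R) :
    set ('M[int]_n * 'M[int]_n) :=
  [set AB | [/\ (maxnorm AB.1)%:R <= T, (maxnorm AB.2)%:R <= T, (0 < rankQ AB.1)%N,
         (0 < rankQ AB.2)%N & (rankQ AB.1 + rankQ AB.2 < n)%N]].
Arguments deficient_pairs {R} n T.

(** The two matrices are counted independently, forgetting that their product
    vanishes: the exponent [(r + s) * n + 2] is at most [n ^ 2 - 1], as
    [r + s <= n - 1], and [n >= 3] when both ranks are positive. *)
Lemma low_rank_pairs (R : realType) (n : nat) : exists2 K : R, 0 <= K &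
  forall T : R, 1 <= T ->
  (cnt R (deficient_pairs n T) <= (K * T ^+ (n ^ 2 - 1))%:E)%E.
Proof.
have /choice[Kf HK] : forall r, exists K : R, 0 <= K /\ forall T : R, 1 <= T ->
   (0 < r <= n)%N ->
   (cnt R (rankset n T r) <=
    (K * T ^+ (r * n + 1))%:E)%E.
  move=> r; have [h|h] := boolP (0 < r <= n)%N.
    by have [K K0 hK] := rank_count R h; exists K; split=> // T T1 _; exact: hK.
  by exists 0.
exists (\sum_(p <- [seq (r, s) | r <- iota 0 n, s <- iota 0 n]) (Kf p.1 * Kf p.2)).
  by apply: sumr_ge0 => p _; rewrite mulr_ge0// (HK _).1.
move=> T T1; have T0 : 0 <= T by exact: le_trans ler01 T1.
pose F (p : nat * nat) := [set AB : 'M[int]_n * 'M[int]_n |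
   (rankset n T p.1 AB.1 /\ rankset n T p.2 AB.2) /\
   [&& (0 < p.1)%N, (0 < p.2)%N & (p.1 + p.2 < n)%N]].
apply: le_trans (@cnt_bigU_le R _ _ [seq (r, s) | r <- iota 0 n, s <- iota 0 n] _ F _) _.
  move=> [A B] [/= mA mB rA rB rAB]; exists (rankQ A, rankQ B).
    apply/allpairsP; exists (rankQ A, rankQ B); rewrite !mem_iota /=; split=> //; lia.
  by split => //=; rewrite rA rB.
rewrite mulr_suml -sumEFin; apply: lee_sum => -[r s] _ /=.
have [/and3P[r0 s0 rs]|h] := boolP [&& (0 < r)%N, (0 < s)%N & (r + s < n)%N]; last first.
  rewrite (_ : F _ = set0); last first.
    by apply/seteqP; split=> // AB [_ /=]; rewrite (negPf h).
  by rewrite /cnt esum_set0 lee_fin !mulr_ge0 ?(HK _).1// exprn_ge0.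
apply: (@le_trans _ _ ((Kf r * T ^+ (r * n + 1))%:E * (Kf s * T ^+ (s * n + 1))%:E)%E).
  apply: le_trans (@cnt_subset R _ _ [set AB : 'M[int]_n * 'M[int]_n |
   rankset n T r AB.1 /\ rankset n T s AB.2] _) _.
    by move=> AB [].
  rewrite cnt_prod; apply: lee_pmul; rewrite ?cnt_ge0//.
    by apply: (HK r).2 => //; lia.
  by apply: (HK s).2 => //; lia.
rewrite -EFinM lee_fin mulrACA -exprD; apply: ler_wpM2l.
  by rewrite mulr_ge0// (HK _).1.
apply: ler_weXn2l => //.
have h1 : ((r + s) * n <= n.-1 * n)%N by rewrite leq_mul2r; apply/orP; right; lia.
have h2 : (n.-1 * n = n ^ 2 - n)%N by rewrite -subn1 mulnBl mul1n mulnn.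
have h3 : (n <= n ^ 2)%N by rewrite -mulnn leq_pmull//; lia.
rewrite mulnDl in h1; lia.
Qed.

(** * Assembly *)

Lemma tau_cnt (R : realType) (n : nat) (T : R) (M : 'M[int]_n) : 0 <= T ->
  cnt R [set AB : 'M[int]_n * 'M[int]_n | [/\ (maxnorm AB.1)%:R <= T,
    (maxnorm AB.2)%:R <= T & AB.1 *m AB.2 = M]] = (tau T M)%:R%:E.
Proof.
move=> T0; set S := mkset _.
have fS : finite_set S.
  pose box := [set X : 'M[int]_n | forall i j, (`|X i j| <= Num.truncn T)%N].
  have fb : finite_set box := finite_box n n (Num.truncn T).
  apply: sub_finite_set (finite_setX fb fb) => -[A B] [/= mA mB _].
  by split; apply/maxnorm_le; rewrite -nat_le_truncn.
rewrite /cnt esum_fset// fsbig_finite//= big_const_seq count_predT /tau -/S.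
by elim: (size _) => //= k ->; rewrite -EFinD; congr EFin; rewrite -natr1 addrC.
Qed.

Definition full_pairs (R : realType) (n : nat) (T : R) :
    set ('M[int]_n * 'M[int]_n) :=
  [set AB | [/\ (maxnorm AB.1)%:R <= T, (maxnorm AB.2)%:R <= T,
     (0 < rankQ AB.1 < n)%N & sat AB.2^T = orthlattice (sat AB.1)]].
Arguments full_pairs {R} n T.

Lemma rankQ_eq0 (n : nat) (A : 'M[int]_n) : (rankQ A == 0%N) = (A == 0).
Proof.
rewrite mxrank_eq0; apply/eqP/eqP => [h|->]; last by rewrite raddf0.
by apply: (@map_mx_intr_inj rat); rewrite h raddf0.
Qed.

Lemma cnt_full_pairs (R : realType) (n : nat) (T : R) :
  cnt R (full_pairs n T) = (\sum_(1 <= r < n) cnt R (@rank_pairs R n T r))%E.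
Proof.
rewrite (@cnt_fiber_sum R _ _ _ (fun AB : 'M[int]_n * 'M[int]_n => rankQ AB.1)
  [set` index_iota 1 n]); last first.
  by move=> AB [_ _ h _]; rewrite /= mem_index_iota.
rewrite esum_fset; [|exact: finite_seq|by move=> r _; exact: cnt_ge0].
rewrite -fsbig_seq; last exact: iota_uniq.
apply: eq_big_seq => r; rewrite mem_index_iota => hr.
congr (cnt R _); apply/seteqP; split=> AB /=.
  by move=> [[mA mB _ sB] <-].
by move=> [mA mB rA sB]; split=> //; split=> //; rewrite rA.
Qed.

(** Only the pair of zero matrices is counted twice among the solutions with a zero
    factor; hence the 1 in the lower bound. *)
Lemma tau_sandwich (R : realType) (n : nat) (T : R) : (0 < n)%N -> 0 <= T ->
  let M := (((Num.truncn T).*2.+1)%:R ^+ (n ^ 2))%:E in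
  (M + M + cnt R (full_pairs n T) <= (tau T (0 : 'M[int]_n))%:R%:E + 1)%E /\
  ((tau T (0 : 'M[int]_n))%:R%:E <=
     M + (M + (cnt R (full_pairs n T) + cnt R (deficient_pairs n T))))%E.
Proof.
move=> n0 T0 M; rewrite -(tau_cnt _ T0); set S := mkset _.
pose S0 := [set AB : 'M[int]_n * 'M[int]_n | AB.1 = 0 /\ (maxnorm AB.2)%:R <= T].
pose S1 := [set AB : 'M[int]_n * 'M[int]_n | (maxnorm AB.1)%:R <= T /\ AB.2 = 0].
pose O := [set ((0, 0) : 'M[int]_n * 'M[int]_n)].
have c0 : cnt R S0 = M.
  rewrite /M -cnt_maxnorm// (cnt_prod R [set A : 'M[int]_n | A = 0]
    [set B : 'M[int]_n | (maxnorm B)%:R <= T]) {1}/cnt.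
  by rewrite (_ : [set A | A = 0] = [set 0])// esum_set1// mul1e.
have c1 : cnt R S1 = M.
  rewrite /M -cnt_maxnorm// (cnt_prod R [set B : 'M[int]_n | (maxnorm B)%:R <= T]
    [set A : 'M[int]_n | A = 0]) {2}/cnt.
  by rewrite (_ : [set A | A = 0] = [set 0])// esum_set1// mule1.
have cO : cnt R O = 1%E by rewrite /cnt esum_set1.
have max0 : (maxnorm (0 : 'M[int]_n))%:R <= T.
  by rewrite nat_le_truncn//; apply/maxnorm_le => i j; rewrite mxE.
have fullS : full_pairs n T `<=` S.
  by move=> [A B] [mA mB rA /sat_orth_mul0[AB _]]; split.
split.
  rewrite -{1}c0 -c1 -cO !cntE -!esumD//.
  apply: le_esum => -[A B] _; rewrite -!EFinD lee_fin -!natrD ler_nat.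
  have inS : (A, B) \in full_pairs n T -> (A, B) \in S.
    by move=> /set_mem/fullS/mem_set.
  have [A0|An0] := eqVneq A 0.
    rewrite (memNset (_ : ~ full_pairs n T (A, B))); last first.
      by move=> [_ _ /andP[]]; rewrite lt0n rankQ_eq0 /= A0 eqxx.
    have [B0|Bn0] := eqVneq B 0.
      rewrite (mem_set (_ : S (A, B))); last by rewrite A0 B0; split; rewrite //= mul0mx.
      rewrite (mem_set (_ : O (A, B))); last by rewrite A0 B0.
      by case: (_ \in S0); case: (_ \in S1).
    rewrite (memNset (_ : ~ S1 (A, B))); last by move=> [_ /= B0]; rewrite B0 eqxx in Bn0.
    case: (boolP (_ \in S0)) => // /set_mem[_ /= mB].
    by rewrite (mem_set (_ : S (A, B)))//; rewrite A0; split; rewrite //= mul0mx.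
  rewrite (memNset (_ : ~ S0 (A, B))); last by move=> [/= A0]; rewrite A0 eqxx in An0.
  have [B0|Bn0] := eqVneq B 0.
    rewrite (memNset (_ : ~ full_pairs n T (A, B))); last first.
      move=> [_ _ /andP[_ rA] /sat_orth_mul0[_]]; rewrite /= -/(rankQ A) -/(rankQ B).
      have /eqP -> : rankQ B == 0%N by rewrite rankQ_eq0 B0.
      by rewrite addn0 => e; rewrite /= e ltnn in rA.
    case: (boolP (_ \in S1)) => // /set_mem[/= mA _].
    by rewrite (mem_set (_ : S (A, B)))//; rewrite B0; split; rewrite //= mulmx0.
  rewrite (memNset (_ : ~ S1 (A, B))); last by move=> [_ /= B0]; rewrite B0 eqxx in Bn0.
  by case: (boolP (_ \in full_pairs n T)) => // /inS ->.
  by move=> x _; rewrite -EFinD lee_fin.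
apply: (@le_trans _ _ (cnt R S0 + (cnt R S1 +
    (cnt R (full_pairs n T) + cnt R (deficient_pairs n T))))%E); last by rewrite c0 c1.
apply: le_trans (@cntU_le R _ S S0 (S1 `|` (full_pairs n T `|` deficient_pairs n T)) _) _.
  move=> [A B] [/= mA mB AB].
  have [A0|An0] := eqVneq A 0; first by left.
  have [B0|Bn0] := eqVneq B 0; first by right; left.
  have rA : (0 < rankQ A)%N by rewrite lt0n rankQ_eq0.
  have rB : (0 < rankQ B)%N by rewrite lt0n rankQ_eq0.
  have rAB : (rankQ A + rankQ B <= n)%N.
    have : map_mx intr A *m map_mx intr B = 0 :> 'M[rat]_n by rewrite -map_mxM AB raddf0.
    by move=> /mulmx0_rank_max.
  right; right; have [h|h] := ltnP (rankQ A + rankQ B) n; [by right; split|left].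
  have e : (rankQ A + rankQ B = n)%N by apply/eqP; rewrite eqn_leq rAB.
  split=> //=; first by rewrite rA /=; lia.
  exact: mul0_sat_orth.
apply: leeD => //; apply: le_trans (@cntU_le R _ _ S1 _ (fun x h => h)) _.
by apply: leeD => //; exact: cntU_le.
Qed.

Theorem theorem1p5 (R : realType) (n : nat) (hn : (2 <= n)%N) :
  [/\ c_zero R n \is a fin_num,
      0 < fine (c_zero R n)
    & exists K : R, forall T : R, 1 <= T ->
        `| (tau T (0 : 'M[int]_n))%:R - fine (c_zero R n) * T ^+ (n ^ 2)%N |
          <= K * T ^+ (n ^ 2 - 1)%N].
Proof.
have n0 : (0 < n)%N by exact: leq_trans hn.
have /choice[te Hte] : forall r, exists te : R * R, (0 < r < n)%N ->
    [/\ \esum_(L in @primitive n r) (main_term R L)%:E = te.1%:E, 0 <= te.1,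
    0 <= te.2 & forall T : R, 1 <= T -> exists2 g : R,
      cnt R (@rank_pairs R n T r) = g%:E &
      `|g - te.1 * T ^+ (n ^ 2)| <= te.2 * T ^+ (n ^ 2 - 1)].
  move=> r; have [h|h] := boolP (0 < r < n)%N; last by exists (0, 0).
  by have [t [e H]] := rank_pairs_asymp R hn h; exists (t, e).
pose t := \sum_(1 <= r < n) (te r).1; pose e := \sum_(1 <= r < n) (te r).2.
have t0 : 0 <= t.
  rewrite /t big_seq; apply: sumr_ge0 => r; rewrite mem_index_iota => /Hte[_ t0 _ _].
  exact: t0.
have cE : c_zero R n = (2 ^+ (n ^ 2 + 1) + t)%:E.
  rewrite /c_zero EFinD; congr (_ + _)%E; rewrite /t -sumEFin.
  apply: eq_big_seq => r; rewrite mem_index_iota => /Hte[<- _ _ _].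
  by [].
rewrite cE; split => //=; first by rewrite ltr_wpDr// exprn_gt0.
have [Kd Kd0 HKd] := low_rank_pairs R n.
have m0 : (0 < n ^ 2)%N by rewrite expn_gt0 n0.
pose k : R := (n ^ 2)%N%:R * 3 ^+ (n ^ 2).
exists (2 * k + e + Kd + 1) => T T1.
have T0 : 0 <= T by exact: le_trans ler01 T1.
have [low up] := @tau_sandwich R n T n0 T0.
have box := box_asymp T1 m0; rewrite -/k in box.
set M : R := (Num.truncn T).*2.+1%:R ^+ (n ^ 2) in low up box.
have /choice[gf Hg] : forall r, exists g : R, (0 < r < n)%N ->
    cnt R (@rank_pairs R n T r) = g%:E /\
      `|g - (te r).1 * T ^+ (n ^ 2)| <= (te r).2 * T ^+ (n ^ 2 - 1).
  move=> r; have [h|h] := boolP (0 < r < n)%N; last by exists 0.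
  by have [_ _ _ /(_ T T1)[g g1 g2]] := Hte r h; exists g.
pose g := \sum_(1 <= r < n) gf r.
have gE : cnt R (full_pairs n T) = g%:E.
  rewrite cnt_full_pairs /g -sumEFin.
  by apply: eq_big_seq => r; rewrite mem_index_iota => /Hg[].
have hg : `|g - t * T ^+ (n ^ 2)| <= e * T ^+ (n ^ 2 - 1).
  rewrite /g /t /e !mulr_suml -sumrB; apply: le_trans (ler_norm_sum _ _ _) _.
  rewrite big_seq [leRHS]big_seq; apply: ler_sum => r; rewrite mem_index_iota.
  by move=> /Hg[].
have hd := HKd T T1.
have df : cnt R (deficient_pairs n T) \is a fin_num.
  by rewrite ge0_fin_numE ?cnt_ge0//; apply: le_lt_trans hd _; rewrite ltry.
move: low up hd; rewrite gE -(fineK df) -!EFinD !lee_fin.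
set d := fine _; set N := (tau T 0)%:R => low up hd.
have d0 : 0 <= d by exact/fine_ge0/cnt_ge0.
have P1 : 1 <= T ^+ (n ^ 2 - 1) by exact: exprn_ege1.
have e2 : 2 ^+ (n ^ 2 + 1) * T ^+ (n ^ 2) = 2 * (2 * T) ^+ (n ^ 2).
  by rewrite exprD expr1 exprMn; ring.
have -> : (2 * k + e + Kd + 1) * T ^+ (n ^ 2 - 1) =
    2 * (k * T ^+ (n ^ 2 - 1)) + e * T ^+ (n ^ 2 - 1) + Kd * T ^+ (n ^ 2 - 1) +
    T ^+ (n ^ 2 - 1) by ring.
rewrite [X in _ - X]mulrDl e2; move: box hg hd P1; rewrite !ler_norml.
set P := T ^+ (n ^ 2 - 1); set Q := (2 * T) ^+ _; set tT := t * _.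
move: (k * P) (e * P) (Kd * P) => kP eP dP /andP[b1 b2] /andP[g1 g2] hd P1.
by apply/andP; split; lra.
Qed.
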